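(* There exist a lacunary sequence $\{n_j\}_{j\in\mathbb N}\subset\mathbb N$ and a sequence of positive functions $\{f_k\}_{k\in\mathbb N}$ on $\mathbb T$ such that the following hold: (1) each $f_k\in L^\infty(\mathbb T)$, and $\|f_k\|_{L\log\log L}\approx 1$, i.e. there are constants $0<c\le c'<\infty$ independent of $k$ with $c\le \|f_k\|_{L\log\log L}\le c'$ for all $k$; (2) $\lim_{k\to\infty}\|f_k\|_{L\log\log L\,\log\log\log\log L}=\infty$; (3) there exists an absolute constant $C>0$ such that for every $k\in\mathbb N$ $$\|C_{lac}^{\{n_j\}_j}(f_k)\|_{L^{1,\infty}}\ \ge\ C\,\|f_k\|_{L\log\log L\,\log\log\log\log L}.$$
   Context: $\mathbb T=\mathbb R/\mathbb Z$ is identified with $[0,1]$ (or $[-\tfrac12,\tfrac12]$) with Lebesgue measure $|\cdot|$; $\log=\log_2$. ''Positive function'' means $f\ge 0$ (not identically zero). A sequence $\{n_j\}_{j\in\mathbb N}\subset\mathbb N$ is lacunary if $\liminf_{j\to\infty} n_{j+1}/n_j>1$. The $\{n_j\}$-lacunary Carleson operator is $$C_{lac}^{\{n_j\}_j}f(x)=\sup_{j\in\mathbb N}\left|\int_{\mathbb T}e^{2\pi i n_j(x-y)}\cot(\pi(x-y))\,f(y)\,dy\right|,$$ the integral being taken in the principal value sense. $\|f\|_{1,\infty}=\|f\|_{L^{1,\infty}}=\sup_{\lambda>0}\lambda\,|\{x\in\mathbb T:|f(x)|>\lambda\}|$. For measurable $f$ on $\mathbb T$, $f^*(t)=\inf\{\lambda\ge0: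 |\{|f|>\lambda\}|\le t\}$ is its decreasing rearrangement. For a nondecreasing concave $\varphi:[0,1]\to[0,\infty)$ with $\varphi(0)=0$, the Lorentz space $\Lambda_\varphi$ consists of all measurable $f$ with $\|f\|_{\Lambda_\varphi}=\int_0^1 f^*(s)\,d\varphi(s)<\infty$. $L\log\log L$ denotes $\Lambda_\mu$ with $\mu(s)=s\log\log\frac4s$, and $L\log\log L\,\log\log\log\log L$ denotes $\Lambda_{\varphi_0}$ with $\varphi_0(s)=s\,\log\log\frac{17}{s}\,\log\log\log\log\frac{17}{s}$ (both functions being $0$ at $s=0$). Away from $0$, where these formulas may fail to be monotone or concave, they are replaced by any nondecreasing concave functions on $[0,1]$ which agree with them near $0$; different choices give equivalent norms. *)

(* Defs.v *)
From mathcomp Require Import all_boot all_order all_algebra.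
From mathcomp Require Import all_classical all_reals all_analysis.
From mathcomp.real_closed Require Import complex.
Set Implicit Arguments.
Unset Strict Implicit.
Unset Printing Implicit Defensive.
Import Order.TTheory GRing.Theory Num.Theory.
Import numFieldNormedType.Exports.

Local Open Scope classical_set_scope.
Local Open Scope complex_scope.
Local Open Scope ring_scope.
Local Open Scope ereal_scope.

(** A function on the circle R/Z is represented by a 1-periodic function on R;
    the circle carries Lebesgue measure restricted to the fundamental domain
    [0, 1[. *)
Section Circle.
Context {R : realType}.

Definition torus_measure : {measure set (measurableTypeR R) -> \bar R} :=
  mrestr (@lebesgue_measure R) (measurable_itv `[0%R, 1%R[).

Definition positive_fun (f : R -> R) : Prop :=
  (forall x, 0 <= f x)%R /\ (exists x, f x != 0)%R.

(** Extended-real-valued, since it is applied to a supremum of a sequence of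
    functions. *)
Definition weak_L1 (g : R -> \bar R) : \bar R :=
  ereal_sup [set l%:E * torus_measure [set x | l%:E < `|g x|]
            | l in [set l : R | 0 < l]%R].

Definition rearrangement (f : R -> R) (t : R) : \bar R :=
  ereal_inf [set l%:E | l in
    [set l : R | (0 <= l)%R /\ torus_measure [set x | (l < `|f x|)%R] <= t%:E]].

End Circle.

Section Lorentz.
Context {R : realType}.

(** Base-2 logarithm; only used where the argument is positive. *)
Definition log2 (x : R) : R := (ln x / ln 2)%R.

(** [cumulative] provides monotonicity and right-continuity. Only the values
    on [0, 1] matter: a nondecreasing concave function on [0, 1] that is
    continuous at 0 is right-continuous on [0, 1[, and its extension by
    constants is [cumulative], so no such function is excluded. *)
Definition lorentz_weight (phi : cumulative R R) : Prop :=
  phi 0%R = 0%R /\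
  convex_function (`[0%R, 1%R]%classic : set R^o) (fun s : R^o => - phi s)%R.

(** As [phi] is right-continuous with [phi 0 = 0], it has no atom at 0 on the
    side of [0, 1]. Integrating over ]0, 1] makes the result independent of
    the values of [phi] on negative numbers. *)
Definition lorentz_norm (phi : cumulative R R) (f : R -> R) : \bar R :=
  \int[lebesgue_stieltjes_measure phi]_(s in `]0%R, 1%R]) rearrangement f s.

Definition LloglogL_weight (phi : cumulative R R) : Prop :=
  lorentz_weight phi /\
  \forall s \near 0^'+, phi s = (s * log2 (log2 (4 / s)))%R.

Definition LloglogLloglogloglogL_weight (phi : cumulative R R) : Prop :=
  lorentz_weight phi /\
  \forall s \near 0^'+, phi s =
    (s * log2 (log2 (17 / s)) * log2 (log2 (log2 (log2 (17 / s)))))%R.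

End Lorentz.

Section LacunaryCarleson.
Context {R : realType}.
Local Open Scope ring_scope.

Definition lacunary (n : nat -> nat) : Prop :=
  (forall j, 0 < n j)%N /\
  (1 < limn_einf (fun j => ((n j.+1)%:R / (n j)%:R : R)%:E))%E.

Definition cis (t : R) : R[i] := cos t +i* sin t.

Definition cot (t : R) : R := cos t / sin t.

Definition Cintegral (D : set R) (g : R -> R[i]) : R[i] :=
  (\int[lebesgue_measure]_(y in D) complex.Re (g y))%R +i*
  (\int[lebesgue_measure]_(y in D) complex.Im (g y))%R.

(** By periodicity the circle is cut at the antipode of [x], so that
    [|x - y|] is the distance on the circle, and a symmetric neighbourhood of
    the singularity [y = x] is removed. For [f] integrable on the circle the
    principal value exists for almost every [x]; elsewhere [lim] returns 0. *)
Definition modulated_hilbert (n : nat) (f : R -> R) (x : R) : R[i] :=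
  lim ((Cintegral [set y | e < `|x - y| <= 2^-1]
        (fun y => cis (2 * pi * n%:R * (x - y)) *
                  (cot (pi * (x - y)) * f y)%:C) : R[i]^o) @[e --> 0^'+]).

Definition carleson_lac (n : nat -> nat) (f : R -> R) (x : R) : \bar R :=
  ereal_sup (range (fun j => (Normc.normc (modulated_hilbert (n j) f x))%:E)).

End LacunaryCarleson.

Arguments lacunary R n : clear implicits.

(* Main.v *)
From HB Require Import structures.
Require Import Defs.
From mathcomp Require Import all_boot all_order all_algebra.
From mathcomp Require Import all_classical all_reals all_analysis.
From mathcomp Require Import measurable_realfun.
From mathcomp.real_closed Require Import complex.
From mathcomp Require Import ring lra zify.
Set Implicit Arguments.
Unset Strict Implicit.
Unset Printing Implicit Defensive.
Import Order.TTheory GRing.Theory Num.Theory.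
Import numFieldNormedType.Exports.
Local Open Scope classical_set_scope.
Local Open Scope ring_scope.

(** The lacunary sequence is [8 ^ j], and [f_k] is the step function [extremizer L],
    with [L] equal to [k] plus a constant.  Everything lives in the arc from [0] to
    [1/8] of the circle, where distances are at most [1/8] and [cot (pi u)] is
    comparable to [1 / u]; the arc is described by [t = 8 y] in the unit interval.

    For a number [J] of levels, exponential in [L], and scales [K_j = 2 ^ (J + j)], the
    function takes the value [v_j = 8 ^ M_j / K_j] on a set [E_j] whose measure is
    comparable to [8 ^- M_j / J], where [M_j] lies between [2 ^ K_j] and [2 ^ (4 K_j)].
    So [log log (1 / |E_j|)] is of order [K_j], each level contributes a constant
    times [1 / J] to the norm in [L log log L], and all of them together a constant.
    As [J = 2 ^ (10 L - 1)], two more logarithms of [K_j] are of order [L]: the norm in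
    the smaller space is of order [L] ([loglog_bound], [loglogloglog_bound],
    [lorentz_norm_bounds]).

    It remains to see that the operator is at least a constant times [L] on a set
    of measure bounded below.  The unit interval is cut by a tree ([system]), with a
    large constant [g] ([ratio]) and [J = g ^ L / 2].  At level [j] one passes through a
    tower of [L] steps; at each step a cell is cut into [g 2 ^ K_j] subcells, grouped in
    [2 ^ K_j] windows of [g] subcells.  The first subcell of a window goes on to the next
    step; from each of the others one exits, to level [j - 1].  The cells that survive
    all [L] steps carry the value [v_j], at the points with [M_j] prescribed digits in
    base 8; the cells that exit from every level are the free leaves.

    A free leaf [F] has an index [i], and is tested with the frequency [8 ^ (c + i)].
    At every level, the surviving cells in the windows around the exit of [F] prescribe
    the digit of [y] at position [c + i]: it is 1 to the left of [F], which makes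
    [sin (2 pi 8 ^ (c + i) y)] at least [1/2], and 5 to the right, which makes it at most
    [- 1/2].  So the sine agrees in sign with [cot (pi (x - y))], and there is no
    cancellation: with density [1 / K_j], the windows at distances [1, 2, 3, ...] up to
    [2 ^ K_j] contribute [1 / K_j] times a harmonic sum, which is a constant, times the
    proportion [g ^- r] of a subcell that survives the [r] steps that are left
    ([exit_step]).  In the earlier steps of the same tower the digits may be wrong, but
    there [x] is at least [g - 1] subcells away from the other windows, which makes
    the loss much smaller than the gain ([stay_step], [tower_gain]).  Mass that
    prescribes no digit at position [c + i] only contributes an oscillation error,
    which is negligible when the shift [c] is large ([inactive_sum],
    [leaf_estimate]).

    Hence the operator at [F] is at least a constant times the sum over the levels of
    [g ^- r_j], the gain of [F] ([leaves_gain]), where [r_j] is the number of steps left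
    at the exit from level [j].  The [r_j] are independent, and [r_j = r] with probability
    about [g ^- (L - r - 1)].  So each level has an expected gain of about [g L / g ^ L],
    and the [J] levels together of about [g L / 2].  An exponential moment shows that the
    gain is at least [L] on free leaves of total length at least [1/4]
    ([good_length]); this gives the lower bound of the weak norm ([weak_L1_ge]). *)

(** * Harmonic sums *)

Section Harmonic.
Context {R : realFieldType}.

Definition harmonic_sum (n : nat) : R := \sum_(0 <= i < n) i.+1%:R^-1.

Lemma harmonic_sum_le m n : (m <= n)%N -> harmonic_sum m <= harmonic_sum n.
Proof.
move=> mn; rewrite /harmonic_sum (big_cat_nat (n := m) (p := n)) //= lerDl.
by apply: sumr_ge0 => i _; rewrite invr_ge0.
Qed.

Lemma harmonic_sum_pow2_ge k : k.+1%:R / 2 <= harmonic_sum (2 ^ k).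
Proof.
elim: k => [|k IH]; first by rewrite /harmonic_sum big_nat1 invr1; lra.
have h : (2 ^ k <= 2 ^ k.+1)%N by rewrite leq_exp2l.
rewrite /harmonic_sum (big_cat_nat (n := 2 ^ k) (p := 2 ^ k.+1)) //=.
rewrite -[X in X + _]/(harmonic_sum (2 ^ k)).
suff : 2^-1 <= \sum_(2 ^ k <= i < 2 ^ k.+1) i.+1%:R^-1 :> R.
  move: IH; rewrite -[k.+2]addn1 natrD; lra.
have -> : 2^-1 = \sum_(2 ^ k <= i < 2 ^ k.+1) (2 ^ k.+1)%:R^-1 :> R.
  rewrite sumr_const_nat (_ : 2 ^ k.+1 - 2 ^ k = 2 ^ k)%N; last by rewrite expnS; lia.
  rewrite -[RHS]mulr_natl expnS natrM invfM mulrCA divff ?mulr1 //.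
rewrite !big_nat; apply: ler_sum => i /andP[_ hi].
by rewrite lef_pV2 ?posrE ?ltr0n ?expn_gt0 // ler_nat.
Qed.

Lemma harmonic_sum_pow2_le k : harmonic_sum (2 ^ k) <= k.+1%:R.
Proof.
elim: k => [|k IH]; first by rewrite /harmonic_sum big_nat1 invr1; lra.
have h : (2 ^ k <= 2 ^ k.+1)%N by rewrite leq_exp2l.
rewrite /harmonic_sum (big_cat_nat (n := 2 ^ k) (p := 2 ^ k.+1)) //=.
rewrite -[X in X + _]/(harmonic_sum (2 ^ k)).
suff : \sum_(2 ^ k <= i < 2 ^ k.+1) i.+1%:R^-1 <= 1 :> R.
  move: IH; rewrite -[k.+2]addn1 natrD; lra.
rewrite [leRHS](_ : 1 = \sum_(2 ^ k <= i < 2 ^ k.+1) (2 ^ k)%:R^-1); last first.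
  rewrite sumr_const_nat (_ : 2 ^ k.+1 - 2 ^ k = 2 ^ k)%N; last by rewrite expnS; lia.
  rewrite -[RHS]mulr_natl.
  by rewrite divff // pnatr_eq0 -lt0n expn_gt0.
rewrite !big_nat; apply: ler_sum => i /andP[hi _].
by rewrite lef_pV2 ?posrE ?ltr0n ?expn_gt0 // ler_nat ltnW.
Qed.

Lemma sum_inv_left k : \sum_(0 <= i < k) (k - i)%:R^-1 = harmonic_sum k :> R.
Proof.
rewrite /harmonic_sum big_nat_rev /= !big_nat; apply: eq_bigr => i hi.
by congr (_%:R^-1); lia.
Qed.

Lemma sum_inv_right k n : (k < n)%N ->
  \sum_(k.+1 <= i < n) (i - k)%:R^-1 = harmonic_sum (n - k.+1) :> R.
Proof.
move=> kn; rewrite /harmonic_sum -{1}[k.+1]add0n big_addn !big_nat.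
by apply: eq_bigr => i hi; congr (_%:R^-1); lia.
Qed.

Definition ndist (a b : nat) : nat := (a - b + (b - a))%N.

(** The two sides of [k] are harmonic sums of at most [2 ^ n] terms each. *)
Lemma sum_inv_dist_le n k : (k < 2 ^ n)%N ->
  \sum_(0 <= i < 2 ^ n | i != k) (ndist i k)%:R^-1 <= 2 * n.+1%:R :> R.
Proof.
move=> kn; rewrite (big_cat_nat (n := k)) //=; last exact: ltnW.
rewrite [X in _ + X]big_ltn_cond //= eqxx /=.
have -> : \sum_(0 <= i < k | i != k) (ndist i k)%:R^-1 = harmonic_sum k :> R.
  rewrite -sum_inv_left big_nat_cond [RHS]big_nat.
  by apply: eq_big => i; rewrite /ndist; [lia|move=> hi; congr (_%:R^-1); lia].
have -> : \sum_(k.+1 <= i < 2 ^ n | i != k) (ndist i k)%:R^-1 =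
    harmonic_sum (2 ^ n - k.+1) :> R.
  rewrite -sum_inv_right // big_nat_cond [RHS]big_nat.
  by apply: eq_big => i; rewrite /ndist; [lia|move=> hi; congr (_%:R^-1); lia].
have h1 := @harmonic_sum_le k (2 ^ n)%N (ltnW kn).
have h2 : harmonic_sum (2 ^ n - k.+1) <= harmonic_sum (2 ^ n).
  by apply: harmonic_sum_le; rewrite leq_subr.
have := harmonic_sum_pow2_le n; lra.
Qed.

(** One of the two sides of [k] has at least half of the points, hence a
    harmonic sum of at least [2 ^ n.-1] terms. *)
Lemma sum_inv_dist_ge n k : (k < 2 ^ n)%N ->
  n%:R / 2 <= \sum_(0 <= i < 2 ^ n) (ndist i k).+1%:R^-1 :> R.
Proof.
case: n => [|n] kn; first by rewrite mul0r; apply: sumr_ge0 => i _; rewrite invr_ge0.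
apply: le_trans (harmonic_sum_pow2_ge n) _.
have nonneg a b : 0 <= \sum_(a <= i < b) (ndist i k).+1%:R^-1 :> R.
  by apply: sumr_ge0 => i _; rewrite invr_ge0.
have h2 : (2 ^ n.+1 = 2 ^ n + 2 ^ n)%N by rewrite expnS mul2n addnn.
have [hk|hk] := leqP (2 ^ n) k.
  rewrite (big_cat_nat (n := k.+1)) //=.
  apply: ler_wpDr => //.
  rewrite (_ : \sum_(0 <= i < k.+1) _ = harmonic_sum k.+1); last first.
    rewrite -sum_inv_left [LHS]big_nat [RHS]big_nat; apply: eq_bigr => i hi.
    by congr (_%:R^-1); rewrite /ndist; lia.
  by apply: harmonic_sum_le; lia.
rewrite (big_cat_nat (n := k)) //=; last exact: ltnW.
apply: ler_wpDl => //.
rewrite (_ : \sum_(k <= i < 2 ^ n.+1) _ = harmonic_sum (2 ^ n.+1 - k)); last first.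
  rewrite /harmonic_sum -{1}[k]add0n big_addn [LHS]big_nat [RHS]big_nat.
  by apply: eq_bigr => i hi; congr (_%:R^-1); rewrite /ndist; lia.
by apply: harmonic_sum_le; lia.
Qed.

Lemma sum_blocks g n (F : nat -> R) :
  \sum_(0 <= k < n) \sum_(0 <= e < g) F (g * k + e)%N = \sum_(0 <= b < g * n) F b.
Proof.
elim: n => [|n IH]; first by rewrite muln0 !big_nil.
rewrite big_nat_recr //= IH (@big_cat_nat _ _ _ (g * n) 0 (g * n.+1)) //=; last first.
  by rewrite mulnS leq_addl.
congr (_ + _); rewrite -{2}[(g * n)%N]add0n big_addn mulnS addnK.
by apply: eq_bigr => i _; rewrite addnC.
Qed.

End Harmonic.

(** * The tree of cells *)

Section Leaves.
Context {R : realFieldType}.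

(** A cell that carries mass: [mlev] is its level, and the points of it where
    the function does not vanish have the digits [mdig] at the consecutive
    base 8 positions from [moff] on, up to a shift common to all leaves;
    [true] stands for the digit 1 and [false] for the digit 5. *)
Record mleaf := MLeaf
  { mpos : R; mlen : R; mlev : nat; moff : nat; mdig : seq bool }.

(** A cell on which the function vanishes and the operator is tested: [fidx]
    determines the frequency, and [fgain] is the lower bound obtained there,
    up to a constant factor. *)
Record fleaf := FLeaf { fpos : R; flen : R; fidx : nat; fgain : R }.

Definition mleaf_tuple (l : mleaf) := (mpos l, mlen l, mlev l, moff l, mdig l).
Definition tuple_mleaf (t : R * R * nat * nat * seq bool) :=
  let: (p, l, j, o, d) := t in MLeaf p l j o d.
Lemma mleaf_tupleK : cancel mleaf_tuple tuple_mleaf. Proof. by case. Qed.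
HB.instance Definition _ := Equality.copy mleaf (can_type mleaf_tupleK).

Definition fleaf_tuple (l : fleaf) := (fpos l, flen l, fidx l, fgain l).
Definition tuple_fleaf (t : R * R * nat * R) :=
  let: (p, l, i, s) := t in FLeaf p l i s.
Lemma fleaf_tupleK : cancel fleaf_tuple tuple_fleaf. Proof. by case. Qed.
HB.instance Definition _ := Equality.copy fleaf (can_type fleaf_tupleK).

Definition subcell_pos (B b : nat) (p : R) : R := (b%:R + p) / B%:R.

Definition mplace B b l :=
  MLeaf (subcell_pos B b (mpos l)) (mlen l / B%:R) (mlev l) (moff l) (mdig l).
Definition mshift o l :=
  MLeaf (mpos l) (mlen l) (mlev l) (o + moff l)%N (mdig l).
Definition mappend d l :=
  MLeaf (mpos l) (mlen l) (mlev l) (moff l) (mdig l ++ d).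
Definition fplace B b l :=
  FLeaf (subcell_pos B b (fpos l)) (flen l / B%:R) (fidx l) (fgain l).
Definition fshift o s l :=
  FLeaf (fpos l) (flen l) (o + fidx l)%N (s + fgain l).

End Leaves.
Arguments mleaf R : clear implicits.
Arguments fleaf R : clear implicits.

Section Branch.
Variables (g N : nat).

(** The subcells of a cell are numbered [g * k + e], where [k] is the
    window and [e] the place in the window; [e = 0] means that one stays in
    the tower. *)
Definition branch T (stay exit : nat -> seq T) : seq T :=
  flatten [seq stay k ++ flatten [seq exit (g * k + e)%N | e <- index_iota 1 g]
          | k <- index_iota 0 N].

Lemma big_branch (R : nmodType) T (stay exit : nat -> seq T) (F : T -> R) :
  \sum_(l <- branch stay exit) F l =
  \sum_(0 <= k < N) (\sum_(l <- stay k) F l +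
     \sum_(1 <= e < g) \sum_(l <- exit (g * k + e)%N) F l).
Proof.
rewrite big_flatten big_map; apply: eq_bigr => k _.
by rewrite big_cat big_flatten big_map.
Qed.

Lemma big_branch_stay (R : nmodType) T (stay : nat -> seq T) (F : T -> R) :
  \sum_(l <- branch stay (fun=> [::])) F l =
  \sum_(0 <= k < N) \sum_(l <- stay k) F l.
Proof.
rewrite big_branch; apply: eq_bigr => k _.
by rewrite [X in _ + X]big1 ?addr0 // => e _; rewrite big_nil.
Qed.

Lemma mem_branch (T : eqType) (stay exit : nat -> seq T) (l : T) :
  l \in branch stay exit ->
  (exists2 k, (k < N)%N & l \in stay k) \/
  (exists k e, [/\ (k < N)%N, (0 < e < g)%N & l \in exit (g * k + e)%N]).
Proof.
move=> /flattenP[s /mapP[k]]; rewrite mem_index_iota /= => kN ->.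
rewrite mem_cat => /orP[lk|/flattenP[t /mapP[e]]]; first by left; exists k.
by rewrite mem_index_iota => eg -> le; right; exists k, e.
Qed.

End Branch.

Section Tower.
Context {R : realFieldType}.
Variables (g N M lev : nat).
Variables (msub : seq (mleaf R)) (fsub : seq (fleaf R)).

Let B := (g * N)%N.

(** The positions [b * M, ..., b * M + M - 1] belong to the leaves
    that exit through subcell [b]. The digit that window [k] prescribes there
    records whether the window lies to the left of [b], which is the sign of
    the kernel [cot (pi (x - y))] for [x] in subcell [b] and [y] in the
    window. *)
Definition side_pattern (k : nat) : seq bool :=
  mkseq (fun t => g * k < t %/ M)%N (B * M).

(** The cells that stay through all [r] steps, in a tower whose subcells
    number [B = g * N]. *)
Fixpoint tower_top (r : nat) : seq (mleaf R) :=
  if r is r'.+1 then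
    branch g N
      (fun k => [seq mplace B (g * k) (mappend (side_pattern k) l)
                | l <- tower_top r'])
      (fun=> [::])
  else [:: MLeaf 0 1 lev 0 [::]].

(** The mass leaves of lower levels, one copy of [msub] for each exit. The
    shift [(r' * B + b) * M] gives separate ranges of positions to the
    exits of one cell; the exits with the same number [b] in different windows
    of an earlier step share their range, which keeps the number of positions
    small. *)
Fixpoint tower_low (r : nat) : seq (mleaf R) :=
  if r is r'.+1 then
    branch g N
      (fun k => [seq mplace B (g * k) l | l <- tower_low r'])
      (fun b => [seq mplace B b (mshift ((r' * B + b) * M) l) | l <- msub])
  else [::].

(** An exit with [r'] steps left gains [g ^- r'], the proportion of a
    subcell that survives those steps. *)
Fixpoint tower_free (r : nat) : seq (fleaf R) :=
  if r is r'.+1 then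
    branch g N
      (fun k => [seq fplace B (g * k) l | l <- tower_free r'])
      (fun b => [seq fplace B b (fshift ((r' * B + b) * M) (g%:R ^- r') l)
                | l <- fsub])
  else [::].

Hypothesis (g_gt1 : (1 < g)%N) (N_gt0 : (0 < N)%N).

Let B_gt0 : 0 < B%:R :> R. Proof. by rewrite ltr0n muln_gt0 N_gt0; lia. Qed.
Let B_neq0 : B%:R != 0 :> R. Proof. exact: lt0r_neq0. Qed.

Definition in_unit (p l : R) := [&& 0 <= p, 0 < l & p + l <= 1].

Lemma in_unit_subcell b p l : (b < B)%N -> in_unit p l ->
  in_unit (subcell_pos B b p) (l / B%:R).
Proof.
move=> bB /and3P[p0 l0 pl]; rewrite /in_unit /subcell_pos.
have : b.+1%:R <= B%:R :> R by rewrite ler_nat.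
rewrite -natr1 => bB'; apply/and3P; split; last 1 first.
- by rewrite -mulrDl ler_pdivrMr // mul1r; lra.
- by rewrite divr_ge0 ?addr_ge0 // ltW.
- by rewrite divr_gt0.
Qed.

Lemma stay_lt k : (k < N)%N -> (g * k < B)%N.
Proof. by move=> kN; rewrite /B ltn_pmul2l //; lia. Qed.

Lemma exit_lt k e : (k < N)%N -> (0 < e < g)%N -> (g * k + e < B)%N.
Proof. by move=> kN eg; rewrite /B; nia. Qed.

Lemma tower_top_unit r l : l \in tower_top r -> in_unit (mpos l) (mlen l).
Proof.
elim: r l => [|r IH] l; first by rewrite inE => /eqP->; rewrite /in_unit /=; lra.
case/mem_branch => [[k kN /mapP[l' /IH h ->]]|[k [e []]]//].
exact/in_unit_subcell/h/stay_lt.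
Qed.

Lemma tower_low_unit r l : {in msub, forall l, in_unit (mpos l) (mlen l)} ->
  l \in tower_low r -> in_unit (mpos l) (mlen l).
Proof.
move=> hs; elim: r l => [//|r IH] l.
case/mem_branch => [[k kN /mapP[l' /IH h ->]]|[k [e [kN eg /mapP[l' /hs h ->]]]]].
  exact/in_unit_subcell/h/stay_lt.
exact/in_unit_subcell/h/exit_lt.
Qed.

Lemma tower_free_unit r l : {in fsub, forall l, in_unit (fpos l) (flen l)} ->
  l \in tower_free r -> in_unit (fpos l) (flen l).
Proof.
move=> hs; elim: r l => [//|r IH] l.
case/mem_branch => [[k kN /mapP[l' /IH h ->]]|[k [e [kN eg /mapP[l' /hs h ->]]]]].
  exact/in_unit_subcell/h/stay_lt.
exact/in_unit_subcell/h/exit_lt.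
Qed.

Lemma tower_top_label r l : l \in tower_top r ->
  [/\ mlev l = lev, moff l = 0%N & size (mdig l) = (r * (B * M))%N].
Proof.
elim: r l => [|r IH] l; first by rewrite inE => /eqP->.
case/mem_branch => [[k kN /mapP[l' /IH[h1 h2 h3] ->]]|[k [e []]]//].
by split=> //=; rewrite size_cat size_mkseq h3; lia.
Qed.

Lemma tower_low_label (P : nat -> nat -> Prop) r l :
  {in msub, forall l, P (mlev l) (size (mdig l))} ->
  l \in tower_low r -> P (mlev l) (size (mdig l)).
Proof.
move=> hs; elim: r l => [//|r IH] l.
by case/mem_branch => [[k kN /mapP[l' /IH h ->]]|[k [e [kN eg /mapP[l' /hs h ->]]]]].
Qed.

Lemma tower_low_range r l :
  {in msub, forall l, (moff l + size (mdig l) <= M)%N} ->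
  l \in tower_low r -> (moff l + size (mdig l) <= r * (B * M))%N.
Proof.
move=> hs; elim: r l => [//|r IH] l.
case/mem_branch => [[k kN /mapP[l' /IH h ->]]|[k [e [kN eg /mapP[l' /hs h ->]]]]] /=.
  by lia.
by have := exit_lt kN eg; nia.
Qed.

Lemma tower_free_range r l : {in fsub, forall l, (fidx l < M)%N} ->
  l \in tower_free r -> (fidx l < r * (B * M))%N.
Proof.
move=> hs; elim: r l => [//|r IH] l.
case/mem_branch => [[k kN /mapP[l' /IH h ->]]|[k [e [kN eg /mapP[l' /hs h ->]]]]] /=.
  by lia.
by have := exit_lt kN eg; nia.
Qed.

Lemma sum_stay (c : R) : \sum_(0 <= k < N) (c / B%:R) = c / g%:R.
Proof.
rewrite sumr_const_nat subn0 -[LHS]mulr_natr /B natrM.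
have gn0 : g%:R != 0 :> R by rewrite pnatr_eq0; lia.
have Nn0 : N%:R != 0 :> R by rewrite pnatr_eq0; lia.
by field; rewrite gn0 Nn0.
Qed.

Lemma sum_exit (c : R) :
  \sum_(0 <= k < N) \sum_(1 <= e < g) (c / B%:R) = (1 - g%:R^-1) * c.
Proof.
under eq_bigr do rewrite sumr_const_nat -[_ *+ (g - 1)]mulr_natl mulrA.
rewrite sum_stay natrB; last lia.
have gn0 : g%:R != 0 :> R by rewrite pnatr_eq0; lia.
by field.
Qed.

Lemma tower_top_length r : \sum_(l <- tower_top r) mlen l = g%:R ^- r.
Proof.
elim: r => [|r IH]; first by rewrite big_seq1 expr0 invr1.
rewrite big_branch_stay.
under eq_bigr do rewrite big_map -mulr_suml IH.
by rewrite sum_stay exprSr invfM.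
Qed.

Lemma tower_low_length i r :
  \sum_(l <- tower_low r) (mlev l == i)%:R * mlen l =
  (1 - g%:R ^- r) * \sum_(l <- msub) (mlev l == i)%:R * mlen l.
Proof.
set S := \sum_(l <- msub) _.
elim: r => [|r IH]; first by rewrite big_nil expr0 invr1 subrr mul0r.
rewrite big_branch big_split /=.
under eq_bigr do (rewrite big_map; under eq_bigr do rewrite /= mulrA;
  rewrite -mulr_suml IH).
under [X in _ + X]eq_bigr do under eq_bigr do
  (rewrite big_map; under eq_bigr do rewrite /= mulrA; rewrite -mulr_suml).
rewrite sum_stay sum_exit -/S exprSr invfM; ring.
Qed.

(** The number of steps left at the exit and the position inside the exit are
    independent; the sum over [u] is over the first of them. *)
Lemma tower_free_sum (w : R -> R) r :
  (forall x y, w (x + y) = w x * w y) ->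
  \sum_(l <- tower_free r) flen l * w (fgain l) =
  (\sum_(0 <= u < r) g%:R ^- (r - u.+1) * (1 - g%:R^-1) * w (g%:R ^- u)) *
  \sum_(l <- fsub) flen l * w (fgain l).
Proof.
move=> wD; set S := \sum_(l <- fsub) _.
elim: r => [|r IH]; first by rewrite !big_nil mul0r.
rewrite big_branch big_split /=.
under eq_bigr do (rewrite big_map; under eq_bigr do rewrite /= mulrAC;
  rewrite -mulr_suml IH).
under [X in _ + X]eq_bigr do under eq_bigr do
  (rewrite big_map; under eq_bigr do rewrite /= wD mulrAC mulrCA;
   rewrite -mulr_suml -mulr_sumr).
rewrite sum_stay sum_exit -/S big_nat_recr //= subnn expr0 invr1 mul1r [RHS]mulrDl.
congr (_ + _); last by rewrite mulrA.
rewrite mulrAC; congr (_ * _).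
rewrite mulr_suml; apply: eq_big_nat => u ur.
rewrite (_ : r.+1 - u.+1 = (r - u.+1).+1)%N; last lia.
by rewrite exprSr invfM; ring.
Qed.

Definition inI (t p l : R) := (p <= t < p + l)%R.

Lemma inI_subcell b t p l : inI t (subcell_pos B b p) (l / B%:R) =
  inI (t * B%:R - b%:R) p l.
Proof.
rewrite /inI /subcell_pos -mulrDl ler_pdivrMr // ltr_pdivlMr //.
by rewrite lerBrDl ltrBlDl addrA.
Qed.

Lemma sum_cells n t :
  \sum_(0 <= b < n) (inI (t - b%:R) 0 1)%:R = (inI t 0 n%:R)%:R :> R.
Proof.
elim: n => [|n IH]; first by rewrite big_nil /inI addr0; case: lerP => // h; rewrite ltNge h.
rewrite big_nat_recr //= IH /inI -natr1.
have n0 : 0 <= n%:R :> R by [].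
have -> : (0 <= t - n%:R < 0 + 1) = (n%:R <= t < n%:R + 1).
  by rewrite subr_ge0 add0r ltrBlDl.
rewrite !add0r -natrD; congr _%:R.
have [nt|tn] := lerP n%:R t; first by rewrite (le_trans n0 nt).
by rewrite (lt_trans tn) ?ltrDl // addn0.
Qed.

Lemma tower_partition r t :
  (forall t, \sum_(l <- msub) (inI t (mpos l) (mlen l))%:R +
    \sum_(l <- fsub) (inI t (fpos l) (flen l))%:R = (inI t 0 1)%:R :> R) ->
  \sum_(l <- tower_top r) (inI t (mpos l) (mlen l))%:R +
  \sum_(l <- tower_low r) (inI t (mpos l) (mlen l))%:R +
  \sum_(l <- tower_free r) (inI t (fpos l) (flen l))%:R = (inI t 0 1)%:R :> R.
Proof.
move=> hs; elim: r t => [|r IH] t; first by rewrite big_seq1 !big_nil !addr0.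
rewrite big_branch_stay !big_branch -!big_split /=.
pose S b := (inI (t * B%:R - b%:R) 0 1)%:R : R.
transitivity (\sum_(0 <= k < N) \sum_(0 <= e < g) S (g * k + e)%N).
  apply: eq_bigr => k _; rewrite [in RHS]big_ltn ?addn0; last lia.
  rewrite !big_map [X in X + _ = _]addrA addrACA; congr (_ + _).
    by rewrite /S -IH; congr (_ + _ + _); apply: eq_bigr => l _; rewrite inI_subcell.
  rewrite -big_split; apply: eq_bigr => e _; rewrite !big_map /S -hs.
  by congr (_ + _); apply: eq_bigr => l _; rewrite inI_subcell.
rewrite sum_blocks sum_cells /inI !add0r.
by rewrite pmulr_lge0 // -ltr_pdivlMr // divff.
Qed.

End Tower.

(** * Cells with base 8 endpoints *)

Section Aligned.
Context {R : realFieldType}.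

Definition aligned (c : nat) (p : R) := exists n : nat, p * 8 ^+ c = n%:R.

Lemma aligned_le c c' p : (c <= c')%N -> aligned c p -> aligned c' p.
Proof.
move=> /subnKC <- [n hn]; exists (n * 8 ^ (c' - c))%N.
by rewrite exprD mulrA hn natrM natrX.
Qed.

(** As [B] divides a power of 8, cutting into [B] parts only adds finitely
    many base 8 digits. *)
Lemma aligned_subcell B b c d p : (B %| 8 ^ d)%N -> (0 < B)%N -> aligned c p ->
  aligned (c + d) (subcell_pos B b p).
Proof.
move=> /dvdnP[m hm] B0 [n hn]; exists ((b * 8 ^ c + n) * m)%N.
rewrite /subcell_pos exprD -natrX -[8 ^+ d]natrX hm !natrM natrD natrM -hn natrX.
have : B%:R != 0 :> R by rewrite pnatr_eq0; lia.
by move=> ?; field.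
Qed.

Lemma aligned_div B c d (l : R) : (B %| 8 ^ d)%N -> (0 < B)%N -> aligned c l ->
  aligned (c + d) (l / B%:R).
Proof.
move=> h1 h2 h3; have := aligned_subcell 0 h1 h2 h3.
by rewrite /subcell_pos add0r.
Qed.

Definition maligned c (l : mleaf R) := aligned c (mpos l) /\ aligned c (mlen l).
Definition faligned c (l : fleaf R) := aligned c (fpos l) /\ aligned c (flen l).

Lemma tower_aligned g N M lev (msub : seq (mleaf R)) (fsub : seq (fleaf R)) c d r :
  (0 < g)%N -> (0 < N)%N -> (g * N %| 8 ^ d)%N ->
  {in msub, forall l, maligned c l} -> {in fsub, forall l, faligned c l} ->
  [/\ {in tower_top g N M lev r, forall l, maligned (c + r * d) l},
      {in tower_low g N M msub r, forall l, maligned (c + r * d) l} &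
      {in tower_free g N M fsub r, forall l, faligned (c + r * d) l}].
Proof.
move=> g0 N0 dvd hm hf; have B0 : (0 < g * N)%N by rewrite muln_gt0 g0.
have up r' p : aligned c p -> aligned (c + r' * d) p by apply: aligned_le; lia.
have E r' : (c + r'.+1 * d = c + r' * d + d)%N by lia.
elim: r => [|r [IH1 IH2 IH3]].
  split=> // l; rewrite inE => /eqP ->; split=> /=.
    by exists 0%N; rewrite mul0r.
  by exists (8 ^ (c + 0 * d))%N; rewrite mul1r natrX.
split=> l.
- case/mem_branch => [[k kN /mapP[l' /IH1[h1 h2] ->]]|[k [e []]]//].
  by rewrite E; split; [apply: aligned_subcell|apply: aligned_div].
- case/mem_branch => [[k kN /mapP[l' /IH2[h1 h2] ->]]|[k [e [kN eg /mapP[l' /hm[h1 h2] ->]]]]].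
    by rewrite E; split; [apply: aligned_subcell|apply: aligned_div].
  by rewrite E; split; [apply: aligned_subcell => //; exact: up|
    apply: aligned_div => //; exact: up].
- case/mem_branch => [[k kN /mapP[l' /IH3[h1 h2] ->]]|[k [e [kN eg /mapP[l' /hf[h1 h2] ->]]]]].
    by rewrite E; split; [apply: aligned_subcell|apply: aligned_div].
  by rewrite E; split; [apply: aligned_subcell => //; exact: up|
    apply: aligned_div => //; exact: up].
Qed.

End Aligned.

(** * Contribution of a mass leaf to the operator *)

Section Contribution.
Context {R : realFieldType}.
Variables (c1 c2 : R) (D : nat -> R).
Hypotheses (c1_ge0 : 0 <= c1) (c2_ge0 : 0 <= c2) (D_ge0 : forall j, 0 <= D j).

Definition active (l : mleaf R) i := (moff l <= i < moff l + size (mdig l))%N.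

Definition mass (l : mleaf R) : R := D (mlev l) * mlen l.

(** What the leaf guarantees for the integral of the function against
    [sin (2 pi n y) * cot (pi (x - y))], where [n] is the frequency
    of index [i]: the mass divided by the largest distance to [x] if the digit
    agrees with the side on which the leaf lies, minus the mass divided by the
    smallest distance if it does not, with constants [c1] and [c2]. Leaves
    that prescribe no digit at [i] count as 0 here; their oscillation error is
    estimated separately. *)
Definition contribution (l : mleaf R) (x : R) (i : nat) : R :=
  let left := nth false (mdig l) (i - moff l) in
  if active l i then
    if mpos l + mlen l <= x then
      if left then c1 * mass l / (x - mpos l)
      else - (c2 * mass l / (x - (mpos l + mlen l)))
    else
      if left then - (c2 * mass l / (mpos l - x))
      else c1 * mass l / (mpos l + mlen l - x)
  else 0.

Lemma contribution_mplace B b l x i : (0 < B)%N ->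
  contribution (mplace B b l) (subcell_pos B b x) i = contribution l x i.
Proof.
move=> B0; have B0' : 0 < B%:R :> R by rewrite ltr0n.
have sub (p q : R) : subcell_pos B b p - subcell_pos B b q = (p - q) / B%:R.
  by rewrite /subcell_pos; ring.
have add (p q : R) : subcell_pos B b p + q / B%:R = subcell_pos B b (p + q).
  by rewrite /subcell_pos; ring.
have quo (c m d : R) : c * (m / B%:R) / (d / B%:R) = c * m / d.
  by rewrite invf_div [LHS]mulrA; congr (_ / _); rewrite -mulrA divfK // gt_eqF.
rewrite /contribution /mass /active /= add !sub [D _ * (_ / _)]mulrA !quo.
by rewrite /subcell_pos ler_pM2r ?invr_gt0 // lerD2l.
Qed.

Lemma contribution_mshift o l x i :
  contribution (mshift o l) x (o + i) = contribution l x i.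
Proof. by rewrite /contribution /active /= -addnA !leq_add2l ltn_add2l subnDl. Qed.

Lemma contribution_inactive l x i : ~~ active l i -> contribution l x i = 0.
Proof. by rewrite /contribution => /negbTE ->. Qed.

Lemma mass_ge0 l : in_unit (mpos l) (mlen l) -> 0 <= mass l.
Proof. by case/and3P=> _ /ltW h _; rewrite mulr_ge0. Qed.

Lemma contribution_matching_ge l y i d : in_unit (mpos l) (mlen l) -> active l i ->
  (1 < y) && nth false (mdig l) (i - moff l) && (y <= d) ||
  (y < 0) && ~~ nth false (mdig l) (i - moff l) && (1 - y <= d) ->
  c1 * mass l / d <= contribution l y i.
Proof.
move=> hu ha; have m0 := mass_ge0 hu; case/and3P: hu => p0 l0 pl1.
have cm c : 0 <= c -> 0 <= c * mass l by move=> h; exact: mulr_ge0.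
rewrite /contribution ha => /orP[/andP[/andP[y1 ->] yd]|/andP[/andP[y0 /negbTE ->] yd]].
  rewrite (_ : _ + _ <= y) /=; last by apply/ltW/(le_lt_trans pl1).
  by apply: ler_wpM2l; rewrite ?cm // lef_pV2 ?posrE; lra.
rewrite ifN /=; last by rewrite -ltNge; lra.
by apply: ler_wpM2l; rewrite ?cm // lef_pV2 ?posrE; lra.
Qed.

Lemma contribution_ge l y i d : in_unit (mpos l) (mlen l) -> 0 < d ->
  (1 <= y - d) || (y + d <= 0) ->
  - (c2 * ((active l i)%:R * mass l) / d) <= contribution l y i.
Proof.
move=> hu d0 yd; have m0 := mass_ge0 hu; case/and3P: hu => p0 l0 pl1.
rewrite /contribution; case: ifP => ha; last by rewrite mul0r mulr0 mul0r oppr0.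
rewrite mul1r; have cm c : 0 <= c -> 0 <= c * mass l by move=> h; exact: mulr_ge0.
have neg z : 0 <= z -> - (c2 * mass l / d) <= z.
  by apply: le_trans; rewrite oppr_le0 divr_ge0 ?cm // ltW.
case: ifP => hy; case: ifP => _; try by apply/neg/divr_ge0; rewrite ?cm //; lra.
  by rewrite lerN2; apply: ler_wpM2l; rewrite ?cm // lef_pV2 ?posrE //; lra.
have : mpos l + mlen l > y by rewrite ltNge hy.
by move=> h; rewrite lerN2; apply: ler_wpM2l; rewrite ?cm // lef_pV2 ?posrE //; lra.
Qed.

(** A leaf placed in subcell [q], seen from subcell [b], is the same leaf seen
    from [b - q] units further, after rescaling. *)
Lemma contribution_neighbour B q b l x i : (0 < B)%N ->
  contribution (mplace B q l) (subcell_pos B b x) i =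
  contribution l (x + b%:R - q%:R) i.
Proof.
move=> B0; rewrite -[RHS](@contribution_mplace B q) //; congr contribution.
by rewrite /subcell_pos; congr (_ / _); ring.
Qed.

End Contribution.

(** * Gain and loss in one tower *)

Section TowerEstimate.
Context {R : realFieldType}.
Variables (c1 c2 : R) (D : nat -> R).
Hypotheses (c1_ge0 : 0 <= c1) (c2_ge0 : 0 <= c2) (D_ge0 : forall j, 0 <= D j).
Variables (g n M lev : nat) (msub : seq (mleaf R)) (fsub : seq (fleaf R)).
Hypotheses (g_gt1 : (1 < g)%N) (M_gt0 : (0 < M)%N).
Hypothesis msub_unit : {in msub, forall l, in_unit (mpos l) (mlen l)}.
Hypothesis fsub_unit : {in fsub, forall l, in_unit (fpos l) (flen l)}.
Hypothesis msub_range : {in msub, forall l, (moff l + size (mdig l) <= M)%N}.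
Hypothesis fsub_range : {in fsub, forall l, (fidx l < M)%N}.

Let N := (2 ^ n)%N.
Let B := (g * N)%N.
Let N_gt0 : (0 < N)%N. Proof. by rewrite /N expn_gt0. Qed.
Let B_gt0 : (0 < B)%N. Proof. by rewrite /B muln_gt0 N_gt0; lia. Qed.

Local Notation ctr := (contribution c1 c2 D).
Local Notation top r := (tower_top g N M lev r).
Local Notation low r := (tower_low g N M msub r).
Local Notation free r := (tower_free g N M fsub r).

Lemma sum_pick (V : nmodType) (G : nat -> V) k0 e0 :
  (k0 < N)%N -> (0 < e0 < g)%N ->
  (forall k e, (k < N)%N -> (0 < e < g)%N -> (g * k + e <> g * k0 + e0)%N ->
     G (g * k + e)%N = 0) ->
  \sum_(0 <= k < N) \sum_(1 <= e < g) G (g * k + e)%N = G (g * k0 + e0)%N.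
Proof.
move=> kN eg h.
rewrite (bigD1_seq k0) ?mem_index_iota ?iota_uniq //=.
rewrite [X in _ + X]big_seq_cond [X in _ + X]big1 ?addr0; last first.
  move=> k /andP[]; rewrite mem_index_iota /= => kN' kk.
  rewrite big_nat big1 // => e he; apply: h => //.
  by move: kk => /eqP; nia.
rewrite (bigD1_seq e0) ?mem_index_iota ?iota_uniq //=.
rewrite [X in _ + X]big_seq_cond big1 ?addr0 // => e /andP[].
by rewrite mem_index_iota /= => he /eqP ne; apply: h => //; lia.
Qed.

Definition active_mass (s : seq (mleaf R)) i :=
  \sum_(l <- s) (active l i)%:R * mass D l.

Lemma inactive_shift q l i : l \in msub -> (i %/ M)%N <> q ->
  ~~ active (mshift (q * M) l) i.
Proof.
move=> /msub_range h ne; apply/negP => /andP[/= h1 h2]; apply: ne.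
rewrite (_ : i = q * M + (i - q * M))%N; last lia.
by rewrite divnMDl // divn_small ?addn0 //; lia.
Qed.

(** The positions of distinct exits of a cell are disjoint, so only one exit
    of a step is active at [i]: it adds mass [W / B], and what comes from
    the later steps is divided by [g >= 2] each time. *)
Lemma tower_low_active_mass W r i :
  \sum_(l <- msub) mass D l <= W ->
  active_mass (low r) i <= 2 * W / B%:R.
Proof.
move=> hW.
have m0 l : l \in msub -> 0 <= mass D l by move=> /msub_unit; exact: mass_ge0.
have W0 : 0 <= W by apply: le_trans hW; rewrite big_seq sumr_ge0.
have B0 : 0 < B%:R :> R by rewrite ltr0n.
have WB : 0 <= W / B%:R by rewrite divr_ge0 // ltW.
elim: r => [|r IH]; first by rewrite /active_mass big_nil -mulrA mulr_ge0.
rewrite /active_mass big_branch big_split /=.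
have -> : 2 * W / B%:R = 2 * W / B%:R / 2 + W / B%:R by field; rewrite gt_eqF.
apply: lerD.
  have E : \sum_(l <- low r) (active l i)%:R * (mass D l / B%:R) =
      active_mass (low r) i / B%:R.
    by rewrite mulr_suml; apply: eq_bigr => l _; rewrite mulrA.
  have massE b l : mass D (mplace B b l) = mass D l / B%:R by rewrite /mass /= mulrA.
  under eq_bigr do (rewrite big_map; under eq_bigr do rewrite massE; rewrite E).
  rewrite sum_stay //.
  have A0 : 0 <= active_mass (low r) i.
    rewrite /active_mass big_seq; apply: sumr_ge0 => l hl.
    by rewrite mulr_ge0 // mass_ge0 //; apply: tower_low_unit hl.
  apply: ler_pM => //.
  by rewrite lef_pV2 ?posrE ?ltr0n ?ler_nat //; lia.
pose G b := \sum_(l <- msub) (active (mshift ((r * B + b) * M) l) i)%:R *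
  (mass D l / B%:R).
have -> : \sum_(0 <= k < N) \sum_(1 <= e < g)
    \sum_(l <- [seq mplace B (g * k + e) (mshift ((r * B + (g * k + e)) * M) l)
         | l <- msub]) (active l i)%:R * mass D l =
    \sum_(0 <= k < N) \sum_(1 <= e < g) G (g * k + e)%N.
  apply: eq_bigr => k _; apply: eq_bigr => e _; rewrite big_map /G.
  by apply: eq_bigr => l _; congr (_ * _); rewrite [LHS]mulrA.
have G0 b : (i %/ M)%N <> (r * B + b)%N -> G b = 0.
  move=> ne; rewrite /G big_seq big1 // => l hl.
  by rewrite (negbTE (inactive_shift hl ne)) mul0r.
have [[k0 [e0 [kN eg E]]]|no] := pselect (exists k e, [/\ (k < N)%N, (0 < e < g)%N &
    (i %/ M = r * B + (g * k + e))%N]).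
  rewrite (@sum_pick _ G k0 e0) //; last by move=> *; apply: G0; lia.
  apply: (@le_trans _ _ (\sum_(l <- msub) mass D l / B%:R)); last first.
    by rewrite -mulr_suml ler_pM2r ?invr_gt0.
  rewrite /G !big_seq; apply: ler_sum => l hl.
  have := divr_ge0 (m0 _ hl) (ltW B0).
  by case: (active _ _); rewrite ?mul1r ?mul0r.
rewrite big_nat big1 // => k kN; rewrite big_nat big1 // => e eg.
by apply: G0 => E; apply: no; exists k, e.
Qed.

(** All windows around the exit carry the correct digit for it, at distances
    at most [g * (|k - k0| + 1)] subcells; this makes a harmonic sum
    over [2 ^ n] windows. *)
Lemma exit_top_gain r k0 e0 i x : (k0 < N)%N -> (0 < e0 < g)%N -> (i < M)%N ->
  0 < x < 1 ->
  c1 * (D lev * g%:R ^- r) * (n%:R / 2 / g%:R) <=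
  \sum_(l <- top r.+1)
    ctr l (subcell_pos B (g * k0 + e0) x) ((r * B + (g * k0 + e0)) * M + i).
Proof.
move=> kN eg iM /andP[x0 x1]; set b := (g * k0 + e0)%N; set I := (_ + i)%N.
have bB : (b < B)%N by apply: exit_lt.
have g0 : 0 < g%:R :> R by rewrite ltr0n; lia.
have DD : 0 <= D lev * g%:R ^- r by rewrite mulr_ge0 // invr_ge0 exprn_ge0 // ltW.
rewrite big_branch_stay.
apply: (@le_trans _ _ (\sum_(0 <= k < N)
    c1 * (D lev * g%:R ^- r) / g%:R * (ndist k k0).+1%:R^-1)).
  rewrite -mulr_sumr; set X := c1 * _.
  rewrite [leLHS](_ : _ = X / g%:R * (n%:R / 2)); last by ring.
  apply: ler_wpM2l; last exact: sum_inv_dist_ge.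
  by apply: divr_ge0; [apply: mulr_ge0|apply: ltW].
rewrite !big_nat; apply: ler_sum => k /= kN'.
rewrite big_map -(tower_top_length M lev g_gt1 N_gt0) !mulr_sumr !mulr_suml.
rewrite !big_seq; apply: ler_sum => l hl.
have [h1 h2 h3] := tower_top_label g_gt1 N_gt0 hl.
have hu := tower_top_unit g_gt1 N_gt0 hl.
rewrite contribution_neighbour // -/b.
rewrite (_ : _ * _ = c1 * mass D (mappend (side_pattern g N M k) l) /
    (g%:R * (ndist k k0).+1%:R)); last by rewrite /mass /= h1 invfM; ring.
have hI : (r * (B * M) <= I < r * (B * M) + B * M)%N by rewrite /I; apply/andP; split; nia.
have dge : (ndist (g * k) b).+1%:R <= g%:R * (ndist k k0).+1%:R :> R.
  by rewrite -natrM ler_nat /ndist /b; nia.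
apply: contribution_matching_ge => //.
  by rewrite /active /= h2 size_cat size_mkseq h3 add0n; case/andP: hI.
rewrite /= h2 subn0 nth_cat h3 ltnNge; case/andP: hI => -> hI2 /=.
rewrite nth_mkseq; last lia.
have -> : ((I - r * (B * M)) %/ M)%N = b.
  rewrite (_ : I - r * (B * M) = b * M + i)%N; last by rewrite /I; nia.
  by rewrite divnMDl // divn_small // addn0.
have [lt|gt] : (g * k < b)%N \/ (b < g * k)%N.
  by rewrite /b; have [?|?] := leqP k k0; [left|right]; nia.
- apply/orP; left; rewrite lt.
  move: dge; rewrite (_ : ndist (g * k) b = b - g * k)%N; last by rewrite /ndist; lia.
  rewrite -natr1 natrB; last lia.
  have : (g * k)%:R + 1 <= b%:R :> R by rewrite natr1 ler_nat.
  by move=> *; apply/andP; split; [apply/andP; split => //|]; lra.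
- apply/orP; right; rewrite ltnNge (ltnW gt).
  move: dge; rewrite (_ : ndist (g * k) b = g * k - b)%N; last by rewrite /ndist; lia.
  rewrite -natr1 natrB; last lia.
  have : b%:R + 1 <= (g * k)%:R :> R by rewrite natr1 ler_nat.
  by move=> *; apply/andP; split; [apply/andP; split => //|]; lra.
Qed.

(** Besides the windows of this step, only the system placed in the exit is
    active at the index of [x], and it appears there as a rescaled copy. *)
Lemma exit_step r k0 e0 i x : (k0 < N)%N -> (0 < e0 < g)%N -> (i < M)%N ->
  0 < x < 1 ->
  forall X I, X = subcell_pos B (g * k0 + e0) x ->
  I = ((r * B + (g * k0 + e0)) * M + i)%N ->
  c1 * (D lev * g%:R ^- r) * (n%:R / 2 / g%:R) + \sum_(l <- msub) ctr l x i <=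
  \sum_(l <- top r.+1) ctr l X I + \sum_(l <- low r.+1) ctr l X I.
Proof.
move=> kN eg iM x01 X I XE IE.
apply: lerD; first by rewrite XE IE; exact: exit_top_gain.
rewrite big_branch big_split /= [X in _ <= X + _]big1_seq ?add0r; last first.
  move=> k _; rewrite big_map big1_seq // => l /andP[_ hl].
  rewrite contribution_inactive //.
  have := tower_low_range g_gt1 N_gt0 msub_range hl.
  by rewrite /active IE /= -/B; nia.
pose G b := \sum_(l <- msub) ctr (mplace B b (mshift ((r * B + b) * M) l)) X I.
have -> : \sum_(0 <= k < N) \sum_(1 <= e < g)
    \sum_(l <- [seq mplace B (g * k + e) (mshift ((r * B + (g * k + e)) * M) l)
         | l <- msub]) ctr l X I =
    \sum_(0 <= k < N) \sum_(1 <= e < g) G (g * k + e)%N.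
  by apply: eq_bigr => k _; apply: eq_bigr => e _; rewrite big_map.
rewrite (@sum_pick _ G k0 e0) // => [|k e _ _ ne].
  by apply: ler_sum => l _; rewrite XE IE contribution_mplace // contribution_mshift.
rewrite /G big1_seq // => l /andP[_ hl]; apply: contribution_inactive.
apply: (inactive_shift hl); rewrite IE divnMDl // divn_small // addn0.
by move/addnI => E; apply: ne.
Qed.

(** Leaves in another window [k] are at least [(g - 1) * |k - k0|]
    subcells away from the first subcell of window [k0], and so lose a
    harmonic sum divided by [g - 1], whatever their digits. *)
Lemma stay_error A (s : seq (mleaf R)) (h : nat -> mleaf R -> mleaf R) k0 x i :
  (k0 < N)%N -> 0 < x < 1 ->
  {in s, forall l k, in_unit (mpos (h k l)) (mlen (h k l))} ->
  (forall k, active_mass [seq h k l | l <- s] i <= A) ->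
  - (c2 * A / (g.-1)%:R * (2 * n.+1%:R)) <=
  \sum_(0 <= k < N | k != k0) \sum_(l <- s)
     ctr (mplace B (g * k) (h k l)) (subcell_pos B (g * k0) x) i.
Proof.
move=> kN /andP[x0 x1] hu hA.
have g0 : 0 < (g.-1)%:R :> R by rewrite ltr0n; lia.
have A0 : 0 <= A.
  apply: le_trans (hA 0%N); rewrite /active_mass big_map big_seq.
  by apply: sumr_ge0 => l hl; rewrite mulr_ge0 // mass_ge0 //; apply: hu.
apply: (@le_trans _ _ (- \sum_(0 <= k < N | k != k0)
    c2 * A / (g.-1)%:R * (ndist k k0)%:R^-1)).
  rewrite lerN2 -mulr_sumr; apply: ler_wpM2l; last exact: sum_inv_dist_le.
  by rewrite divr_ge0 ?mulr_ge0 // ltW.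
rewrite -sumrN; apply: ler_sum => k kk.
have nd0 : (0 < ndist k k0)%N by rewrite /ndist; lia.
pose d := (g.-1)%:R * (ndist k k0)%:R : R.
have d0 : 0 < d by rewrite mulr_gt0 // ltr0n.
apply: (@le_trans _ _ (- (c2 * active_mass [seq h k l | l <- s] i / d))).
  rewrite lerN2 (_ : c2 * A / _ / _ = c2 * A / d); last by rewrite /d invfM mulrA.
  by rewrite ler_pM2r ?invr_gt0 //; apply: ler_wpM2l.
rewrite /active_mass big_map mulr_sumr mulr_suml -sumrN !big_seq.
apply: ler_sum => l hl; rewrite contribution_neighbour //.
apply: contribution_ge => //; first exact: hu.
rewrite /d -natrM; have [lt|lt] : (k < k0)%N \/ (k0 < k)%N by lia.
  apply/orP; left; rewrite -addrA -opprD -natrD lerBrDr.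
  apply: (@le_trans _ _ (g * k0)%:R); last by rewrite lerDr ltW.
  rewrite -[1]/(1%:R) -natrD ler_nat /ndist; nia.
apply/orP; right; rewrite addrAC lerBlDr add0r -addrA -natrD.
apply: (@le_trans _ _ (1 + (g * k0 + g.-1 * ndist k k0)%:R)).
  by rewrite lerD2r ltW.
by rewrite -[1]/(1%:R) -natrD ler_nat /ndist; nia.
Qed.

(** The chosen window is a rescaled copy of the remaining tower, with the same
    digits at the positions in question; the other windows cost what
    [stay_error] says. *)
Lemma stay_step A r k0 i x : (k0 < N)%N -> 0 < x < 1 -> (i < r * (B * M))%N ->
  active_mass (low r) i <= A ->
  forall X, X = subcell_pos B (g * k0) x ->
  (\sum_(l <- top r) ctr l x i + \sum_(l <- low r) ctr l x i) -
    c2 * (D lev * g%:R ^- r + A) / (g.-1)%:R * (2 * n.+1%:R) <=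
  \sum_(l <- top r.+1) ctr l X i + \sum_(l <- low r.+1) ctr l X i.
Proof.
move=> kN x01 ir hA X XE.
have htop : \sum_(l <- top r) ctr l x i
    - c2 * (D lev * g%:R ^- r) / (g.-1)%:R * (2 * n.+1%:R) <=
    \sum_(l <- top r.+1) ctr l X i.
  rewrite big_branch_stay (bigD1_seq k0) ?mem_index_iota ?iota_uniq //=.
  apply: lerD.
    rewrite big_map !big_seq; apply: ler_sum => l hl.
    have [h1 h2 h3] := tower_top_label g_gt1 N_gt0 hl.
    rewrite XE -/B contribution_mplace // /contribution /active /= h2 size_cat h3.
    rewrite size_mkseq nth_cat h3 subn0 ir /= -/B.
    by rewrite (_ : (i < r * (B * M) + B * M)%N) // (leq_trans ir) // leq_addr.
  rewrite XE; under eq_bigr do rewrite big_map.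
  apply: (@stay_error _ _ (fun k => mappend (side_pattern g N M k))) => //.
    by move=> l hl k; apply: (tower_top_unit g_gt1 N_gt0 hl).
  move=> k; rewrite /active_mass big_map.
  rewrite -(tower_top_length M lev g_gt1 N_gt0) mulr_sumr.
  rewrite !big_seq; apply: ler_sum => l hl.
  have [h1 h2 h3] := tower_top_label g_gt1 N_gt0 hl.
  have m0 := mass_ge0 D_ge0 (tower_top_unit g_gt1 N_gt0 hl).
  rewrite -h1 -/(mass D l) /mass /= -/(mass D l).
  by case: (active _ _); rewrite ?mul1r ?mul0r.
have hlow : \sum_(l <- low r) ctr l x i
    - c2 * A / (g.-1)%:R * (2 * n.+1%:R) <=
    \sum_(l <- low r.+1) ctr l X i.
  rewrite big_branch big_split /= [X in _ <= _ + X]big1_seq ?addr0; last first.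
    move=> k; rewrite mem_index_iota /= => kN'; rewrite big_nat big1 // => e eg.
    rewrite big_map big1_seq // => l /andP[_ hl].
    apply: contribution_inactive; rewrite /active /= -/B; nia.
  rewrite (bigD1_seq k0) ?mem_index_iota ?iota_uniq //=.
  apply: lerD.
    by rewrite big_map; apply: ler_sum => l _; rewrite XE -/B contribution_mplace.
  rewrite XE; under eq_bigr do rewrite big_map.
  apply: (@stay_error _ _ (fun k => id)) => // [l hl _|k].
    exact: (tower_low_unit g_gt1 N_gt0 msub_unit hl).
  by rewrite map_id.
apply: le_trans (lerD htop hlow).
by rewrite addrACA lerD2l -opprD lerN2 -!mulrDl -mulrDr.
Qed.

(** The exit gains [P * g ^- s]. Each enclosing step costs
    [E * (g ^- r - g ^- r.+1)], so the costs telescope, to less than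
    [E * g ^- s]; thus [P - E >= gamma] suffices. The hypothesis on
    the mass of [msub] makes its active part no larger than the mass of the
    tower itself. *)
Lemma tower_gain (gamma : R) L :
  0 <= gamma ->
  {in fsub, forall f x, fpos f < x < fpos f + flen f ->
    gamma * fgain f <= \sum_(l <- msub) ctr l x (fidx f)} ->
  2 * (\sum_(l <- msub) mass D l) / B%:R <= D lev * g%:R ^- L ->
  gamma <= c1 * D lev * (n%:R / 2 / g%:R) -
           c2 * (2 * D lev) / (g.-1)%:R * (2 * n.+1%:R) / (g.-1)%:R ->
  {in free L, forall f x, fpos f < x < fpos f + flen f ->
    gamma * fgain f <=
    \sum_(l <- top L) ctr l x (fidx f) + \sum_(l <- low L) ctr l x (fidx f)}.
Proof.
move=> gamma0 hsub hW hgamma.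
set P := c1 * D lev * _ in hgamma; set E := _ / (g.-1)%:R in hgamma.
have g0 : 0 < g%:R :> R by rewrite ltr0n; lia.
have g1 : 0 < (g.-1)%:R :> R by rewrite ltr0n; lia.
have E0 : 0 <= E.
  by rewrite /E !(divr_ge0, mulr_ge0) // ltW.
(* [s] is the number of steps left at the exit, [G] the gain at lower levels. *)
suff H r f x : (r < L)%N -> f \in free r.+1 -> fpos f < x < fpos f + flen f ->
    exists s G, fgain f = g%:R ^- s + G /\
      gamma * G + P * g%:R ^- s - E * (g%:R ^- s - g%:R ^- r) <=
    \sum_(l <- top r.+1) ctr l x (fidx f) + \sum_(l <- low r.+1) ctr l x (fidx f).
  case: L hW H => [//|L] hW H f hf x hx.
  have [//|s [G [-> hG]]] := H L f x _ hf hx.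
  apply: le_trans hG; rewrite mulrDr.
  have : 0 <= E * g%:R ^- L by rewrite mulr_ge0 // invr_ge0 exprn_ge0 // ltW.
  have : gamma * g%:R ^- s <= (P - E) * g%:R ^- s.
    by apply: ler_wpM2r => //; rewrite invr_ge0 exprn_ge0 // ltW.
  by lra.
have xsub (y : R) b f' : (b%:R + fpos f') / B%:R < y ->
    y < (b%:R + fpos f') / B%:R + flen f' / B%:R ->
    fpos f' < y * B%:R - b%:R < fpos f' + flen f'.
  have B0 : 0 < B%:R :> R by rewrite ltr0n.
  move=> h1 h2; apply/andP; split; first by rewrite ltrBrDl -ltr_pdivrMr.
  by rewrite ltrBlDl addrA -ltr_pdivlMr // [ltRHS]mulrDl.
have xE (y : R) b : y = subcell_pos B b (y * B%:R - b%:R).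
  by rewrite /subcell_pos addrC subrK mulfK // pnatr_eq0 -lt0n.
have in01 (p l y : R) : in_unit p l -> p < y < p + l -> 0 < y < 1.
  by move=> /and3P[? ? ?] /andP[? ?]; apply/andP; split; lra.
have Dg u : (u <= L)%N -> D lev * g%:R ^- L <= D lev * g%:R ^- u.
  move=> uL; apply: ler_wpM2l => //; rewrite lef_pV2 ?posrE ?exprn_gt0 //.
  by rewrite ler_eXn2l // ltr1n.
elim: r f x => [|r IH] f x rL hf /andP[x1 x2].
all: case/mem_branch: hf x1 x2 => [[k kN /mapP[l' hl' ->]]|[k [e [kN eg /mapP[l' hl' ->]]]]].
- by [].
- move=> x1 x2; have hx := xsub x (g * k + e)%N l' x1 x2.
  exists 0%N, (fgain l'); split=> //; rewrite subrr mulr0 subr0.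
  have h01 := in01 _ _ _ (fsub_unit hl') hx.
  apply: le_trans (@exit_step 0 _ _ _ _ kN eg (fsub_range hl') h01 _ _ (xE _ _) (erefl _)).
  by rewrite addrC; apply: lerD; [rewrite /P; lra|exact: hsub].
- move=> x1 x2; have hx := xsub x (g * k)%N l' x1 x2.
  have {}hl' : l' \in free r.+1 := hl'.
  have [s [G [hG hs]]] := IH _ _ (ltnW rL) hl' hx.
  exists s, G; split=> //.
  have h01 := in01 _ _ _ (tower_free_unit g_gt1 N_gt0 fsub_unit hl') hx.
  have ir := tower_free_range g_gt1 N_gt0 fsub_range hl'.
  have hA := le_trans (tower_low_active_mass r.+1 (fidx l') (lexx _)) hW.
  apply: le_trans (@stay_step _ r.+1 _ _ _ kN h01 ir hA _ (xE _ _)).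
  apply: le_trans (lerB hs (lexx _)).
  set X := gamma * G + _.
  have hgr : g%:R ^- r = g%:R * g%:R ^- r.+1 :> R.
    by rewrite exprS invfM mulrA divff ?mul1r // gt_eqF.
  have hg1 : (g.-1)%:R = g%:R - 1 :> R by rewrite -subn1 natrB // ltnW.
  suff : c2 * (D lev * g%:R ^- r.+1 + D lev * g%:R ^- L) / (g.-1)%:R * (2 * n.+1%:R)
      <= E * (g%:R ^- r - g%:R ^- r.+1) by lra.
  rewrite [leRHS](_ : _ = c2 * (2 * D lev * g%:R ^- r.+1) / (g.-1)%:R * (2 * n.+1%:R)).
    apply: ler_wpM2r; first exact: mulr_ge0.
    apply: ler_wpM2r; first by rewrite invr_ge0 ltW.
    by apply: ler_wpM2l => //; have := Dg r.+1 (ltnW rL); lra.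
  rewrite (_ : g%:R ^- r - g%:R ^- r.+1 = (g.-1)%:R * g%:R ^- r.+1); last first.
    by rewrite hgr hg1; ring.
  rewrite /E; move: (g.-1)%:R (g%:R ^- r.+1) g1 => G1 y G1_gt0.
  by field; exact: lt0r_neq0.
- move=> x1 x2; have hx := xsub x (g * k + e)%N l' x1 x2.
  exists r.+1, (fgain l'); split=> //; rewrite subrr mulr0 subr0.
  have h01 := in01 _ _ _ (fsub_unit hl') hx.
  apply: le_trans (@exit_step r.+1 _ _ _ _ kN eg (fsub_range hl') h01 _ _ (xE _ _) (erefl _)).
  by rewrite addrC; apply: lerD; [rewrite /P; lra|exact: hsub].
Qed.

End TowerEstimate.

(** * Towers of all levels *)

Section System.
Context {R : realFieldType}.
Variables (g L : nat) (K : nat -> nat).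
Hypotheses (g_gt1 : (1 < g)%N) (L_gt0 : (0 < L)%N).

(** The length of the range of positions of the first [j] levels, and of the
    indices of their free leaves: each of the [L] steps gives a range of the
    previous length to each of its subcells. *)
Fixpoint label_count (j : nat) : nat :=
  if j is j'.+1 then (L * (g * 2 ^ K j' * label_count j'))%N else 1%N.

Fixpoint system (j : nat) : seq (mleaf R) * seq (fleaf R) :=
  if j is j'.+1 then
    let: (ms, fs) := system j' in
    (tower_top g (2 ^ K j') (label_count j') j' L ++
     tower_low g (2 ^ K j') (label_count j') ms L,
     tower_free g (2 ^ K j') (label_count j') fs L)
  else ([::], [:: FLeaf 0 1 0 0]).

Definition mleaves j := (system j).1.
Definition fleaves j := (system j).2.

Lemma mleavesS j : mleaves j.+1 =
  tower_top g (2 ^ K j) (label_count j) j L ++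
  tower_low g (2 ^ K j) (label_count j) (mleaves j) L.
Proof. by rewrite /mleaves /=; case: (system j). Qed.

Lemma fleavesS j :
  fleaves j.+1 = tower_free g (2 ^ K j) (label_count j) (fleaves j) L.
Proof. by rewrite /fleaves /=; case: (system j). Qed.

Let N_gt0 j : (0 < 2 ^ K j)%N. Proof. by rewrite expn_gt0. Qed.

Lemma label_count_gt0 j : (0 < label_count j)%N.
Proof. by elim: j => //= j IH; rewrite !muln_gt0 L_gt0 IH N_gt0; lia. Qed.

Lemma mleaves_unit j : {in mleaves j, forall l, in_unit (mpos l) (mlen l)}.
Proof.
elim: j => [//|j IH] l; rewrite mleavesS mem_cat => /orP[|].
  exact: tower_top_unit.
exact: tower_low_unit.
Qed.

Lemma fleaves_unit j : {in fleaves j, forall l, in_unit (fpos l) (flen l)}.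
Proof.
elim: j => [|j IH] l; first by rewrite inE => /eqP ->; rewrite /in_unit /=; lra.
by rewrite fleavesS; exact: tower_free_unit.
Qed.

Lemma mleaves_range j :
  {in mleaves j, forall l, (moff l + size (mdig l) <= label_count j)%N}.
Proof.
elim: j => [//|j IH] l; rewrite mleavesS mem_cat => /orP[hl|].
  by have [_ -> ->] := tower_top_label g_gt1 (N_gt0 j) hl.
exact: tower_low_range.
Qed.

Lemma fleaves_range j : {in fleaves j, forall l, (fidx l < label_count j)%N}.
Proof.
elim: j => [|j IH] l; first by rewrite inE => /eqP ->.
by rewrite fleavesS; exact: tower_free_range.
Qed.

Lemma mleaves_label j :
  {in mleaves j, forall l, (mlev l < j)%N /\ size (mdig l) = label_count (mlev l).+1}.
Proof.
elim: j => [//|j IH] l; rewrite mleavesS mem_cat => /orP[hl|].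
  by have [-> _ ->] := tower_top_label g_gt1 (N_gt0 j) hl.
apply: (@tower_low_label _ _ _ _ _ (fun v s => (v < j.+1)%N /\ s = label_count v.+1)).
by move=> l' /IH[h1 h2]; split=> //; exact: ltnW.
Qed.

Lemma leaves_partition j t :
  \sum_(l <- mleaves j) (inI t (mpos l) (mlen l))%:R +
  \sum_(l <- fleaves j) (inI t (fpos l) (flen l))%:R = (inI t 0 1)%:R :> R.
Proof.
elim: j t => [|j IH] t; first by rewrite big_nil big_seq1 add0r.
by rewrite mleavesS fleavesS big_cat tower_partition.
Qed.

Lemma leaves_aligned d j : (forall i, (i < j)%N -> (g * 2 ^ K i %| 8 ^ d)%N) ->
  {in mleaves j, forall l, maligned (j * (L * d)) l} /\
  {in fleaves j, forall l, faligned (j * (L * d)) l}.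
Proof.
elim: j => [|j IH] dvd.
  split=> // l; rewrite inE => /eqP ->; split; [exists 0%N|exists 1%N];
  by rewrite /= ?mul0r // mul1r.
have [hm hf] := IH (fun i ij => dvd i (ltnW ij)).
have [h1 h2 h3] := tower_aligned (label_count j) j L (ltnW g_gt1) (N_gt0 j)
  (dvd j (ltnSn j)) hm hf.
rewrite mulSn addnC; split; last by rewrite fleavesS.
by move=> l; rewrite mleavesS mem_cat => /orP[/h1|/h2].
Qed.

Lemma mleaves_length i j : (i < j)%N ->
  \sum_(l <- mleaves j | mlev l == i) mlen l =
  g%:R ^- L * (1 - g%:R ^- L) ^+ (j - i.+1) :> R.
Proof.
rewrite big_mkcond /=.
rewrite (eq_bigr (fun l => (mlev l == i)%:R * mlen l)); last first.
  by move=> l _; case: eqP; rewrite ?mul1r ?mul0r.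
elim: j => [//|j IH] ij; rewrite mleavesS big_cat /= tower_low_length //.
have topE : \sum_(l <- tower_top g (2 ^ K j) (label_count j) j L)
    (mlev l == i)%:R * mlen l = (j == i)%:R * g%:R ^- L :> R.
  rewrite -(tower_top_length (label_count j) j g_gt1 (N_gt0 j)) mulr_sumr.
  rewrite big_seq [RHS]big_seq; apply: eq_bigr => l hl.
  by have [-> _ _] := tower_top_label g_gt1 (N_gt0 j) hl.
rewrite topE; have [<-|ne] := eqVneq j i.
  rewrite mul1r subnn mulr1 big_seq big1 ?mulr0 ?addr0 // => l hl.
  have [h _] := mleaves_label hl.
  by rewrite (_ : (mlev l == j) = false) ?mul0r //; apply/eqP; lia.
rewrite mul0r add0r IH; last lia.
by rewrite (_ : j.+1 - i.+1 = (j - i.+1).+1)%N ?exprS; [rewrite mulrCA|lia].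
Qed.

(** The gain adds up over the levels, where the exits are chosen
    independently; a multiplicative weight therefore gives a product. *)
Lemma fleaves_sum (w : R -> R) j : (forall x y, w (x + y) = w x * w y) -> w 0 = 1 ->
  \sum_(l <- fleaves j) flen l * w (fgain l) =
  (\sum_(0 <= u < L) g%:R ^- (L - u.+1) * (1 - g%:R^-1) * w (g%:R ^- u)) ^+ j.
Proof.
move=> wD w0; elim: j => [|j IH]; first by rewrite big_seq1 expr0 /= mul1r.
by rewrite fleavesS tower_free_sum // IH exprS.
Qed.

Section Key.
Variables (c1 c2 gamma : R) (D : nat -> R) (J : nat).
Hypotheses (c1_ge0 : 0 <= c1) (c2_ge0 : 0 <= c2) (gamma_ge0 : 0 <= gamma).
Hypothesis D_ge0 : forall j, 0 <= D j.
Hypothesis D_sum : \sum_(0 <= i < J) D i <= 1.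
Hypothesis D_large : forall j, (j < J)%N -> 2 / (g * 2 ^ K j)%:R <= D j.
Hypothesis gammaP : forall j, (j < J)%N ->
  gamma <= c1 * D j * ((K j)%:R / 2 / g%:R) -
           c2 * (2 * D j) / (g.-1)%:R * (2 * (K j).+1%:R) / (g.-1)%:R.

(** A leaf of level [j] has density [D j], and the surviving cells of one
    level have total length at most [g ^- L]. *)
Lemma mleaves_mass j : (j <= J)%N ->
  \sum_(l <- mleaves j) mass D l <= g%:R ^- L.
Proof.
move=> jJ; have g0 : 1 < g%:R :> R by rewrite ltr1n.
have g00 : 0 < g%:R :> R by rewrite (lt_trans _ g0).
have gL0 : 0 <= g%:R ^- L :> R by rewrite invr_ge0 exprn_ge0 // ltW.
have gL1 : g%:R ^- L <= 1 :> R by rewrite invf_le1 ?exprn_ege1 ?exprn_gt0 ?ltW.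
have -> : \sum_(l <- mleaves j) mass D l =
    \sum_(0 <= i < j) D i * \sum_(l <- mleaves j | mlev l == i) mlen l.
  under [in RHS]eq_bigr do rewrite mulr_sumr big_mkcond /=.
  rewrite exchange_big /= big_seq [RHS]big_seq; apply: eq_bigr => l hl.
  have [h _] := mleaves_label hl.
  rewrite (bigD1_seq (mlev l)) ?mem_index_iota ?iota_uniq //= eqxx big1 ?addr0 //.
  by move=> i /negbTE; rewrite eq_sym => ->.
apply: (@le_trans _ _ (\sum_(0 <= i < j) D i * g%:R ^- L)).
  rewrite !big_nat; apply: ler_sum => i /andP[_ ij].
  rewrite mleaves_length //; apply: ler_wpM2l => //.
  by rewrite ler_piMr // exprn_ile1 //; lra.
rewrite -mulr_suml ler_piMl // (le_trans _ D_sum) //.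
by rewrite [leRHS](big_cat_nat (n := j)) //= lerDl sumr_ge0.
Qed.

Lemma leaves_gain j : (j <= J)%N ->
  {in fleaves j, forall f x, fpos f < x < fpos f + flen f ->
    gamma * fgain f <= \sum_(l <- mleaves j) contribution c1 c2 D l x (fidx f)}.
Proof.
elim: j => [|j IH] jJ f.
  by rewrite inE => /eqP-> x _; rewrite big_nil mulr0.
rewrite fleavesS => hf x hx; rewrite mleavesS big_cat.
have g0 : 1 < g%:R :> R by rewrite ltr1n.
have g00 : 0 < g%:R :> R by rewrite (lt_trans _ g0).
have B0 : 0 < (g * 2 ^ K j)%:R :> R by rewrite ltr0n muln_gt0 N_gt0 ltnW.
apply: (tower_gain c1_ge0 c2_ge0 D_ge0 g_gt1 (label_count_gt0 j)
  (@mleaves_unit j) (@fleaves_unit j) (@mleaves_range j) (@fleaves_range j)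
  gamma_ge0 (IH (ltnW jJ)) _ (gammaP jJ) hf hx).
apply: (@le_trans _ _ (2 / (g * 2 ^ K j)%:R * g%:R ^- L)).
  rewrite mulrAC; apply: ler_wpM2l; first by rewrite divr_ge0 // ltW.
  exact: mleaves_mass (ltnW jJ).
apply: ler_wpM2r; last exact: D_large.
by rewrite invr_ge0 exprn_ge0 // ltW.
Qed.

End Key.
End System.

(** * Sine and cotangent near the origin *)

Section Trigonometry.
Context {R : realType}.
Implicit Types (t u x y z : R).

Lemma cos_ge_half t : 0 <= t <= pi / 4 -> 2^-1 <= cos t.
Proof.
move=> /andP[t0 t4]; have p0 := @pi_gt0 R.
have c4 : 2^-1 <= cos (pi / 4 : R).
  have h : cos (pi / 4 : R) ^+ 2 = 2^-1.
    have := cos_mulr2n (pi / 4 : R).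
    rewrite (_ : (pi / 4) *+ 2 = pi / 2); last by rewrite -mulr_natr; field.
    by rewrite cos_pihalf -mulr_natr; lra.
  have cp : 0 <= cos (pi / 4 : R) by apply: cos_ge0_pihalf; apply/andP; split; lra.
  rewrite leNgt; apply/negP => lt; have := h; rewrite expr2 => h2.
  by nra.
apply: le_trans c4 _; have [->//|ne] := eqVneq t (pi / 4).
rewrite ltW // ltr_cos ?in_itv /= ?lt_neqAle ?ne //; apply/andP; split; lra.
Qed.

Lemma sin_cos_between t : 0 < t <= pi / 4 ->
  exists2 s, 2^-1 <= s <= 1 & sin t = s * t.
Proof.
move=> /andP[t0 t4].
have [|xi] := @MVT R sin cos 0 t t0.
- by apply: continuous_subspaceT => z; exact: continuous_sin.
- rewrite in_itv /= sin0 !subr0 => /andP[x0 xt] ->; exists (cos xi) => //.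
  by rewrite cos_le1 cos_ge_half //; apply/andP; split; lra.
Qed.

Lemma sin_le_norm t : `|sin t| <= `|t|.
Proof.
wlog t0 : t / 0 < t => [H|].
  have [t0|t0|->] := ltrgt0P t; last by rewrite sin0 normr0.
  - by rewrite -[leRHS](gtr0_norm t0); exact: H.
  - by rewrite -(ltr0_norm t0); have := H (- t); rewrite sinN !normrN; apply; rewrite oppr_gt0.
have [|xi _] := @MVT R sin cos 0 t t0.
- by apply: continuous_subspaceT => z; exact: continuous_sin.
- by rewrite sin0 !subr0 => ->; rewrite normrM ler_piMl // cos_max.
Qed.

Lemma cotN t : cot (- t) = - cot t.
Proof. by rewrite /cot cosN sinN invrN mulrN. Qed.

Lemma sin_pi_ge u : 0 < u <= 8^-1 -> u <= sin (pi * u).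
Proof.
move=> /andP[u0 u8]; have p0 := @pi_gt0 R; have p2 := @pi_ge2 R.
have [|s /andP[s1 _] ->] := @sin_cos_between (pi * u).
  by rewrite mulr_gt0 //=; nra.
have h : 2^-1 * pi <= s * pi by rewrite ler_pM2r.
by rewrite mulrA; apply: ler_peMl; [exact: ltW|lra].
Qed.

Lemma cot_bounds u : 0 < u <= 8^-1 -> (8 * u)^-1 <= cot (pi * u) <= u^-1.
Proof.
move=> /andP[u0 u8]; have p0 := @pi_gt0 R; have p2 := @pi_ge2 R.
have p4 : pi <= 4 :> R by have := @pihalf_lt2 R; lra.
have t0 : 0 < pi * u by rewrite mulr_gt0.
have t4 : pi * u <= pi / 4 by nra.
have [|s /andP[s1 s2] E] := @sin_cos_between (pi * u); first by rewrite t0.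
have c1 : 2^-1 <= cos (pi * u) by apply: cos_ge_half; rewrite t4 ltW.
have c2 := cos_le1 (pi * u).
have s0 : 0 < s * (pi * u) by rewrite mulr_gt0 //; lra.
rewrite /cot E -[X in X <= _ <= _]mul1r -[X in _ <= _ <= X]mul1r.
rewrite ler_pdivrMr ?mulr_gt0 // mulrAC ler_pdivlMr // ler_pdivrMr // mulrAC.
rewrite ler_pdivlMr //; apply/andP; split; nra.
Qed.

Lemma norm_cot_le d u : 0 < d -> d <= `|u| <= 8^-1 -> `|cot (pi * u)| <= d^-1.
Proof.
move=> d0 /andP[du u8].
wlog u0 : u du u8 / 0 < u => [H|].
  have [u0|u0|E] := ltrgt0P u; last by rewrite E normr0 in du; lra.
  - exact: H.
  - by rewrite -[u]opprK mulrN cotN normrN; apply: H; rewrite ?normrN // oppr_gt0.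
rewrite gtr0_norm // in du u8.
have /andP[h1 h2] := @cot_bounds u ltac:(by rewrite u0).
rewrite ger0_norm; last by apply: le_trans h1; rewrite invr_ge0; lra.
by apply: le_trans h2 _; rewrite lef_pV2 ?posrE.
Qed.

Lemma norm_sin_pi_ge d u : 0 < d -> d <= `|u| <= 8^-1 -> d <= `|sin (pi * u)|.
Proof.
move=> d0 /andP[du u8].
wlog u0 : u du u8 / 0 < u => [H|].
  have [u0|u0|E] := ltrgt0P u; last by rewrite E normr0 in du; lra.
  - exact: H.
  - by rewrite -[u]opprK mulrN sinN normrN; apply: H; rewrite ?normrN // oppr_gt0.
rewrite gtr0_norm // in du u8.
have h := @sin_pi_ge u ltac:(by rewrite u0).
by rewrite ger0_norm; lra.
Qed.

(** The difference of two cotangents is [sin (pi (u' - u))] divided by the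
    product of the sines. *)
Lemma cot_lipschitz d u u' : 0 < d -> d <= `|u| <= 8^-1 -> d <= `|u'| <= 8^-1 ->
  `|cot (pi * u) - cot (pi * u')| <= 4 / d ^+ 2 * `|u - u'|.
Proof.
move=> d0 hu hu'; have p0 := @pi_gt0 R.
have p4 : pi <= 4 :> R by have := @pihalf_lt2 R; lra.
have su := norm_sin_pi_ge d0 hu; have su' := norm_sin_pi_ge d0 hu'.
have n1 : sin (pi * u) != 0 by rewrite -normr_gt0; lra.
have n2 : sin (pi * u') != 0 by rewrite -normr_gt0; lra.
have -> : cot (pi * u) - cot (pi * u') =
    sin (pi * (u' - u)) / (sin (pi * u) * sin (pi * u')).
  by rewrite /cot mulrBr sinB; field; rewrite n1 n2.
have hA : `|sin (pi * (u' - u))| <= 4 * `|u - u'|.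
  by apply: le_trans (sin_le_norm _) _; rewrite normrM distrC (gtr0_norm p0) ler_wpM2r.
rewrite normrM normfV normrM; set P := `|sin (pi * u)| * _.
have hP : d ^+ 2 <= P by rewrite expr2 ler_pM // ltW.
have d2 : 0 < d ^+ 2 by rewrite exprn_gt0.
rewrite ler_pdivrMr; last exact: lt_le_trans hP.
apply: le_trans hA _.
rewrite [leRHS](_ : _ = 4 * `|u - u'| * (P / d ^+ 2)); last by ring.
by apply: ler_peMr; [rewrite mulr_ge0|rewrite ler_pdivlMr // mul1r].
Qed.

Lemma sin_2pi_nat (m : nat) z : sin (2 * pi * (m%:R + z)) = sin (2 * pi * z).
Proof.
rewrite mulrDr addrC -[RHS](periodicn (@sinD2pi R) m); congr (sin (_ + _)).
by rewrite -mulrnA -[RHS]mulr_natl natrM; ring.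
Qed.

Lemma cos_2pi_nat (m : nat) z : cos (2 * pi * (m%:R + z)) = cos (2 * pi * z).
Proof.
rewrite mulrDr addrC -[RHS](periodicn (@cosD2pi R) m); congr (cos (_ + _)).
by rewrite -mulrnA -[RHS]mulr_natl natrM; ring.
Qed.

Lemma sin_2pi_ge z : 8^-1 <= z <= 4^-1 -> 2^-1 <= sin (2 * pi * z).
Proof.
move=> /andP[z1 z2]; have p0 := @pi_gt0 R.
rewrite -[2 * pi * z](subrK (pi / 2)) sinDpihalf -cosN opprB.
by apply: cos_ge_half; apply/andP; split; nra.
Qed.

Lemma sin_2pi_le z : 5 / 8 <= z <= 3 / 4 -> sin (2 * pi * z) <= - 2^-1.
Proof.
move=> /andP[z1 z2].
rewrite (_ : 2 * pi * z = 2 * pi * (z - 2^-1) + pi); last by field.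
by rewrite sinDpi lerN2; apply: sin_2pi_ge; apply/andP; split; lra.
Qed.

End Trigonometry.

(** * Integrals of the kernel over an interval *)

Section IntervalIntegral.
Context {R : realType}.
Local Notation mu := (@lebesgue_measure R).
Implicit Types (a b x y : R) (h : R -> R).

Lemma integrable_within a b h : {within `[a, b], continuous h} ->
  mu.-integrable `[a, b] (EFin \o h).
Proof. by move=> hc; apply: continuous_compact_integrable => //; exact: segment_compact. Qed.

Lemma Rintegral_segment_cst a b (c : R) : a <= b ->
  \int[mu]_(y in `[a, b]) c = c * (b - a).
Proof.
move=> ab; rewrite Rintegral_cst //= lebesgue_measure_itv /= lte_fin.
by case: ltgtP ab => // -> _; rewrite subrr.
Qed.

Lemma Rintegral_segment_ge a b h (c : R) : a <= b ->
  {within `[a, b], continuous h} -> (forall y, a <= y <= b -> c <= h y) ->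
  c * (b - a) <= \int[mu]_(y in `[a, b]) h y.
Proof.
move=> ab hc ch; rewrite -Rintegral_segment_cst //.
apply: le_Rintegral => //; last exact: integrable_within.
by apply: integrable_within; apply: continuous_subspaceT; exact: cst_continuous.
Qed.

Lemma Rintegral_segment_norm_le a b h (c : R) : a <= b ->
  {within `[a, b], continuous h} -> (forall y, a <= y <= b -> `|h y| <= c) ->
  `|\int[mu]_(y in `[a, b]) h y| <= c * (b - a).
Proof.
move=> ab hc ch; rewrite -Rintegral_segment_cst //.
apply: le_trans (le_normr_Rintegral _ _) _ => //; first exact: integrable_within.
apply: le_Rintegral => //.
  exact: integrable_norm (integrable_within hc).
by apply: integrable_within; apply: continuous_subspaceT; exact: cst_continuous.
Qed.

Lemma Rintegral_sin (k a b : R) : a < b -> k != 0 ->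
  \int[mu]_(y in `[a, b]) sin (k * y) = (cos (k * a) - cos (k * b)) / k.
Proof.
move=> ab k0.
have dF y : is_derive y 1 (fun y => - cos (k * y) / k) (sin (k * y)).
  have h : is_derive y 1 (fun y => k * y) k.
    have := @is_deriveZ _ _ _ id k y 1 1 (is_derive_id _ _).
    by rewrite scaler1.
  have h2 := is_derive1_comp (is_derive_cos (k * y)) h.
  have h3 := @is_deriveZ _ _ _ _ (- k^-1) y 1 _ h2.
  have -> : (fun y => - cos (k * y) / k) = - k^-1 \*: (cos \o *%R k).
    apply/funext => z; rewrite fctE.
    by rewrite -[RHS]/(- k^-1 * cos (k * z)); ring.
  apply: is_derive_eq; rewrite -[LHS]/(- k^-1 * (- sin (k * y) * k)).
  by field.
rewrite /Rintegral (@continuous_FTC2 _ _ (fun y => - cos (k * y) / k)) //.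
- by rewrite /=; field.
- by apply: continuous_subspaceT => y; apply: continuous_comp;
    [exact: mulrl_continuous|exact: continuous_sin].
- have cF y : {for y, continuous (fun y => - cos (k * y) / k)}.
    by apply/differentiable_continuous/derivable1_diffP; exact: ex_derive.
  split.
  + by move=> y _; exact: ex_derive.
  + by apply: cvg_at_right_filter; exact: cF.
  + by apply: cvg_at_left_filter; exact: cF.
- by move=> y _; rewrite derive1E; exact: derive_val.
Qed.

(** Only the part [sin (2 pi n y)] of the modulation is needed for lower
    bounds; see [hilbert_step]. *)
Definition kernel_integral (n : nat) x a b : R :=
  \int[mu]_(y in `[a, b]) (cot (pi * (x - y)) * sin (2 * pi * n%:R * y)).

Lemma cot_continuous_within x a b :
  (forall y, a <= y <= b -> sin (pi * (x - y)) != 0) ->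
  {within `[a, b], continuous (fun y => cot (pi * (x - y)))}.
Proof.
move=> h; apply: continuous_in_subspaceT => y; rewrite inE /= in_itv /= => hy.
have lin : {for y, continuous (fun y => pi * (x - y))}.
  apply: cvgM; first exact: cvg_cst.
  by apply: cvgB; [exact: cvg_cst|exact: cvg_id].
apply: cvgM.
  by apply: (@continuous_comp _ _ _ (fun y => pi * (x - y)) cos) => //; exact: continuous_cos.
apply: cvgV; first exact: h.
by apply: (@continuous_comp _ _ _ (fun y => pi * (x - y)) sin) => //; exact: continuous_sin.
Qed.

Lemma sin_mul_continuous (k : R) : continuous (fun y => sin (k * y)).
Proof.
by move=> y; apply: continuous_comp; [exact: mulrl_continuous|exact: continuous_sin].
Qed.

Lemma kernel_continuous_within n x a b :
  (forall y, a <= y <= b -> sin (pi * (x - y)) != 0) ->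
  {within `[a, b], continuous
     (fun y => cot (pi * (x - y)) * sin (2 * pi * n%:R * y))}.
Proof.
move=> h y; apply: cvgM; first exact: cot_continuous_within.
by apply: continuous_subspaceT; exact: sin_mul_continuous.
Qed.

(** The upper bound [1/8] keeps the argument of the cotangent in the range
    where it is comparable to the inverse. *)
Definition away (x d a b : R) := forall y, a <= y <= b -> d <= `|x - y| <= 8^-1.

Lemma away_sin x d a b : 0 < d -> away x d a b ->
  forall y, a <= y <= b -> sin (pi * (x - y)) != 0.
Proof. by move=> d0 h y /h hy; rewrite -normr_gt0 (lt_le_trans d0) // norm_sin_pi_ge. Qed.

Lemma kernel_integral_norm_le n x d a b : 0 < d -> a <= b -> away x d a b ->
  `|kernel_integral n x a b| <= d^-1 * (b - a).
Proof.
move=> d0 ab h; apply: Rintegral_segment_norm_le => //.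
  exact/kernel_continuous_within/(away_sin d0 h).
move=> y /h hy; rewrite normrM -[leRHS]mulr1.
by apply: ler_pM => //; [exact: norm_cot_le|exact: sin_max].
Qed.

Lemma kernel_integral_left n x a b : a <= b -> b < x -> x - a <= 8^-1 ->
  (forall y, a <= y <= b -> 2^-1 <= sin (2 * pi * n%:R * y)) ->
  (16 * (x - a))^-1 * (b - a) <= kernel_integral n x a b.
Proof.
move=> ab bx xa hs; apply: Rintegral_segment_ge => //.
  apply: kernel_continuous_within; apply: (@away_sin _ (x - b)); first lra.
  by move=> y /andP[? ?]; rewrite ger0_norm; lra.
move=> y hy; have s0 := hs y hy; case/andP: hy => ay yb.
have xy : 0 < x - y <= 8^-1 by lra.
have /andP[h _] := cot_bounds xy.
rewrite -(_ : (8 * (x - a))^-1 * 2^-1 = (16 * (x - a))^-1); last first.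
  by rewrite -invfM mulrAC -natrM.
apply: ler_pM => //; first by rewrite invr_ge0; lra.
by apply: le_trans h; rewrite lef_pV2 ?posrE; lra.
Qed.

Lemma kernel_integral_right n x a b : a <= b -> x < a -> b - x <= 8^-1 ->
  (forall y, a <= y <= b -> sin (2 * pi * n%:R * y) <= - 2^-1) ->
  (16 * (b - x))^-1 * (b - a) <= kernel_integral n x a b.
Proof.
move=> ab ax bx hs; apply: Rintegral_segment_ge => //.
  apply: kernel_continuous_within; apply: (@away_sin _ (a - x)); first lra.
  by move=> y /andP[? ?]; rewrite ler0_norm; lra.
move=> y hy; have s0 := hs y hy; case/andP: hy => ay yb.
have xy : 0 < y - x <= 8^-1 by lra.
have /andP[h _] := cot_bounds xy.
rewrite -(opprB y x) mulrN cotN mulNr -mulrN.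
rewrite -(_ : (8 * (b - x))^-1 * 2^-1 = (16 * (b - x))^-1); last first.
  by rewrite -invfM mulrAC -natrM.
apply: ler_pM => //; first by rewrite invr_ge0; lra.
  by apply: le_trans h; rewrite lef_pV2 ?posrE; lra.
lra.
Qed.

(** The integral of [sin (2 pi n y)] from [a] to [b]. *)
Definition sine_increment (n : nat) a b : R :=
  (cos (2 * pi * n%:R * a) - cos (2 * pi * n%:R * b)) / (2 * pi * n%:R).

(** On an interval away from [x] the cotangent may be replaced by its value at
    the left endpoint. *)
Lemma kernel_integral_approx n x d a b : 0 < d -> a < b -> (0 < n)%N ->
  away x d a b ->
  `|kernel_integral n x a b - cot (pi * (x - a)) * sine_increment n a b| <=
  4 / d ^+ 2 * (b - a) * (b - a).
Proof.
move=> d0 ab n0 h; have k0 : 2 * pi * n%:R != 0 :> R.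
  by rewrite !mulf_neq0 // ?pnatr_eq0 ?lt0n_neq0 // gt_eqF // pi_gt0.
have ab' := ltW ab.
have cK := @kernel_continuous_within n _ _ _ (away_sin d0 h).
have cS : {within `[a, b], continuous (fun y => sin (2 * pi * n%:R * y))}.
  by apply: continuous_subspaceT; exact: sin_mul_continuous.
rewrite /sine_increment -Rintegral_sin // -RintegralZl //; last exact: integrable_within.
have cS' : {within `[a, b], continuous
    (fun y => cot (pi * (x - a)) * sin (2 * pi * n%:R * y))}.
  by move=> y; apply: cvgM; [exact: cvg_cst|exact: cS].
rewrite -RintegralB //; try exact: integrable_within.
apply: Rintegral_segment_norm_le => //.
  by move=> y; apply: cvgB; [exact: cK|exact: cS'].
move=> y hy; rewrite -mulrBl normrM -[leRHS]mulr1.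
have ha : a <= a <= b by rewrite lexx.
apply: ler_pM => //; last exact: sin_max.
apply: le_trans (cot_lipschitz d0 (h _ hy) (h _ ha)) _.
apply: ler_wpM2l; first by rewrite divr_ge0 // exprn_ge0 // ltW.
case/andP: hy => ay yb; rewrite (_ : x - y - (x - a) = - (y - a)); last by ring.
by rewrite normrN ger0_norm; lra.
Qed.

End IntervalIntegral.

(** * Intervals with prescribed digits *)

(** With leading digit 1 the fractional part lies between [1/8] and [1/4],
    where [sin (2 pi z)] is at least [1/2]; with leading digit 5 it lies
    between [5/8] and [3/4], where the sine is at most [- 1/2]. *)
Definition digit (b : bool) : nat := if b then 1 else 5.

Definition word (d : seq bool) : nat := foldl (fun w b => 8 * w + digit b)%N 0%N d.

Lemma word_rcons d b : word (rcons d b) = (8 * word d + digit b)%N.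
Proof. by rewrite /word -cats1 foldl_cat. Qed.

Lemma word_lt d : (word d < 8 ^ size d)%N.
Proof.
elim/last_ind: d => [//|d b IH]; rewrite word_rcons size_rcons expnS.
have : (digit b <= 5)%N by case: (b).
by lia.
Qed.

Lemma word_digit d t : (t < size d)%N -> exists A r,
  (r < 8 ^ (size d - t.+1))%N /\
  word d = ((8 * A + digit (nth false d t)) * 8 ^ (size d - t.+1) + r)%N.
Proof.
elim/last_ind: d t => [//|d b IH] t; rewrite size_rcons ltnS word_rcons nth_rcons.
rewrite leq_eqVlt => /orP[/eqP->|td].
  by rewrite ltnn eqxx subnn; exists (word d), 0%N; split=> //; lia.
rewrite td; have [A [r [hr ->]]] := IH t td.
rewrite (_ : (size d).+1 - t.+1 = (size d - t.+1).+1)%N; last lia.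
exists A, (8 * r + digit b)%N; rewrite !expnS.
have : (digit b <= 5)%N by case: (b).
by split; lia.
Qed.

Section Bars.
Context {R : realType}.
Variables (s : nat) (d : seq bool).

Let M := size d.

Definition bar_length : R := 8 ^- (s + M).
(** The left end of the interval formed by the points of the interval number
    [q] of length [8 ^- s] whose digits at the next [M] positions are [d]. *)
Definition bar (q : nat) : R := (q * 8 ^ M + word d)%:R * bar_length.

Lemma bar_length_gt0 : 0 < bar_length.
Proof. by rewrite invr_gt0 exprn_gt0. Qed.

Let e8 n : 8 ^+ n != 0 :> R. Proof. by rewrite expf_neq0. Qed.

Lemma bar_end q : bar q + bar_length = (q * 8 ^ M + word d).+1%:R * bar_length.
Proof. by rewrite -natr1 mulrDl mul1r. Qed.

Lemma bar_block q : q%:R * 8 ^- s <= bar q /\ bar q + bar_length <= q.+1%:R * 8 ^- s.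
Proof.
have l0 := bar_length_gt0.
have E : 8 ^- s = (8 ^ M)%:R * bar_length.
  by rewrite natrX /bar_length exprD; field; rewrite !e8.
rewrite E !mulrA -!natrM bar_end /bar; split.
  by rewrite ler_pM2r // ler_nat leq_addr.
by rewrite ler_pM2r // ler_nat; have := word_lt d; rewrite -/M; lia.
Qed.

(** Multiplication by [8 ^ (s + t)] moves the digit number [t] of [d] to
    the first place after the point. *)
Lemma bar_sin q t y : (t < M)%N -> bar q <= y <= bar q + bar_length ->
  if nth false d t then 2^-1 <= sin (2 * pi * (8 ^ (s + t))%:R * y)
  else sin (2 * pi * (8 ^ (s + t))%:R * y) <= - 2^-1.
Proof.
move=> tM /andP[y1 y2]; have [A [r [hr E]]] := word_digit tM.
have l0 := bar_length_gt0.
set u := (M - t.+1)%N in hr E; set dg := digit _ in E.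
have Mu : M = (t + u.+1)%N by rewrite /u; lia.
have P0 : 0 < 8 ^+ u :> R by rewrite exprn_gt0.
have key w : (8 ^ (s + t))%:R * (w * bar_length) = w / 8 ^+ u / 8.
  rewrite /bar_length Mu natrX addnA !exprD exprS.
  by field; rewrite !e8.
have wE : (q * 8 ^ M + word d)%:R =
    ((q * 8 ^ t + A)%:R * 8 + dg%:R) * 8 ^+ u + r%:R :> R.
  rewrite -[in RHS]natrX -natrM -natrD -natrM -natrD E Mu; congr _%:R.
  by rewrite expnD expnS; ring.
pose z := (8 ^ (s + t))%:R * y - (q * 8 ^ t + A)%:R.
have S0 : 0 < (8 ^ (s + t))%:R :> R by rewrite ltr0n expn_gt0.
have z1 : dg%:R / 8 <= z.
  rewrite lerBrDr; apply: le_trans (ler_wpM2l (ltW S0) y1).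
  rewrite key wE mulrDl mulfK ?gt_eqF //.
  have : 0 <= r%:R / 8 ^+ u :> R by rewrite divr_ge0 // ltW.
  lra.
have z2 : z <= (dg%:R + 1) / 8.
  rewrite lerBlDr; apply: le_trans (ler_wpM2l (ltW S0) y2) _.
  rewrite bar_end -natr1 key wE -addrA mulrDl mulfK ?gt_eqF //.
  have : (r%:R + 1) / 8 ^+ u <= 1 :> R.
    by rewrite ler_pdivrMr // mul1r natr1 -natrX ler_nat.
  lra.
rewrite (_ : 2 * pi * (8 ^ (s + t))%:R * y = 2 * pi * ((q * 8 ^ t + A)%:R + z)); last first.
  by rewrite /z; ring.
rewrite sin_2pi_nat; rewrite /dg /digit in z1 z2.
case: (nth false d t) z1 z2 => z1 z2.
  by apply: sin_2pi_ge; apply/andP; split; lra.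
by apply: sin_2pi_le; apply/andP; split; lra.
Qed.

Lemma sine_increment_norm_le n q : (0 < n)%N ->
  `|sine_increment n (bar q) (bar q + bar_length)| <= bar_length.
Proof.
move=> n0; have l0 := bar_length_gt0.
rewrite /sine_increment -Rintegral_sin; first last.
- by rewrite !mulf_neq0 // ?pnatr_eq0 ?lt0n_neq0 // gt_eqF // pi_gt0.
- by rewrite ltrDl.
rewrite [leRHS](_ : _ = 1 * (bar q + bar_length - bar q)); last by ring.
apply: Rintegral_segment_norm_le; first by rewrite lerDl ltW.
  by apply: continuous_subspaceT; exact: sin_mul_continuous.
by move=> y _; exact: sin_max.
Qed.

(** The bar is a whole number of periods. *)
Lemma sine_increment_high i q : (s + M <= i)%N ->
  sine_increment (8 ^ i) (bar q) (bar q + bar_length) = 0.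
Proof.
move=> hi; rewrite /sine_increment.
have E w : 2 * pi * (8 ^ i)%:R * (w%:R * bar_length) =
    2 * pi * ((w * 8 ^ (i - (s + M)))%:R + 0).
  rewrite addr0 natrM natrX -mulrA; congr (_ * _).
  rewrite -{1}(subnK hi) natrX exprD /bar_length; field; exact: e8.
rewrite bar_end E /bar E.
by rewrite !cos_2pi_nat subrr mul0r.
Qed.

(** For [i < s], half a period of the frequency [8 ^ i] is a whole number
    of steps from one bar to another; the sine changes its sign under this
    shift. *)
Lemma bar_shift i q : (i < s)%N ->
  bar (q + 4 * 8 ^ (s - i.+1)) = bar q + (2 * (8 ^ i)%:R)^-1.
Proof.
move=> hi; rewrite /bar mulnDl addnAC natrD mulrDl; congr (_ + _).
rewrite /bar_length !natrM !natrX -{2}(subnK hi) -addnA exprD exprD exprS.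
set P := 8 ^+ (s - i.+1); set Q := 8 ^+ M; set T := 8 ^+ i.
by field; rewrite !e8.
Qed.

Lemma sine_increment_low i q : (i < s)%N ->
  let q' := (q + 4 * 8 ^ (s - i.+1))%N in
  sine_increment (8 ^ i) (bar q') (bar q' + bar_length) =
  - sine_increment (8 ^ i) (bar q) (bar q + bar_length).
Proof.
move=> hi q'; rewrite /q' bar_shift // /sine_increment.
have n0 : (8 ^ i)%:R != 0 :> R by rewrite pnatr_eq0 -lt0n expn_gt0.
have E w : 2 * pi * (8 ^ i)%:R * (w + (2 * (8 ^ i)%:R)^-1) =
    2 * pi * (8 ^ i)%:R * w + pi by field.
rewrite -addrA [_^-1 + _]addrC addrA !E !cosDpi.
by rewrite -mulNr; congr (_ / _); ring.
Qed.

Lemma sum_pairs u n (F : nat -> R) q0 :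
  \sum_(q0 <= q < q0 + u.*2 * n) F q =
  \sum_(0 <= p < n) \sum_(0 <= r < u)
    (F (q0 + u.*2 * p + r)%N + F (q0 + u.*2 * p + r + u)%N).
Proof.
elim: n => [|n IH]; first by rewrite muln0 addn0 !big_geq.
rewrite big_nat_recr //= -IH (@big_cat_nat _ _ _ (q0 + u.*2 * n)) //=; last 2 first.
- by rewrite leq_addr.
- by rewrite leq_add2l leq_mul2l leqnSn orbT.
congr (_ + _); rewrite mulnS addnCA [in LHS]addnA.
set a := (q0 + u.*2 * n)%N; rewrite (_ : (u.*2 + q0 + u.*2 * n = a + u.*2)%N); last lia.
rewrite (@big_cat_nat _ _ _ (a + u)) ?leq_addr //=; last by lia.
rewrite big_split /=; congr (_ + _).
  rewrite -{1}[a]add0n big_addn addKn.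
  by apply: eq_bigr => r _; rewrite addnC.
rewrite -{1}[(a + u)%N]add0n big_addn (_ : a + u.*2 - (a + u) = u)%N; last lia.
by apply: eq_bigr => r _; congr F; lia.
Qed.

(** At a high frequency every bar contains whole periods, and freezing the
    cotangent costs the length of the bar. At a low frequency, bars half a
    period apart cancel, up to the variation of the cotangent over half a
    period; the divisibility says that they can be paired. *)
Lemma inactive_sum x dl i q0 Q : 0 < dl ->
  (forall q, (q0 <= q < q0 + Q)%N -> away x dl (bar q) (bar q + bar_length)) ->
  (i < s)%N && (8 ^ (s - i) %| Q)%N || (s + M <= i)%N ->
  `|\sum_(q0 <= q < q0 + Q)
      kernel_integral (8 ^ i) x (bar q) (bar q + bar_length)| <=
  Q%:R * bar_length * (4 / dl ^+ 2) * (bar_length + 8 ^- i).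
Proof.
move=> dl0 hx hi; have l0 := bar_length_gt0; have n0 : (0 < 8 ^ i)%N by rewrite expn_gt0.
set Lam := 4 / dl ^+ 2; have Lam0 : 0 <= Lam by rewrite divr_ge0 // exprn_ge0 // ltW.
have i0 : 0 <= 8 ^- i :> R by rewrite invr_ge0 exprn_ge0.
have l1 := ltW l0.
pose I q := kernel_integral (8 ^ i) x (bar q) (bar q + bar_length).
pose S q := sine_increment (8 ^ i) (bar q) (bar q + bar_length).
have approx q : (q0 <= q < q0 + Q)%N ->
    `|I q - cot (pi * (x - bar q)) * S q| <= Lam * bar_length * bar_length.
  move=> hq; have h := @kernel_integral_approx _ (8 ^ i) x dl (bar q) (bar q + bar_length) dl0.
  have := h _ n0 (hx q hq); rewrite (_ : bar q + bar_length - bar q = bar_length); last by ring.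
  by apply; rewrite ltrDl.
case/orP: hi => [/andP[hi /dvdnP[n hn]]|hi]; last first.
  apply: le_trans (ler_norm_sum _ _ _) _.
  apply: (@le_trans _ _ (\sum_(q0 <= q < q0 + Q) Lam * bar_length * bar_length)).
    rewrite !big_nat; apply: ler_sum => q hq.
    by have := approx q hq; rewrite /S sine_increment_high // mulr0 subr0.
  rewrite sumr_const_nat addKn -[leLHS]mulr_natl mulrDr.
  rewrite (_ : _ * (_ * _) = Q%:R * bar_length * Lam * bar_length); last by ring.
  by rewrite lerDl (mulr_ge0 (mulr_ge0 (mulr_ge0 (ler0n _ _) l1) Lam0) i0).
(* [u] bars make half a period. *)
pose u := (4 * 8 ^ (s - i.+1))%N.
have Qu : Q = (u.*2 * n)%N.
  by rewrite hn /u (_ : s - i = (s - i.+1).+1)%N ?expnS; [lia|lia].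
rewrite Qu sum_pairs.
apply: le_trans (ler_norm_sum _ _ _) _.
apply: (@le_trans _ _ (\sum_(0 <= p < n) \sum_(0 <= r < u)
    2 * bar_length * Lam * (bar_length + 8 ^- i))); last first.
  under eq_bigr do rewrite sumr_const_nat subn0.
  rewrite sumr_const_nat subn0 -mulrnA -[leLHS]mulr_natl.
  by rewrite -muln2 !natrM le_eqVlt; apply/orP; left; apply/eqP; ring.
rewrite !big_nat; apply: ler_sum => p hp.
apply: le_trans (ler_norm_sum _ _ _) _; rewrite !big_nat; apply: ler_sum => r hr.
set q := (q0 + u.*2 * p + r)%N.
have hq : (q0 <= q < q0 + Q)%N by rewrite Qu /q; nia.
have hq' : (q0 <= q + u < q0 + Q)%N by rewrite Qu /q; nia.
have S' : S (q + u)%N = - S q by exact: sine_increment_low.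
have a1 := approx q hq; have a2 := approx _ hq'.
have b1 : `|cot (pi * (x - bar q)) - cot (pi * (x - bar (q + u)))| <=
    Lam * 8 ^- i.
  have m1 : bar q <= bar q <= bar q + bar_length by rewrite lexx lerDl ltW.
  have m2 : bar (q + u) <= bar (q + u) <= bar (q + u) + bar_length.
    by rewrite lexx lerDl ltW.
  apply: le_trans (cot_lipschitz dl0 (hx q hq _ m1) (hx _ hq' _ m2)) _.
  apply: ler_wpM2l => //; rewrite bar_shift //.
  rewrite (_ : _ - _ = (2 * (8 ^ i)%:R)^-1); last by ring.
  rewrite ger0_norm ?invr_ge0 ?mulr_ge0 // natrX invfM.
  by have := i0; lra.
have b2 : `|S q| <= bar_length by exact: sine_increment_norm_le.
rewrite -/(I q) -/(I (q + u)%N) (_ : I q + I (q + u)%N =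
    (I q - cot (pi * (x - bar q)) * S q) +
    (I (q + u)%N - cot (pi * (x - bar (q + u))) * S (q + u)%N) +
    (cot (pi * (x - bar q)) - cot (pi * (x - bar (q + u)))) * S q); last first.
  by rewrite S'; ring.
apply: le_trans (ler_normD _ _) _.
apply: (@le_trans _ _ (2 * (Lam * bar_length * bar_length) + Lam * 8 ^- i * bar_length)).
  apply: lerD; last by rewrite normrM; apply: ler_pM.
  by apply: le_trans (ler_normD _ _) _; lra.
have : 0 <= Lam * 8 ^- i * bar_length by exact: (mulr_ge0 (mulr_ge0 Lam0 i0) l1).
lra.
Qed.

End Bars.

(** * Integral of the kernel over a mass leaf *)

Section LeafKernel.
Context {R : realType}.
Variables (D : nat -> R) (c c0 : nat).
Hypothesis D_ge0 : forall j, 0 <= D j.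
Hypothesis c0c : (c0 < c)%N.

Implicit Type l : mleaf R.

(** The factor [1/8] carries the unit interval to the arc where the function
    lives. For aligned leaves, truncation does not change this number and
    [leaf_count]. *)
Definition leaf_start l : nat := Num.truncn (mpos l / 8 * 8 ^+ (c + moff l)).
Definition leaf_count l : nat := Num.truncn (mlen l / 8 * 8 ^+ (c + moff l)).
Definition leaf_bar l (q : nat) : R := bar (c + moff l) (mdig l) q.
Definition leaf_width l : R := bar_length (c + moff l) (mdig l).
(** Only the proportion [8 ^- size (mdig l)] of the leaf carries the
    function; the height compensates for it, and gives the leaf the mean
    [D (mlev l)]. *)
Definition leaf_height l : R := D (mlev l) * 8 ^+ size (mdig l).

Definition leaf_kernel n x l : R :=
  \sum_(leaf_start l <= q < leaf_start l + leaf_count l)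
    kernel_integral n x (leaf_bar l q) (leaf_bar l q + leaf_width l).

Lemma aligned_nat (p : R) o : aligned c0 p -> exists k : nat,
  p / 8 * 8 ^+ (c + o) = (k * 8 ^ (c + o - c0.+1))%:R.
Proof.
move=> [k hk]; exists k.
have E : (c + o = c0 + (c + o - c0.+1).+1)%N by lia.
by rewrite natrM -hk natrX {1}E exprD exprS; field; rewrite ?expf_neq0.
Qed.

Lemma leaf_start_eq l : aligned c0 (mpos l) ->
  (leaf_start l)%:R = mpos l / 8 * 8 ^+ (c + moff l).
Proof. by move=> /(@aligned_nat _ (moff l))[k hk]; rewrite /leaf_start hk natrK. Qed.

Lemma leaf_count_eq l : aligned c0 (mlen l) ->
  (leaf_count l)%:R = mlen l / 8 * 8 ^+ (c + moff l).
Proof. by move=> /(@aligned_nat _ (moff l))[k hk]; rewrite /leaf_count hk natrK. Qed.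

Lemma leaf_count_dvd l : aligned c0 (mlen l) ->
  (8 ^ (c + moff l - c0.+1) %| leaf_count l)%N.
Proof.
move=> /(@aligned_nat _ (moff l))[k hk]; rewrite /leaf_count hk natrK.
exact: dvdn_mull.
Qed.

Lemma leaf_width_gt0 l : 0 < leaf_width l.
Proof. exact: bar_length_gt0. Qed.

Lemma leaf_bar_inside l q : maligned c0 l ->
  (leaf_start l <= q < leaf_start l + leaf_count l)%N ->
  mpos l / 8 <= leaf_bar l q /\
  leaf_bar l q + leaf_width l <= (mpos l + mlen l) / 8.
Proof.
move=> [hp hl] /andP[q1 q2].
have [b1 b2] := @bar_block R (c + moff l) (mdig l) q.
have e0 : 0 < 8 ^+ (c + moff l) :> R by rewrite exprn_gt0.
split.
  apply: le_trans b1; rewrite ler_pdivlMr // -leaf_start_eq //.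
  by rewrite ler_nat.
apply: le_trans b2 _; rewrite ler_pdivrMr // !mulrDl -leaf_start_eq // -leaf_count_eq //.
by rewrite -natrD ler_nat.
Qed.

Lemma leaf_mass l : aligned c0 (mlen l) ->
  leaf_height l * ((leaf_count l)%:R * leaf_width l) = mass D l / 8.
Proof.
move=> hl; rewrite leaf_count_eq // /leaf_height /leaf_width /bar_length /mass.
have e0 n : 8 ^+ n != 0 :> R by rewrite expf_neq0.
by rewrite (exprD _ (c + _)); field; rewrite !e0.
Qed.

Lemma leaf_height_ge0 l : 0 <= leaf_height l.
Proof. by rewrite mulr_ge0 // exprn_ge0. Qed.

Lemma leaf_kernel_ge n x l (k : R) : aligned c0 (mlen l) ->
  (forall q, (leaf_start l <= q < leaf_start l + leaf_count l)%N ->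
    k * leaf_width l <=
    kernel_integral n x (leaf_bar l q) (leaf_bar l q + leaf_width l)) ->
  k * (mass D l / 8) <= leaf_height l * leaf_kernel n x l.
Proof.
move=> hl h; rewrite -leaf_mass // mulrCA; apply: ler_wpM2l.
  exact: leaf_height_ge0.
rewrite mulrCA mulr_natl /leaf_kernel.
have -> : k * leaf_width l *+ leaf_count l =
    \sum_(leaf_start l <= q < leaf_start l + leaf_count l) k * leaf_width l.
  by rewrite sumr_const_nat addKn.
by rewrite !big_nat; apply: ler_sum.
Qed.

Lemma leaf_bar_away l t d : in_unit (mpos l) (mlen l) -> maligned c0 l ->
  0 < t < 1 -> (mpos l + mlen l + 8 * d <= t) || (t + 8 * d <= mpos l) ->
  forall q, (leaf_start l <= q < leaf_start l + leaf_count l)%N ->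
  away (t / 8) d (leaf_bar l q) (leaf_bar l q + leaf_width l).
Proof.
move=> /and3P[p0 l0 pl1] ha /andP[t0 t1] hd q hq y /andP[y1 y2].
have [h1 h2] := leaf_bar_inside ha hq.
rewrite ler_norml lerNl opprB; case/orP: hd => hd.
  have : d <= t / 8 - y by lra.
  by move=> h; rewrite (le_trans h (ler_norm _)) /=; apply/andP; split; lra.
have : d <= y - t / 8 by lra.
move=> h; rewrite distrC (le_trans h (ler_norm _)) /=.
by apply/andP; split; lra.
Qed.

(** On an active leaf the sine has a constant sign on all the bars, and is at
    least [1/2] in absolute value. An inactive leaf has all its digits before
    or all after the position [c + i], and [inactive_sum] applies. *)
Lemma leaf_estimate l t i dl : in_unit (mpos l) (mlen l) -> maligned c0 l ->
  0 < t < 1 -> 0 < dl ->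
  (mpos l + mlen l + 8 * dl <= t) || (t + 8 * dl <= mpos l) ->
  contribution 16^-1 1 D l t i - mass D l * (8 ^- c / dl ^+ 2) <=
  leaf_height l * leaf_kernel (8 ^ (c + i)) (t / 8) l.
Proof.
move=> hu ha t01 dl0 ht; have /andP[t0 t1] := t01; have m0 := mass_ge0 D_ge0 hu.
have w0 := leaf_width_gt0 l; have [hp hl] := ha.
have /and3P[p0 l0 pl1] := hu.
have err0 : 0 <= mass D l * (8 ^- c / dl ^+ 2).
  by rewrite mulr_ge0 // divr_ge0 ?invr_ge0 ?exprn_ge0 // ltW.
have inside q (hq : (leaf_start l <= q < leaf_start l + leaf_count l)%N) :=
  leaf_bar_inside ha hq.
have waway d := leaf_bar_away (d := d) hu ha t01.
have mE : mass D l = 8 * (mass D l / 8) by field.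
rewrite /contribution; case: ifP => hact; last first.
  have hin : (c + i < c + moff l)%N && (8 ^ (c + moff l - (c + i)) %| leaf_count l)%N ||
      (c + moff l + size (mdig l) <= c + i)%N.
    have [lt|ge] := ltnP i (moff l).
      rewrite ltn_add2l lt /= (dvdn_trans _ (leaf_count_dvd hl)) //.
      by rewrite dvdn_exp2l // leq_sub2l // (leq_trans c0c) // leq_addr.
    by move/negbT: hact; rewrite /active ge /= -leqNgt => h;
      apply/orP; right; rewrite -addnA leq_add2l.
  have := inactive_sum dl0 (waway _ ht) hin.
  rewrite -/(leaf_kernel _ _ l) => hle.
  have hle2 : `|leaf_height l * leaf_kernel (8 ^ (c + i)) (t / 8) l| <=
      mass D l * (8 ^- c / dl ^+ 2).
    rewrite normrM ger0_norm ?leaf_height_ge0 //.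
    apply: le_trans (ler_wpM2l (leaf_height_ge0 l) hle) _.
    rewrite -[bar_length _ _]/(leaf_width l).
    rewrite [leLHS](_ : _ = leaf_height l * ((leaf_count l)%:R * leaf_width l) *
      (4 / dl ^+ 2) * (leaf_width l + 8 ^- (c + i))); last by ring.
    rewrite leaf_mass //.
    rewrite [leRHS](_ : _ = mass D l / 8 * (4 / dl ^+ 2) * (2 * 8 ^- c)); last first.
      by field; rewrite ?expf_neq0 ?gt_eqF.
    apply: ler_wpM2l.
      by rewrite mulr_ge0 // divr_ge0 // exprn_ge0 // ltW.
    have small n : 8 ^- (c + n) <= 8 ^- c :> R.
      rewrite lef_pV2 ?posrE ?exprn_gt0 //.
      by rewrite ler_weXn2l ?leq_addr // ler1n.
    have := small i; have := small (moff l + size (mdig l))%N.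
    by rewrite addnA -/(leaf_width l); rewrite /leaf_width /bar_length; lra.
  by move: hle2; rewrite ler_norml => /andP[h _]; lra.
suff H : forall k : R, (forall q, (leaf_start l <= q < leaf_start l + leaf_count l)%N ->
    k * leaf_width l <=
    kernel_integral (8 ^ (c + i)) (t / 8) (leaf_bar l q) (leaf_bar l q + leaf_width l)) ->
    k * (mass D l / 8) - mass D l * (8 ^- c / dl ^+ 2) <=
    leaf_height l * leaf_kernel (8 ^ (c + i)) (t / 8) l.
  have hact' := hact.
  case/andP: hact' => i1 i2.
  have isub : (i - moff l < size (mdig l))%N by rewrite ltn_subLR.
  have hsin q y : leaf_bar l q <= y <= leaf_bar l q + leaf_width l ->
      if nth false (mdig l) (i - moff l)
      then 2^-1 <= sin (2 * pi * (8 ^ (c + i))%:R * y)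
      else sin (2 * pi * (8 ^ (c + i))%:R * y) <= - 2^-1.
    move=> hy; have := bar_sin isub hy.
    by rewrite -addnA subnKC.
  have bad d : 0 < d -> (mpos l + mlen l + 8 * d <= t) || (t + 8 * d <= mpos l) ->
      - (1 * mass D l / (8 * d)) - mass D l * (8 ^- c / dl ^+ 2) <=
      leaf_height l * leaf_kernel (8 ^ (c + i)) (t / 8) l.
    move=> d0 hd; rewrite (_ : - _ = - d^-1 * (mass D l / 8)); last first.
      by field; exact: lt0r_neq0.
    apply: H => q hq; have w1 := ltW w0.
    have := @kernel_integral_norm_le _ (8 ^ (c + i)) (t / 8) d (leaf_bar l q)
      (leaf_bar l q + leaf_width l) d0.
    rewrite lerDl => /(_ w1 (waway _ hd q hq)).
    rewrite (_ : leaf_bar l q + leaf_width l - leaf_bar l q = leaf_width l); last by ring.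
    by rewrite ler_norml mulNr => /andP[].
  case/orP: ht => ht.
    have -> : mpos l + mlen l <= t by lra.
    case: ifP => hn; last first.
      have := bad ((t - (mpos l + mlen l)) / 8).
      rewrite mulrCA mulrV ?unitfE // mulr1; apply; first by lra.
      by apply/orP; left; lra.
    rewrite (_ : 16^-1 * _ / _ = (2 * (t - mpos l))^-1 * (mass D l / 8)); last first.
      by field; rewrite ?gt_eqF //; lra.
    apply: H => q hq; have [h1 h2] := inside q hq.
    have w1 : leaf_bar l q <= leaf_bar l q + leaf_width l by rewrite lerDl ltW.
    have := @kernel_integral_left _ (8 ^ (c + i)) (t / 8) _ _ w1.
    rewrite (_ : leaf_bar l q + leaf_width l - leaf_bar l q = leaf_width l); last by ring.
    move=> K; apply: le_trans (K _ _ _); last first.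
    + by move=> y hy; have := hsin q y hy; rewrite hn.
    + by lra.
    + by lra.
    by rewrite ler_pM2r // lef_pV2 ?posrE; lra.
  rewrite ifN; last by rewrite -ltNge; lra.
  case: ifP => hn.
    have := bad ((mpos l - t) / 8).
    rewrite mulrCA mulrV ?unitfE // mulr1; apply; first by lra.
    by apply/orP; right; lra.
  rewrite (_ : 16^-1 * _ / _ = (2 * (mpos l + mlen l - t))^-1 * (mass D l / 8)); last first.
    by field; rewrite ?gt_eqF //; lra.
  apply: H => q hq; have [h1 h2] := inside q hq.
  have w1 : leaf_bar l q <= leaf_bar l q + leaf_width l by rewrite lerDl ltW.
  have := @kernel_integral_right _ (8 ^ (c + i)) (t / 8) _ _ w1.
  rewrite (_ : leaf_bar l q + leaf_width l - leaf_bar l q = leaf_width l); last by ring.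
  move=> K; apply: le_trans (K _ _ _); last first.
  + by move=> y hy; have := hsin q y hy; rewrite hn.
  + by lra.
  + by lra.
  by rewrite ler_pM2r // lef_pV2 ?posrE; lra.
move=> k hk; have := leaf_kernel_ge hl hk; lra.
Qed.

End LeafKernel.

(** * Step functions on the circle *)

Section StepFunctions.
Context {R : realType}.
Local Notation mu := (@lebesgue_measure R).

Definition block : Type := (R * R * R)%type.
Definition bheight (w : block) : R := w.1.1.
Definition bleft (w : block) : R := w.1.2.
Definition bright (w : block) : R := w.2.

Definition fracpart (y : R) : R := y - (Num.floor y)%:~R.

Definition in_block (w : block) (y : R) : bool := bleft w <= y < bright w.

Definition step_fun (s : seq block) (y : R) : R :=
  \sum_(w <- s) bheight w * (in_block w (fracpart y))%:R.

(** The right end is at most [1/8], so that the circle may be cut outside the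
    support and all distances in it are at most [1/8]. *)
Definition block_ok (w : block) := (0 <= bleft w) && (bleft w < bright w) && (bright w <= 8^-1).

Lemma fracpart_itv (z : int) y : z%:~R <= y < z%:~R + 1 -> fracpart y = y - z%:~R.
Proof. by move=> hy; rewrite /fracpart (@floor_def _ y z) // intrD. Qed.

Lemma step_fun_periodic s : periodic (step_fun s) 1.
Proof.
move=> y; apply: eq_bigr => w _; congr (_ * (in_block w _)%:R).
have /andP[h1 h2] : (Num.floor y)%:~R <= y < (Num.floor y)%:~R + 1.
  by rewrite floor_le_tmp -[1]/(1%:~R) -intrD floorD1_gt.
rewrite (@fracpart_itv (Num.floor y + 1)) ?intrD.
  by rewrite /fracpart; ring.
by apply/andP; split; lra.
Qed.

Lemma in_block_near (w : block) y : block_ok w -> -2^-1 < y < 5 / 8 ->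
  in_block w (fracpart y) = in_block w y.
Proof.
move=> /andP[/andP[a0 ab] b8] /andP[y1 y2]; have [y0|y0] := leP 0 y.
  by rewrite (@fracpart_itv 0) ?subr0 //; apply/andP; split; lra.
rewrite (@fracpart_itv (-1)); last by rewrite mulrNz; apply/andP; split; lra.
rewrite mulrNz opprK /in_block [RHS]andbC [LHS]andbC.
rewrite (_ : (y + 1%:~R < _) = false); last by apply/negbTE; rewrite -leNgt; lra.
by rewrite (_ : (_ <= y) = false) ?andbF //; apply/negbTE; rewrite -ltNge; lra.
Qed.

Lemma Rintegral_step (D : set (measurableTypeR R)) (s : seq block) (f h : R -> R) : measurable D ->
  {in s, forall w, [/\ bleft w <= bright w, `[bleft w, bright w[ `<=` D &
     {within `[bleft w, bright w], continuous h}]} ->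
  (forall y, D y -> f y = \sum_(w <- s) bheight w * (in_block w y)%:R) ->
  \int[mu]_(y in D) (h y * f y) =
  \sum_(w <- s) bheight w * \int[mu]_(y in `[bleft w, bright w]) h y.
Proof.
move=> mD hs hf.
pose g (w : block) (y : R) := bheight w * (h \_ `[bleft w, bright w[) y.
have intg w : w \in s -> mu.-integrable D (EFin \o (h \_ `[bleft w, bright w[)).
  move=> /hs[ab sub hc].
  rewrite -restrict_EFin; apply: (integrable_restrict mu
    (measurable_itv (Interval (BLeft (bleft w)) (BLeft (bright w)))) mD (EFin \o h)).1.
  rewrite setIidr //; apply: integrableS (integrable_within hc) => //.
  by move=> y /=; rewrite !in_itv /= => /andP[-> /ltW ->].
have intg' w : w \in s -> mu.-integrable D (EFin \o g w).
  move=> /intg hw; have h2 := integrableZl mD (bheight w) hw.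
  apply: eq_integrable h2 => // y _ /=; by rewrite -EFinM.
transitivity (\int[mu]_(y in D) \sum_(w <- s) g w y).
  apply: eq_Rintegral => y /set_mem Dy; rewrite hf // mulr_sumr.
  apply: eq_bigr => w _; rewrite /g mulrCA; congr (_ * _).
  rewrite /in_block patchE; case: ifPn => [|hy].
    by rewrite inE /= in_itv /= => ->; rewrite mulr1.
  rewrite (_ : (_ <= y < _) = false) ?mulr0 //.
  by apply/negbTE/negP => hy'; move/negP: hy; apply; rewrite inE /= in_itv.
have -> : \sum_(w <- s) bheight w * \int[mu]_(y in `[bleft w, bright w]) h y =
    \sum_(w <- s) \int[mu]_(y in D) g w y.
  rewrite big_seq [RHS]big_seq; apply: eq_bigr => w ws; have [ab sub hc] := hs w ws.
  rewrite RintegralZl //; last exact: intg.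
  rewrite -Rintegral_mkcondr setIidr // Rintegral_itv_bndo_bndc //.
  apply: integrableS (integrable_within hc) => //.
  by move=> y /=; rewrite !in_itv /= => /andP[-> /ltW ->].
elim: s intg' {hs hf intg} => [|w s IH] hs.
  under eq_Rintegral do rewrite big_nil.
  by rewrite big_nil Rintegral_cst // mul0r.
rewrite big_cons -IH; last by move=> w' ws; apply: hs; rewrite in_cons ws orbT.
under eq_Rintegral do rewrite big_cons.
rewrite RintegralD //; first by apply: hs; rewrite mem_head.
have : mu.-integrable D (fun y => \sum_(w' <- s | w' \in s) (EFin \o g w') y)%E.
  by apply: integrable_sum => // w' ws; apply: hs; rewrite in_cons ws orbT.
apply: eq_integrable => // y _ /=.
by rewrite -big_seq sumEFin.
Qed.

Lemma away_block_subset x e d w : block_ok w -> 0 < x < 8^-1 -> e < d ->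
  away x d (bleft w) (bright w) ->
  `[bleft w, bright w[ `<=` [set y | e < `|x - y| <= 2^-1].
Proof.
move=> /andP[/andP[w0 w1] w2] hx ed h y /=; rewrite in_itv /= => /andP[y1 y2].
have /h/andP[h1 h2] : bleft w <= y <= bright w by rewrite y1 ltW.
by rewrite (lt_le_trans ed h1) (le_trans h2) //; lra.
Qed.

Lemma measurable_annulus x (e : R) : 0 < e ->
  measurable ([set y | e < `|x - y| <= 2^-1] : set (measurableTypeR R)).
Proof.
move=> e0.
have -> : [set y | e < `|x - y| <= 2^-1] =
    (`[x - 2^-1, x + 2^-1] `&` (`]-oo, x - e[ `|` `]x + e, +oo[)).
  apply/seteqP; split => y /=; rewrite !in_itv /= andbT => H.
    move: H; rewrite distrC ltr_normr ler_norml => /andP[/orP H /andP[h1 h2]].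
    split; first by apply/andP; split; lra.
    by case: H => ?; [right|left]; lra.
  case: H => /andP[h1 h2] H; rewrite distrC ltr_normr ler_norml.
  apply/andP; split; last by apply/andP; split; lra.
  by apply/orP; case: H => ?; [right|left]; lra.
by apply: measurableI => //; exact: measurableU.
Qed.

(** As [sin (n y) = sin (n x) cos (n (x - y)) - cos (n x) sin (n (x - y))],
    the integral against the sine is a combination, with coefficients on the
    unit circle, of the real and imaginary parts. The principal value is that
    of an eventually constant function, because the blocks are away from [x]. *)
Lemma hilbert_step n x d s : 0 < d -> 0 < x < 8^-1 ->
  {in s, forall w, block_ok w /\ away x d (bleft w) (bright w)} ->
  `|\sum_(w <- s) bheight w * kernel_integral n x (bleft w) (bright w)| <=
  Normc.normc (modulated_hilbert n (step_fun s) x).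
Proof.
move=> d0 hx hs; have /andP[x0 x8] := hx.
pose k := 2 * pi * n%:R : R.
pose hc y := cos (k * (x - y)) * cot (pi * (x - y)).
pose hsn y := sin (k * (x - y)) * cot (pi * (x - y)).
pose A := \sum_(w <- s) bheight w * \int[mu]_(y in `[bleft w, bright w]) hc y.
pose B := \sum_(w <- s) bheight w * \int[mu]_(y in `[bleft w, bright w]) hsn y.
have lin : continuous (fun y : R => k * (x - y)).
  move=> y; apply: cvgM; first exact: cvg_cst.
  by apply: cvgB; [exact: cvg_cst|exact: cvg_id].
have contc w : w \in s -> {within `[bleft w, bright w], continuous hc}.
  move=> /hs[_ h] y; apply: cvgM; last first.
    exact: (cot_continuous_within (away_sin d0 h)).
  apply: continuous_subspaceT => z.
  by apply: (@continuous_comp _ _ _ (fun y => k * (x - y)) cos); [exact: lin|exact: continuous_cos].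
have conts w : w \in s -> {within `[bleft w, bright w], continuous hsn}.
  move=> /hs[_ h] y; apply: cvgM; last first.
    exact: (cot_continuous_within (away_sin d0 h)).
  apply: continuous_subspaceT => z.
  by apply: (@continuous_comp _ _ _ (fun y => k * (x - y)) sin); [exact: lin|exact: continuous_sin].
have -> : modulated_hilbert n (step_fun s) x = (A +i* B)%C.
  rewrite /modulated_hilbert.
  have hausC : hausdorff_space (R[i]%C^o) by exact: norm_hausdorff.
  apply: (@lim_near_cst _ hausC _ _ _ (A +i* B)%C).
  near=> e.
  have e0 : 0 < e by near: e; exact: nbhs_right_gt.
  have ed : e < d by near: e; exact: nbhs_right_lt.
  set T := [set y | _].
  have sf y : T y -> step_fun s y = \sum_(w <- s) bheight w * (in_block w y)%:R.
    move=> /andP[h1 h2]; rewrite /step_fun big_seq [RHS]big_seq.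
    apply: eq_bigr => w /hs[wok _]; rewrite in_block_near //.
    by move: h2; rewrite ler_norml => /andP[h2 h3]; apply/andP; split; lra.
  have sub w : w \in s -> bleft w <= bright w /\ `[bleft w, bright w[ `<=` T.
    move=> /hs[wok h]; split; last exact: away_block_subset h.
    by case/andP: wok => /andP[_ /ltW].
  have mT := measurable_annulus x e0.
  congr (_ +i* _)%C.
    transitivity (\int[mu]_(y in T) (hc y * step_fun s y)).
      by apply: eq_Rintegral => y _; rewrite /hc /=; ring.
    apply: Rintegral_step => // w ws; have [? ?] := sub w ws.
    by split=> //; exact: contc.
  transitivity (\int[mu]_(y in T) (hsn y * step_fun s y)).
    by apply: eq_Rintegral => y _; rewrite /hsn /=; ring.
  apply: Rintegral_step => // w ws; have [? ?] := sub w ws.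
  by split=> //; exact: conts.
have -> : \sum_(w <- s) bheight w * kernel_integral n x (bleft w) (bright w) =
    sin (k * x) * A - cos (k * x) * B.
  rewrite /A /B !mulr_sumr -sumrB big_seq [RHS]big_seq; apply: eq_bigr => w ws.
  have ic := integrable_within (contc w ws); have is_ := integrable_within (conts w ws).
  rewrite mulrCA [cos _ * _]mulrCA -mulrBr; congr (_ * _).
  rewrite -RintegralZl // -RintegralZl // -RintegralB //; first last.
  - exact: (integrableZl _ (cos (k * x)) is_).
  - exact: (integrableZl _ (sin (k * x)) ic).
  apply: eq_Rintegral => y _; rewrite -/k /hc /hsn.
  have -> : k * y = k * x - k * (x - y) by ring.
  by rewrite sinB; ring.
(* Cauchy-Schwarz for the unit vector [(sin (k x), - cos (k x))]. *)
rewrite /Normc.normc -sqrtr_sqr ler_sqrt; last by rewrite addr_ge0 ?sqr_ge0.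
have := cos2Dsin2 (k * x); set p := sin _; set q := cos _ => pq.
rewrite -[leRHS]mul1r -pq -subr_ge0.
rewrite (_ : _ - _ = (q * A + p * B) ^+ 2); first exact: sqr_ge0.
by ring.
Unshelve. all: by end_near.
Qed.

End StepFunctions.

(** * Superlevel sets of step functions *)

Section BlockMeasure.
Context {R : realType}.
Local Notation mu := (@lebesgue_measure R).
Implicit Types (s : seq (@block R)) (w : @block R).

Lemma lebesgue_measure_le (A B : set R) : A `<=` B -> (mu A <= mu B)%E.
Proof. by move=> AB; exact: le_mu_ext. Qed.

Definition blocks_set s : set R := [set y | has (in_block^~ y) s].

Definition bwidth w : R := bright w - bleft w.

Definition blocks_disjoint s := forall y, (count (in_block^~ y) s <= 1)%N.

Lemma blocks_disjoint_filter P s : blocks_disjoint s -> blocks_disjoint (seq.filter P s).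
Proof.
move=> h y; apply: leq_trans (h y); rewrite count_filter.
by apply: sub_count => w /= /andP[].
Qed.

Lemma blocks_set_cons w s :
  blocks_set (w :: s) = `[bleft w, bright w[ `|` blocks_set s.
Proof.
apply/seteqP; split => y; rewrite /blocks_set /= in_itv /=.
  by case/orP; [left|right].
by case=> h; apply/orP; [left|right].
Qed.

Lemma blocks_set_nil : blocks_set [::] = set0.
Proof. by apply/seteqP; split. Qed.

Lemma measurable_blocks_set s : measurable (blocks_set s : set (measurableTypeR R)).
Proof.
elim: s => [|w s IH]; last by rewrite blocks_set_cons; exact: measurableU.
by rewrite blocks_set_nil.
Qed.

Lemma measure_blocks_set s : blocks_disjoint s -> {in s, forall w, block_ok w} ->
  mu (blocks_set s) = (\sum_(w <- s) bwidth w)%:E.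
Proof.
elim: s => [|w s IH] hd hok.
  by rewrite blocks_set_nil measure0 big_nil.
have hd' : blocks_disjoint s by move=> y; apply: leq_trans (hd y); rewrite /= leq_addl.
have /andP[/andP[w0 w1] w2] : block_ok w by apply: hok; rewrite mem_head.
have IHs : mu (blocks_set s) = (\sum_(w <- s) bwidth w)%:E.
  by apply: IH => // w' h; apply: hok; rewrite in_cons h orbT.
have mw : mu `[bleft w, bright w[ = (bwidth w)%:E.
  by rewrite lebesgue_measure_itv /= lte_fin w1.
rewrite blocks_set_cons big_cons EFinD -IHs -mw; apply: measureU => //.
- exact: measurable_blocks_set.
- apply/seteqP; split => // y [/=]; rewrite in_itv /= => hw.
  rewrite /blocks_set /= has_count => hs.
  by have := hd y; rewrite /= {1}/in_block hw; lia.
Qed.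

Lemma step_fun_in s y w : blocks_disjoint s -> w \in s -> in_block w (fracpart y) ->
  step_fun s y = bheight w.
Proof.
rewrite /step_fun; elim: s => [//|w' s IH] hd; rewrite in_cons big_cons => hw hin.
have hd' : blocks_disjoint s by move=> z; apply: leq_trans (hd z); rewrite /= leq_addl.
have := hd (fracpart y); rewrite /=.
case: (boolP (in_block w' (fracpart y))) => hw' /= hcount.
  have hs : ~~ has (in_block^~ (fracpart y)) s by rewrite has_count -leqNgt; lia.
  case/orP: hw => [/eqP ->|hw]; last by move/hasPn: hs => /(_ w hw); rewrite hin.
  rewrite mulr1 big_seq big1 ?addr0 // => z /(hasPn hs) /negbTE ->.
  by rewrite mulr0.
case/orP: hw => [/eqP E|hw]; first by move: hw'; rewrite -E hin.
by rewrite mulr0 add0r IH.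
Qed.

Lemma step_fun_out s y : ~~ has (in_block^~ (fracpart y)) s -> step_fun s y = 0.
Proof.
move=> hs; rewrite /step_fun big_seq big1 // => z /(hasPn hs) /negbTE ->.
by rewrite mulr0.
Qed.

Lemma superlevel_step s (l : R) : blocks_disjoint s ->
  {in s, forall w, block_ok w /\ 0 <= bheight w} -> 0 <= l ->
  torus_measure [set x | l < `|step_fun s x|] =
  (\sum_(w <- s | l < bheight w) bwidth w)%:E.
Proof.
move=> hd hs l0; rewrite -big_filter -measure_blocks_set; last 2 first.
- exact: blocks_disjoint_filter.
- by move=> w; rewrite mem_filter => /andP[_ /hs[]].
rewrite /torus_measure /mrestr; congr (mu _); apply/seteqP; split => y.
  case=> /= hy; rewrite in_itv /= => hy01.
  have fy : fracpart y = y by rewrite (@fracpart_itv _ 0) ?subr0 // add0r.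
  case: (boolP (has (in_block^~ (fracpart y)) s)) => [/hasP[w ws hw]|hn].
    move: hy; rewrite (step_fun_in hd ws hw) ger0_norm; last by case: (hs w ws).
    move=> hy; apply/hasP; exists w; first by rewrite mem_filter hy.
    by rewrite -fy.
  by move: hy; rewrite step_fun_out // normr0 ltNge l0.
move=> /hasP[w]; rewrite mem_filter => /andP[lw ws] hw.
have [/andP[/andP[w0 w1] w2] h0] := hs w ws.
have hy01 : 0 <= y < 1 by case/andP: hw => ? ?; apply/andP; split; lra.
have fy : fracpart y = y by rewrite (@fracpart_itv _ 0) ?subr0 // add0r.
split; last by rewrite /= in_itv.
by rewrite /= (step_fun_in hd ws) ?fy // ger0_norm.
Qed.

End BlockMeasure.

(** * Lorentz norms of step functions *)

Section LorentzBounds.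
Context {R : realType}.
Local Open Scope ereal_scope.

(** The integral of a nonnegative function is a supremum over simple functions
    below it, which is monotone whether or not the functions are measurable;
    this spares the measurability of the rearrangement. *)
Lemma ge0_le_integral_all d (T : measurableType d) (mu : {measure set T -> \bar R})
    (D : set T) (f g : T -> \bar R) :
  (forall x, D x -> 0 <= f x) -> (forall x, D x -> f x <= g x) ->
  \int[mu]_(x in D) f x <= \int[mu]_(x in D) g x.
Proof.
move=> f0 fg.
have le x : 0 <= (f \_ D) x <= (g \_ D) x.
  rewrite !patchE; case: ifPn => [/set_mem Dx|_]; last by rewrite lexx.
  by rewrite f0 // fg.
rewrite integral_mkcond [leRHS]integral_mkcond.
rewrite !ge0_integralTE; first last.
- by move=> x; case/andP: (le x).
- by move=> x; case/andP: (le x) => h1 h2; exact: le_trans h1 h2.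
apply: le_ereal_sup => _ [h hf <-]; exists h => // x; by apply: le_trans (hf x) _; case/andP: (le x).
Qed.

Variable phi : cumulative R R.
Hypothesis phi0 : phi 0%R = 0%R.

Lemma stieltjes_ocitv (a b : R) : (a <= b)%R ->
  lebesgue_stieltjes_measure phi `]a, b] = (phi b - phi a)%:E.
Proof.
move=> ab; rewrite /lebesgue_stieltjes_measure /measure_extension.
by rewrite measurable_mu_extE /= ?wlength_itv_bnd //; exact: is_ocitv.
Qed.

Definition step_majorant J (v tau : nat -> R) (s : R) : R :=
  (\sum_(0 <= j < J) v j * (s <= tau j)%R%:R)%R.

(** Each term is the indicator of an interval from [0] to [tau j], which has
    measure [phi (tau j)]. *)
Lemma stieltjes_step_integral J (v tau : nat -> R) :
  (forall j, 0 <= v j)%R -> (forall j, 0 <= tau j <= 1)%R ->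
  \int[lebesgue_stieltjes_measure phi]_(s in `]0%R, 1%R])
    (step_majorant J v tau s)%:E =
  (\sum_(0 <= j < J) v j * phi (tau j))%:E.
Proof.
move=> v0 t01.
pose h j (s : R) := (v j)%:E * (\1_(`]-oo, tau j]%classic) s)%:E.
transitivity (\int[lebesgue_stieltjes_measure phi]_(s in `]0%R, 1%R])
    (\sum_(0 <= j < J) h j s)).
  apply: eq_integral => s _; rewrite /step_majorant /h.
  under [RHS]eq_bigr do rewrite -EFinM.
  rewrite sumEFin; congr (_%:E); apply: eq_bigr => j _; congr (_ * _)%R.
  rewrite indicE; congr (nat_of_bool _)%:R.
  by apply/idP/idP; rewrite inE /= in_itv.
rewrite ge0_integral_sum //; last 2 first.
- move=> j; apply: measurable_funeM; apply/measurable_EFinP.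
  exact: measurable_indic.
- by move=> j s _; rewrite mule_ge0 // lee_fin.
rewrite -sumEFin; apply: eq_bigr => j _; have /andP[t0 t1] := t01 j.
rewrite ge0_integralZl_EFin //; last first.
  by apply/measurable_EFinP; exact: measurable_indic.
rewrite integral_indic // EFinM; congr (_ * _).
rewrite (_ : `]-oo, tau j] `&` `]0%R, 1%R] = `]0%R, tau j]%classic).
  by have := stieltjes_ocitv t0; rewrite phi0 subr0.
apply/seteqP; split => s /=; rewrite !in_itv /=.
  by move=> [-> /andP[->]].
by move=> /andP[s0 st]; rewrite s0 st (le_trans st).
Qed.

Lemma lorentz_norm_le f J (v tau : nat -> R) :
  (forall j, 0 <= v j)%R -> (forall j, 0 <= tau j <= 1)%R ->
  (forall s, (0 < s <= 1)%R -> 0 <= rearrangement f s <= (step_majorant J v tau s)%:E) ->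
  lorentz_norm phi f <= (\sum_(0 <= j < J) v j * phi (tau j))%:E.
Proof.
move=> v0 t01 h; rewrite -stieltjes_step_integral //.
by apply: ge0_le_integral_all => s /=; rewrite in_itv /= => /h/andP[].
Qed.

Lemma lorentz_norm_ge f J (v tau : nat -> R) :
  (forall j, 0 <= v j)%R -> (forall j, 0 <= tau j <= 1)%R ->
  (forall s, (0 < s <= 1)%R -> (step_majorant J v tau s)%:E <= rearrangement f s) ->
  (\sum_(0 <= j < J) v j * phi (tau j))%:E <= lorentz_norm phi f.
Proof.
move=> v0 t01 h; rewrite -stieltjes_step_integral //.
apply: ge0_le_integral_all => s /=; rewrite in_itv /=; last exact: h.
by move=> _; rewrite lee_fin sumr_ge0 // => j _; rewrite mulr_ge0.
Qed.

End LorentzBounds.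

Section StepRearrangement.
Context {R : realType}.
Variables (s : seq (@block R)) (J : nat) (v tau sigma : nat -> R).
Hypothesis s_disj : blocks_disjoint s.
Hypothesis s_ok : {in s, forall w, block_ok w /\ 0 <= bheight w}.
Hypothesis s_height : {in s, forall w, exists2 j, (j < J)%N & bheight w = v j}.
Hypothesis v_ge0 : forall j, 0 <= v j.
Hypothesis v_double : forall j, 2 * v j <= v j.+1.

Let v_homo i j : (i <= j)%N -> v i <= v j.
Proof.
move=> /subnKC <-; elim: (j - i)%N => [|k IH]; first by rewrite addn0.
by rewrite addnS; have := v_double (i + k); have := v_ge0 (i + k); lra.
Qed.

Lemma sum_doubling j : \sum_(0 <= i < j.+1) v i <= 2 * v j.
Proof.
elim: j => [|j IH]; first by rewrite big_nat1; have := v_ge0 0; lra.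
by rewrite big_nat_recr //=; have := v_double j; lra.
Qed.

Let bwidth_ge0 w : w \in s -> 0 <= bwidth w.
Proof. by move=> /s_ok[/andP[/andP[_ /ltW h] _] _]; rewrite subr_ge0. Qed.

Lemma width_le (P Q : pred (@block R)) : {in s, forall w, P w -> Q w} ->
  \sum_(w <- s | P w) bwidth w <= \sum_(w <- s | Q w) bwidth w.
Proof.
move=> PQ; rewrite big_mkcond [leRHS]big_mkcond /= !big_seq.
apply: ler_sum => w ws; case: ifP => [/(PQ w ws) ->//|_].
by case: ifP => // _; exact: bwidth_ge0.
Qed.

Lemma rearrangement_step_ge0 t : (0 <= rearrangement (step_fun s) t)%E.
Proof. by apply: le_ereal_inf_tmp => _ [l [l0 _] <-]; rewrite lee_fin. Qed.

(** Let [j] be the first level above the majorant at [t]. Then [tau j < t],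
    and the set above level [j] has measure at most [tau j]. *)
Lemma rearrangement_step_le t :
  (forall j, (j < J)%N -> \sum_(w <- s | v j <= bheight w) bwidth w <= tau j) ->
  0 < t ->
  (rearrangement (step_fun s) t <= (step_majorant J v tau t)%:E)%E.
Proof.
move=> htau t0; set l := step_majorant _ _ _ _.
have l0 : 0 <= l by apply: sumr_ge0 => j _; rewrite mulr_ge0.
apply: ereal_inf_lbound; exists l => //; split=> //.
rewrite superlevel_step // lee_fin.
have [[j0 /andP[jJ lj]]|no] := pselect (exists j, (j < J)%N && (l < v j)); last first.
  rewrite big_seq_cond big1 ?ltW // => w /andP[ws lw]; case: no.
  by have [j jJ E] := s_height ws; exists j; rewrite jJ -E.
have ex : exists j, (j < J)%N && (l < v j) by exists j0; rewrite jJ lj.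
case: (ex_minnP ex) => j /andP[{}jJ {}lj] jmin.
have : tau j < t.
  rewrite ltNge; apply/negP => tj; move: lj; rewrite ltNge => /negP; apply.
  rewrite /l /step_majorant (bigD1_seq j) ?mem_index_iota ?iota_uniq //= tj mulr1.
  by rewrite lerDl sumr_ge0 // => i _; rewrite mulr_ge0.
move=> /ltW; apply: le_trans; apply: le_trans (htau j jJ).
apply: width_le => w ws lw; have [i iJ E] := s_height ws.
by rewrite E v_homo // jmin // iJ -E.
Qed.

(** For the last [j] with [t <= sigma j], the value [v j] is a lower bound
    of the rearrangement; as the heights double, it is at least half of the
    sum of the levels up to it. *)
Lemma rearrangement_step_ge t :
  (forall j, (j < J)%N -> sigma j < \sum_(w <- s | v j <= bheight w) bwidth w) ->
  0 < t ->
  ((step_majorant J (fun j => v j / 2) sigma t)%:E <= rearrangement (step_fun s) t)%E.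
Proof.
move=> hsig t0.
have [[j0 /andP[jJ tj]]|no] := pselect (exists j, (j < J)%N && (t <= sigma j)); last first.
  rewrite /step_majorant big_nat big1; first exact: rearrangement_step_ge0.
  move=> j jJ; case: (boolP (t <= sigma j)) => tj; last by rewrite mulr0.
  by case: no; exists j; rewrite tj andbT.
have ex : exists j, (j < J)%N && (t <= sigma j) by exists j0; rewrite jJ tj.
have bd j : (j < J)%N && (t <= sigma j) -> (j <= J)%N by case/andP => /ltnW.
case: (ex_maxnP ex bd) => j /andP[{}jJ {}tj] jmax.
apply: (@le_trans _ _ (v j)%:E); last first.
  apply: le_ereal_inf_tmp => _ [l [l0 hl] <-]; rewrite lee_fin leNgt; apply/negP => lv.
  move: hl; rewrite superlevel_step // lee_fin => hl.
  have : \sum_(w <- s | v j <= bheight w) bwidth w <= \sum_(w <- s | l < bheight w) bwidth w.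
    by apply: width_le => w _; exact: lt_le_trans.
  by have := hsig j jJ; lra.
rewrite lee_fin /step_majorant (big_cat_nat (n := j.+1)) //=.
rewrite [X in _ + X]big_nat [X in _ + X]big1 ?addr0; last first.
  move=> i /andP[ji iJ]; case: (boolP (t <= sigma i)) => ti; last by rewrite mulr0.
  by have := jmax i; rewrite iJ ti => /(_ isT); rewrite leqNgt ji.
apply: (@le_trans _ _ (\sum_(0 <= i < j.+1) v i / 2)).
  apply: ler_sum => i _; case: (t <= sigma i); rewrite ?mulr1 ?mulr0 //.
  by rewrite divr_ge0.
by rewrite -mulr_suml ler_pdivrMr // mulrC; exact: sum_doubling.
Qed.

End StepRearrangement.

(** * Free leaves with a large gain *)

Lemma bernoulli (R : realFieldType) (x : R) n : 0 <= x <= 1 ->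
  1 - n%:R * x <= (1 - x) ^+ n.
Proof.
move=> /andP[x0 x1]; elim: n => [|n IH]; first by rewrite expr0 mul0r subr0.
rewrite exprS -natr1; apply: le_trans (ler_wpM2l _ IH); last lra.
have : 0 <= n%:R * x * x by rewrite !mulr_ge0.
by nra.
Qed.

Section GoodLeaves.
Context {R : realType}.
Variables (g L J : nat) (K : nat -> nat).
Hypotheses (g_ge : (16 <= g)%N) (L_ge3 : (3 <= L)%N) (gLJ : (g ^ L = 2 * J)%N).

Let g0 : 0 < g%:R :> R. Proof. by rewrite ltr0n (leq_trans _ g_ge). Qed.
Let q : R := g%:R ^- L.
Let q_gt0 : 0 < q. Proof. by rewrite invr_gt0 exprn_gt0. Qed.
Let J0 : (0 < J)%N.
Proof. by have : (0 < g ^ L)%N; [rewrite expn_gt0 (leq_trans _ g_ge)|rewrite gLJ muln_gt0]. Qed.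
Let qJ : J%:R * q = 2^-1.
Proof.
rewrite /q -natrX gLJ natrM invfM mulrCA mulfV ?mulr1 //.
by rewrite pnatr_eq0 -lt0n.
Qed.

Lemma exit_sum n : \sum_(0 <= u < n) g%:R ^- (n - u.+1) * (1 - g%:R^-1) =
  1 - g%:R ^- n :> R.
Proof.
elim: n => [|n IH]; first by rewrite big_nil expr0 invr1 subrr.
rewrite big_nat_recr //= subnn expr0 invr1 mul1r.
have -> : \sum_(0 <= u < n) g%:R ^- (n.+1 - u.+1) * (1 - g%:R^-1) =
    g%:R^-1 * (1 - g%:R ^- n) :> R.
  rewrite -IH mulr_sumr; apply: eq_big_nat => u /andP[_ un].
  by rewrite subSn // exprS invfM mulrA.
by rewrite exprS invfM; ring.
Qed.

Lemma free_length : 2^-1 <= \sum_(f <- fleaves g L K J) flen f :> R.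
Proof.
have := @fleaves_sum R g L K (leq_trans _ g_ge) (fun=> 1) J.
move=> /(_ isT (fun _ _ => esym (mulr1 _)) erefl).
under eq_bigr do rewrite mulr1.
move=> ->; under eq_bigr do rewrite mulr1.
rewrite exit_sum; apply: le_trans (bernoulli J _); first by rewrite -/q qJ; lra.
rewrite ltW //= invf_le1 ?exprn_gt0 // exprn_ege1 // ler1n.
by rewrite (leq_trans _ g_ge).
Qed.

(** A weak form of convexity, sufficient for exponential moments of variables
    in the unit interval. *)
Lemma expRN_le (u : R) : 0 <= u <= 1 -> expR (- u) <= 1 - u / 2.
Proof.
move=> /andP[u0 u1]; rewrite expRN -[leLHS]mul1r ler_pdivrMr ?expR_gt0 //.
have h := expR_ge1Dx u.
apply: (@le_trans _ _ ((1 - u / 2) * (1 + u))); first by nra.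
by rewrite ler_pM2l //; lra.
Qed.

(** The factor of each level is at most [1 - 4 L g ^- L], because
    [exp (- x) <= 1 - x / 2] on the unit interval and [g >= 16];
    there are [g ^ L / 2] levels. *)
Lemma free_exp_sum : \sum_(f <- fleaves g L K J) flen f * expR (- fgain f) <=
  expR (- (2 * L%:R)) :> R.
Proof.
rewrite (@fleaves_sum R g L K (leq_trans _ g_ge) (fun x => expR (- x))) //; last first.
- by rewrite oppr0 expR0.
- by move=> x y; rewrite opprD expRD.
have g16 : 16 <= g%:R :> R by rewrite ler_nat.
have g1 : 1 <= g%:R :> R by rewrite ler1n (leq_trans _ g_ge).
have gi1 : 0 <= 1 - (g%:R : R)^-1 by rewrite subr_ge0 invf_le1.
have gi : 0 < (g%:R : R)^-1 by rewrite invr_gt0.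
have gig : g%:R * g%:R^-1 = 1 :> R by rewrite mulfV // gt_eqF.
have step : \sum_(0 <= u < L) g%:R ^- (L - u.+1) * (1 - g%:R^-1) *
    expR (- g%:R ^- u) <= 1 - L%:R * (4 * q) :> R.
  apply: (@le_trans _ _ (\sum_(0 <= u < L) (g%:R ^- (L - u.+1) * (1 - g%:R^-1)
      - 4 * q))); last first.
    rewrite big_split /= exit_sum sumr_const_nat subn0 -/q -mulr_natl.
    have := q_gt0; lra.
  rewrite !big_nat; apply: ler_sum => u /andP[_ uL].
  have u0 : 0 < g%:R ^- u :> R by rewrite invr_gt0 exprn_gt0.
  have u1 : g%:R ^- u <= 1 :> R.
    by rewrite invf_le1 ?exprn_gt0 // exprn_ege1.
  have e0 : 0 < g%:R ^- (L - u.+1) :> R by rewrite invr_gt0 exprn_gt0.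
  have E : g%:R ^- (L - u.+1) * g%:R ^- u = g%:R * q.
    rewrite /q -invfM -exprD -{2}[L](_ : (L - u.+1 + u).+1 = L); last by rewrite -addnS subnK.
    by rewrite exprS invfM mulrA gig mul1r.
  have p0 : 0 <= g%:R ^- (L - u.+1) * (1 - g%:R^-1) :> R.
    by rewrite mulr_ge0 // ltW.
  apply: le_trans (ler_wpM2l p0 (expRN_le _)) _; first by rewrite u1 ltW.
  rewrite mulrBr mulr1 lerD2l lerN2.
  rewrite (_ : _ * (_ / 2) = (g%:R * q) * (1 - g%:R^-1) / 2); last by rewrite -E; ring.
  rewrite (_ : _ / 2 = (g%:R - 1) / 2 * q); first by rewrite ler_pM2r //; lra.
  rewrite (_ : g%:R * q * _ = (g%:R - g%:R * g%:R^-1) * q); last by ring.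
  by rewrite gig; ring.
apply: (@le_trans _ _ (expR (- (L%:R * (4 * q))) ^+ J)).
  apply: lerXn2r; rewrite ?nnegrE ?expR_ge0 //.
    by apply: sumr_ge0 => u _; rewrite mulr_ge0 ?expR_ge0 // mulr_ge0.
  by apply: le_trans step _; exact: expR_ge1Dx.
rewrite -expRM_natl ler_expR mulrN lerN2.
by rewrite mulrCA [J%:R * _]mulrCA qJ; lra.
Qed.

(** By the exponential Markov inequality the free leaves with gain below [L]
    have total length at most [exp L * exp (- 2 L)], to be compared with
    the total length of all of them, at least [1/2]. *)
Lemma good_length :
  4^-1 <= \sum_(f <- fleaves g L K J | L%:R <= fgain f) flen f :> R.
Proof.
have u f : f \in fleaves g L K J -> 0 <= flen f :> R.
  move=> /(fleaves_unit (leq_trans (isT : 1 < 16)%N g_ge)) /and3P[_ /ltW].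
  by [].
have split_ : \sum_(f <- fleaves g L K J) flen f =
    \sum_(f <- fleaves g L K J | L%:R <= fgain f) flen f +
    \sum_(f <- fleaves g L K J | ~~ (L%:R <= fgain f)) flen f :> R.
  by rewrite (bigID (fun f => L%:R <= fgain f)).
suff bad : \sum_(f <- fleaves g L K J | ~~ (L%:R <= fgain f)) flen f <= 4^-1 :> R.
  by have := free_length; rewrite split_; lra.
(* Where the gain is below [L], [1 <= exp (L - gain)]. *)
apply: (@le_trans _ _ (expR L%:R * expR (- (2 * L%:R)))).
  apply: le_trans (ler_wpM2l (expR_ge0 _) free_exp_sum).
  rewrite mulr_sumr big_mkcond /= big_seq [leRHS]big_seq; apply: ler_sum => f ff.
  case: ifP => [|_]; last by rewrite !mulr_ge0 ?expR_ge0 // u.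
  rewrite -ltNge => lt; rewrite mulrCA -expRD ler_peMr ?u //.
  by rewrite -[leLHS]expR0 ler_expR; lra.
rewrite -expRD (_ : L%:R + _ = - L%:R); last by ring.
have h := @expR_ge1Dx R L%:R.
have L3 : 3 <= L%:R :> R by rewrite ler_nat.
by rewrite expRN lef_pV2 ?posrE ?expR_gt0 //; lra.
Qed.

End GoodLeaves.

(** * The parameters and their logarithms *)

Section Log2.
Context {R : realType}.

Let ln2 : 0 < ln 2 :> R. Proof. by rewrite ln_gt0 // ltr1n. Qed.

Lemma log2_pow n : log2 (2 ^+ n : R) = n%:R.
Proof. by rewrite /log2 lnXn // -[ln 2 *+ n]mulr_natl mulfK // gt_eqF. Qed.

Lemma log2_le (x y : R) : 0 < x -> x <= y -> log2 x <= log2 y.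
Proof.
move=> x0 xy; rewrite /log2 ler_pM2r ?invr_gt0 //.
by rewrite ler_ln ?posrE //; exact: lt_le_trans xy.
Qed.

Lemma log2_between m n (x : R) : 2 ^+ m <= x <= 2 ^+ n -> m%:R <= log2 x <= n%:R.
Proof.
move=> /andP[h1 h2]; have p0 : 0 < 2 ^+ m :> R by rewrite exprn_gt0.
rewrite -(log2_pow m) -(log2_pow n) !log2_le //.
exact: lt_le_trans h1.
Qed.

End Log2.

(** Large enough for the gain of an exit to exceed the losses in
    [gain_constantP], and a power of 2 so that cells have base 8 endpoints.
    Locked, so that it is never computed in unary. *)
Definition ratio : nat := locked (2 ^ 10)%N.
Lemma ratio_eq : ratio = (2 ^ 10)%N. Proof. by rewrite /ratio -lock. Qed.
Lemma ratio_gt1 : (1 < ratio)%N. Proof. by rewrite ratio_eq. Qed.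
Lemma ratio_gt0 : (0 < ratio)%N. Proof. exact: ltnW ratio_gt1. Qed.
(** Half of [ratio ^ L], by [ratio_pow]: at this number of levels a fixed
    proportion of the unit interval is still free. *)
Definition tower_number (L : nat) : nat := (2 ^ (10 * L - 1))%N.
Definition scale_number (L j : nat) : nat := (2 ^ (tower_number L + j))%N.
Definition digit_count (L j : nat) : nat := label_count ratio L (scale_number L) j.+1.

Lemma label_countS g L K j :
  label_count g L K j.+1 = (L * (g * 2 ^ K j * label_count g L K j))%N.
Proof. by []. Qed.

Section Scales.
Variable L : nat.
Hypothesis L_ge2 : (2 <= L)%N.
Let J := tower_number L.
Let K := scale_number L.
Let M := digit_count L.

Lemma ratio_pow : (ratio ^ L = 2 * J)%N.
Proof.
rewrite ratio_eq /J /tower_number -expnM -expnS; congr (2 ^ _)%N.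
by move: L_ge2; lia.
Qed.

Lemma tower_number_gt : (10 * L - 1 < J)%N. Proof. exact: ltn_expl. Qed.

Lemma scale_number_gt j : (J + j < K j)%N. Proof. exact: ltn_expl. Qed.

Lemma scale_numberS j : (K j.+1 = 2 * K j)%N.
Proof. by rewrite /K /scale_number addnS expnS. Qed.

Lemma label_count_bound j :
  (2 ^ K j <= M j)%N /\ (label_count ratio L K j <= 2 ^ (2 * K j))%N.
Proof.
have pos i : (0 < label_count ratio L K i)%N by apply: label_count_gt0; [exact: ratio_gt1|exact: ltnW L_ge2].
have small i : (L * ratio <= 2 ^ K i)%N.
  apply: (@leq_trans (2 ^ (L + 10))).
    by rewrite expnD -ratio_eq leq_mul2r (ltnW (ltn_expl _ _)) // orbT.
  rewrite leq_exp2l //; have := scale_number_gt i; have := tower_number_gt.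
  by move: L_ge2; lia.
split.
  rewrite /M /digit_count label_countS mulnA.
  apply: leq_trans (leq_pmulr _ (pos j)); rewrite mulnA leq_pmull //.
  by rewrite muln_gt0 ratio_gt0 (leq_trans _ L_ge2).
elim: j => [|j IH]; first by rewrite /= expn_gt0.
rewrite label_countS (_ : (2 * K j.+1 = K j + K j + 2 * K j)%N); last by rewrite scale_numberS; lia.
rewrite (expnD 2 (K j + K j)) (expnD 2 (K j) (K j)) !mulnA.
by apply: leq_mul => //; apply: leq_mul.
Qed.

Lemma digit_count_bound j : (2 ^ K j <= M j <= 2 ^ (4 * K j))%N.
Proof.
have [h _] := label_count_bound j; rewrite h /=.
have [_] := label_count_bound j.+1.
by rewrite scale_numberS mulnA.
Qed.

Lemma digit_countS j : (M j < M j.+1)%N.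
Proof.
rewrite /M /digit_count [in X in (_ < X)%N]label_countS.
set m := label_count _ _ _ j.+1.
have m0 : (0 < m)%N by apply: label_count_gt0; [exact: ratio_gt1|exact: ltnW L_ge2].
rewrite mulnA -[X in (X < _)%N]mul1n ltn_pmul2r // mulnA.
have : (1 < L * ratio)%N by rewrite ratio_eq; lia.
have : (0 < 2 ^ scale_number L j.+1)%N by rewrite expn_gt0.
by nia.
Qed.

Section Real.
Context {R : realType}.
Let g : R := ratio%:R.
Let q : R := g ^- L.

Lemma ratioE : g = 2 ^+ 10. Proof. by rewrite /g ratio_eq natrX. Qed.

(** The heights and, up to constants, the measures of the superlevel sets of
    the extremal function: [level_height L j] is the value at level [j], and
    [upper_width], [lower_width] enclose the measure of the set where the
    function is at least that value. *)
Definition level_height (j : nat) : R := 8 ^+ M j / (K j)%:R.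
Definition upper_width (j : nat) : R := 8 ^- M j * q / 4.
Definition lower_width (j : nat) : R := 8 ^- M j * q / 32.

Lemma pow8 n : 8 ^+ n = 2 ^+ (3 * n) :> R.
Proof. by rewrite exprM; congr (_ ^+ n); rewrite !exprS expr0; lra. Qed.

(** Both [8 ^ M j] and the remaining factors of [b / s], which are of
    order [ratio ^ L], are absorbed in a power of [2 ^ M j]. *)
Lemma dilation_bound b s j : 4 <= b <= 17 -> lower_width j <= s <= upper_width j ->
  2 ^+ M j <= b / s <= 2 ^+ (20 * M j).
Proof.
move=> /andP[b4 b17] /andP[s1 s2].
have q0 : 0 < q by rewrite /q ratioE invr_gt0 !exprn_gt0.
have e0 : 0 < 8 ^- M j :> R by rewrite invr_gt0 exprn_gt0.
have l0 : 0 < lower_width j by rewrite !mulr_gt0.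
have s0 : 0 < s by exact: lt_le_trans s1.
have qE : q = 2 ^- (10 * L) by rewrite /q ratioE exprM.
have q1 : q <= 1.
  by rewrite qE invf_le1 ?exprn_gt0 // exprn_ege1 // ler1n.
apply/andP; split.
  rewrite ler_pdivlMr //; apply: (@le_trans _ _ 4) => //.
  apply: (@le_trans _ _ (2 ^+ M j * upper_width j)).
    by rewrite ler_pM2l // exprn_gt0.
  rewrite /upper_width mulrA mulrA.
  have : 2 ^+ M j * 8 ^- M j <= 1 :> R.
    rewrite pow8 ler_pdivrMr ?exprn_gt0 // mul1r ler_weXn2l ?ler1n //.
    by rewrite leq_pmull.
  have : 0 <= 2 ^+ M j * 8 ^- M j :> R by rewrite mulr_ge0 ?exprn_ge0 // ltW.
  by nra.
rewrite ler_pdivrMr //; apply: (@le_trans _ _ (2 ^+ 5)).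
  by rewrite !exprS expr0; lra.
apply: (@le_trans _ _ (2 ^+ (20 * M j) * lower_width j)); last by rewrite ler_pM2l // exprn_gt0.
have big : (10 + 10 * L + 3 * M j <= 20 * M j)%N.
  have /andP[h _] := digit_count_bound j.
  have := ltn_expl (K j) (isT : (1 < 2)%N); have := scale_number_gt j.
  have := tower_number_gt; lia.
rewrite (_ : lower_width j = 2 ^- (5 + 10 * L + 3 * M j)); last first.
  rewrite /lower_width qE pow8 (exprD _ (5 + 10 * L)) (exprD _ 5).
  rewrite (_ : 2 ^+ 5 = 32 :> R); last by rewrite !exprS expr0; lra.
  by move: (2 ^+ _) (2 ^+ _) => A B; rewrite -!invfM; congr (_^-1); ring.
by rewrite ler_pdivlMr ?exprn_gt0 // -exprD ler_weXn2l ?ler1n //.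
Qed.

(** [log2 (b / s)] is of order [M j], which lies between [2 ^ K j] and
    [2 ^ (4 * K j)]. *)
Lemma loglog_bound b s j : 4 <= b <= 17 -> lower_width j <= s <= upper_width j ->
  (K j)%:R <= log2 (log2 (b / s)) <= 5 * (K j)%:R.
Proof.
move=> hb hs; have /andP[h1 h2] := log2_between (dilation_bound hb hs).
have /andP[m1 m2] := digit_count_bound j.
have K5 : (5 <= K j)%N.
  by have := scale_number_gt j; have := tower_number_gt; lia.
rewrite -natrM (_ : 5 * K j = 4 * K j + K j)%N; last lia.
apply: log2_between; apply/andP; split.
  by apply: le_trans h1; rewrite -natrX ler_nat.
apply: le_trans h2 _; rewrite -natrX ler_nat expnD [leqRHS]mulnC.
apply: leq_mul => //; apply: (@leq_trans (2 ^ 5)) => //.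
by rewrite leq_exp2l.
Qed.

(** The next logarithm of [K j = 2 ^ (J + j)] lies between [J] and
    [2 * J + 3], and [J = 2 ^ (10 * L - 1)]. *)
Lemma loglogloglog_bound s j : (j < J)%N -> lower_width j <= s <= upper_width j ->
  L%:R <= log2 (log2 (log2 (log2 (17 / s)))) <= 11 * L%:R.
Proof.
move=> jJ hs; have b17 : 4 <= (17 : R) <= 17 by rewrite lexx andbT ler_nat.
have /andP[h1 h2] := loglog_bound b17 hs.
have : 2 ^+ (J + j) <= log2 (log2 (17 / s)) <= 2 ^+ (J + j + 3).
  have KE : (K j)%:R = 2 ^+ (J + j) :> R by rewrite -natrX.
  rewrite -KE h1 /= (le_trans h2) // exprD -KE mulrC ler_pM2l.
    by rewrite !exprS expr0; lra.
  by rewrite KE exprn_gt0.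
move=> /log2_between/andP[h3 h4].
have : 2 ^+ (10 * L - 1) <= log2 (log2 (log2 (17 / s))) <= 2 ^+ (10 * L + 1).
  have JE : J%:R = 2 ^+ (10 * L - 1) :> R by rewrite -natrX.
  apply/andP; split.
    by rewrite -JE; apply: le_trans h3; rewrite ler_nat leq_addr.
  apply: le_trans h4 _; rewrite -natrX ler_nat.
  rewrite (_ : 10 * L + 1 = (10 * L - 1) + 2)%N; last by move: L_ge2; lia.
  rewrite expnD -/(tower_number L) -/J.
  by have := tower_number_gt; move: L_ge2; lia.
move=> /log2_between/andP[h5 h6]; apply/andP; split.
  by apply: le_trans h5; rewrite ler_nat; lia.
by apply: le_trans h6 _; rewrite -natrM ler_nat; move: L_ge2; lia.
Qed.

End Real.
End Scales.

(** * The blocks of the extremal function *)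

Lemma count_le1 (T : eqType) (P : pred T) (s : seq T) : uniq s ->
  {in s &, forall x y, P x -> P y -> x = y} -> (count P s <= 1)%N.
Proof.
move=> us h; rewrite -size_filter.
have : uniq (seq.filter P s) by exact: filter_uniq.
have : {in seq.filter P s &, forall x y, x = y}.
  move=> x y; rewrite !mem_filter => /andP[px xs] /andP[py ys]; exact: h.
case: (seq.filter P s) => [|x [|y s']] //= hxy /andP[].
by rewrite (hxy x y) ?inE ?eqxx ?orbT.
Qed.

Section Construction.
Context {R : realType}.
Variable L : nat.
Hypothesis L_ge3 : (3 <= L)%N.
Let L_ge2 : (2 <= L)%N := ltnW L_ge3.
Let L_gt0 : (0 < L)%N := ltnW L_ge2.
Let J := tower_number L.
Let K := scale_number L.

(** Makes the harmonic sum over [2 ^ K_j] windows, which is about [K_j],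
    contribute a constant at each level. *)
Definition level_density (j : nat) : R := (scale_number L j)%:R^-1.
(** Every leaf of the tree has endpoints in the multiples of
    [8 ^- base_exponent]. *)
Definition base_exponent : nat := (J * (L * (10 + K J)))%N.
(** Up to a constant, twice the exponent of the length of the smallest cells,
    because the error of [inactive_sum] involves the inverse square of the
    distance. *)
Definition frequency_shift : nat := (2 * base_exponent + 12)%N.

Definition mass_leaves : seq (mleaf R) := mleaves ratio L K J.
Definition free_leaves : seq (fleaf R) := fleaves ratio L K J.

Let D := level_density.
Let c0 := base_exponent.
Let c := frequency_shift.

Definition leaf_blocks (l : mleaf R) : seq block :=
  [seq (leaf_height D l, leaf_bar c l q, leaf_bar c l q + leaf_width c l)
  | q <- index_iota (leaf_start c l) (leaf_start c l + leaf_count c l)].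

Definition all_blocks : seq (@block R) := flatten [seq leaf_blocks l | l <- mass_leaves].

Let D_ge0 j : 0 <= D j. Proof. by rewrite invr_ge0. Qed.
Let c0c : (c0 < c)%N. Proof. by rewrite /c /frequency_shift -/c0; lia. Qed.
Let J_gt0 : (0 < J)%N. Proof. by rewrite expn_gt0. Qed.

Let ratio_dvd i : (i < J)%N -> (ratio * 2 ^ K i %| 8 ^ (10 + K J))%N.
Proof.
move=> iJ; rewrite ratio_eq -expnD (_ : 8 = 2 ^ 3)%N // -expnM dvdn_exp2l //.
have : (K i <= K J)%N by rewrite leq_exp2l // leq_add2l ltnW.
by lia.
Qed.

Lemma mass_leaves_aligned : {in mass_leaves, forall l, maligned c0 l}.
Proof. by have [h _] := @leaves_aligned R _ L _ ratio_gt1 _ _ ratio_dvd. Qed.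

Lemma free_leaves_aligned : {in free_leaves, forall l, faligned c0 l}.
Proof. by have [_ h] := @leaves_aligned R _ L _ ratio_gt1 _ _ ratio_dvd. Qed.

Lemma mass_leaves_unit : {in mass_leaves, forall l, in_unit (mpos l) (mlen l)}.
Proof. exact: (mleaves_unit ratio_gt1). Qed.

Lemma free_leaves_unit : {in free_leaves, forall l, in_unit (fpos l) (flen l)}.
Proof. exact: (fleaves_unit ratio_gt1). Qed.

Lemma mass_leaves_label : {in mass_leaves, forall l,
  (mlev l < J)%N /\ leaf_height D l = level_height L (mlev l)}.
Proof.
move=> l /(mleaves_label ratio_gt1)[h1 h2]; split=> //.
by rewrite /leaf_height h2 mulrC.
Qed.

Lemma all_blocksP w : w \in all_blocks -> exists l q,
  [/\ l \in mass_leaves, (leaf_start c l <= q < leaf_start c l + leaf_count c l)%N &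
    w = (leaf_height D l, leaf_bar c l q, leaf_bar c l q + leaf_width c l)].
Proof.
move=> /flattenP[s /mapP[l hl ->] /mapP[q]]; rewrite mem_index_iota => hq ->.
by exists l, q.
Qed.

Lemma all_blocks_ok : {in all_blocks, forall w, block_ok w /\ 0 <= bheight w}.
Proof.
move=> w /all_blocksP[l [q [hl hq ->]]]; split; last exact: leaf_height_ge0.
have [h1 h2] := leaf_bar_inside c0c (mass_leaves_aligned hl) hq.
have /and3P[p0 l0 pl] := mass_leaves_unit hl.
have w0 := leaf_width_gt0 c l; rewrite /block_ok /bleft /bright /=.
by apply/andP; split; [apply/andP; split|]; lra.
Qed.

Lemma all_blocks_height : {in all_blocks, forall w,
  exists2 j, (j < J)%N & bheight w = level_height L j}.
Proof.
move=> w /all_blocksP[l [q [hl hq ->]]]; have [h1 h2] := mass_leaves_label hl.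
by exists (mlev l).
Qed.

Lemma leaf_blocks_count l y : l \in mass_leaves ->
  (count (in_block^~ y) (leaf_blocks l) <= inI (8 * y) (mpos l) (mlen l))%N.
Proof.
move=> hl; have ha := mass_leaves_aligned hl; rewrite count_map.
case: (boolP (inI _ _ _)) => hin; last first.
  rewrite leqn0 -leqn0 leqNgt -has_count; apply/hasPn => q; rewrite mem_index_iota.
  move=> hq /=; apply: contra hin => /andP[/= y1 y2].
  have [h1 h2] := leaf_bar_inside c0c ha hq.
  rewrite /bleft /bright /= in y1 y2.
  by apply/andP; split; lra.
apply: count_le1 => [|q q' _ _ /andP[/= a1 a2] /andP[/= b1 b2]]; first exact: iota_uniq.
rewrite /bleft /bright /= in a1 a2 b1 b2.
have sep i k : (i < k)%N -> leaf_bar c l i + leaf_width c l <= leaf_bar c l k.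
  move=> ik; have [_ h1] := @bar_block R (c + moff l) (mdig l) i.
  have [h2 _] := @bar_block R (c + moff l) (mdig l) k.
  apply: le_trans h1 _; apply: le_trans h2.
  by rewrite ler_pM2r ?ler_nat // invr_gt0 exprn_gt0.
have [lt|gt|//] := ltngtP q q'.
  by exfalso; have := sep _ _ lt; lra.
by exfalso; have := sep _ _ gt; lra.
Qed.

Lemma all_blocks_disjoint : blocks_disjoint all_blocks.
Proof.
move=> y; rewrite count_flatten -map_comp sumnE big_map.
apply: (@leq_trans (\sum_(l <- mass_leaves) inI (8 * y) (mpos l) (mlen l))).
  by rewrite big_seq [leqRHS]big_seq; apply: leq_sum => l; exact: leaf_blocks_count.
have := @leaves_partition R ratio L K ratio_gt1 J (8 * y).
rewrite -/mass_leaves -natr_sum => h.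
rewrite -(ler_nat R); apply: (@le_trans _ _ (inI (8 * y) 0 1)%:R); last by case: inI.
by rewrite -h lerDl; apply: sumr_ge0.
Qed.

(** A leaf of level [i] fills the proportion [8 ^- digit_count L i] of its
    length. *)
Lemma leaf_blocks_width (P : pred R) :
  \sum_(w <- all_blocks | P (bheight w)) bwidth w =
  \sum_(0 <= i < J | P (level_height L i)) 8 ^- digit_count L i / 8 *
    (ratio%:R ^- L * (1 - ratio%:R ^- L) ^+ (J - i.+1)).
Proof.
transitivity (\sum_(l <- mass_leaves)
    if P (level_height L (mlev l)) then 8 ^- digit_count L (mlev l) / 8 * mlen l else 0).
  rewrite big_flatten big_map big_seq [RHS]big_seq; apply: eq_bigr => l hl.
  rewrite big_map /bheight /=; have [h1 h2] := mass_leaves_label hl; rewrite h2.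
  case: ifP => _; last by rewrite big_pred0_eq.
  rewrite /bwidth /bleft /bright /=.
  under eq_bigr do rewrite addrC addKr.
  rewrite sumr_const_nat addKn -[LHS]mulr_natl.
  have [_ hlen] := mass_leaves_aligned hl.
  rewrite (leaf_count_eq c0c hlen) /leaf_width /bar_length.
  have [_ ->] := mleaves_label ratio_gt1 hl.
  have e0 n : 8 ^+ n != 0 :> R by rewrite expf_neq0.
  rewrite -/(digit_count L (mlev l)) (exprD _ (c + moff l)).
  by field; rewrite !e0.
transitivity (\sum_(0 <= i < J) \sum_(l <- mass_leaves | mlev l == i)
    if P (level_height L i) then 8 ^- digit_count L i / 8 * mlen l else 0).
  under [RHS]eq_bigr do rewrite big_mkcond /=.
  rewrite exchange_big /= big_seq [RHS]big_seq; apply: eq_bigr => l hl.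
  have [h _] := mass_leaves_label hl.
  rewrite (bigD1_seq (mlev l)) ?mem_index_iota ?iota_uniq //= eqxx big1 ?addr0 //.
  by move=> i /negbTE; rewrite eq_sym => ->.
rewrite [RHS]big_mkcond !big_nat; apply: eq_bigr => i /andP[_ iJ].
case: ifP => _; last by rewrite big1.
by rewrite -mulr_sumr mleaves_length // ratio_gt1.
Qed.

Let q : R := ratio%:R ^- L.
Let q_gt0 : 0 < q. Proof. by rewrite invr_gt0 exprn_gt0 // ltr0n ratio_gt0. Qed.
Let qJ : J%:R * q = 2^-1.
Proof.
rewrite /q -natrX ratio_pow // natrM invfM mulrCA mulfV ?mulr1 //.
by rewrite pnatr_eq0 -lt0n.
Qed.

Lemma level_length_bounds i : (i < J)%N ->
  q / 2 <= q * (1 - q) ^+ (J - i.+1) <= q.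
Proof.
move=> iJ; have J1 : 1 <= J%:R :> R by rewrite ler1n.
have q1 : q <= 2^-1 by rewrite -qJ; apply: ler_peMl => //; exact: ltW.
have q01 : 0 <= 1 - q <= 1 by move: (q_gt0) => ?; apply/andP; split; lra.
apply/andP; split.
  rewrite ler_pM2l //; apply: (@le_trans _ _ ((1 - q) ^+ J)).
    apply: le_trans (bernoulli J _); first by rewrite qJ; lra.
    by rewrite ltW //=; lra.
  by apply: ler_wiXn2l; rewrite ?leq_subr //; case/andP: q01.
apply: ler_piMr; first exact: ltW.
by apply: exprn_ile1; case/andP: q01.
Qed.

Lemma digit_count_geometric j n :
  \sum_(j <= i < j + n) 8 ^- digit_count L i <= 2 * 8 ^- digit_count L j :> R.
Proof.
elim: n j => [|n IH] j.
  by rewrite addn0 big_geq // mulr_ge0 // invr_ge0 exprn_ge0.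
rewrite big_ltn; last by rewrite addnS ltnS leq_addr.
have := IH j.+1; rewrite addSnnS.
have : 8 ^- digit_count L j.+1 <= 8 ^- digit_count L j / 8 :> R.
  rewrite -invfM -exprSr lef_pV2 ?posrE ?exprn_gt0 // ler_weXn2l ?ler1n //.
  exact: digit_countS.
have : 0 < 8 ^- digit_count L j :> R by rewrite invr_gt0 exprn_gt0.
lra.
Qed.

Lemma level_height_double j : 2 * level_height L j <= level_height L j.+1 :> R.
Proof.
have k0 : 0 < (K j)%:R :> R by rewrite ltr0n expn_gt0.
rewrite /level_height scale_numberS natrM invfM.
have : 8 ^+ digit_count L j * 8 <= 8 ^+ digit_count L j.+1 :> R.
  by rewrite -exprSr ler_weXn2l ?ler1n // digit_countS.
have : 0 < (K j)%:R^-1 :> R by rewrite invr_gt0.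
set a := 8 ^+ _; set b := 8 ^+ _; set k := _^-1 => k1 ab.
have a0 : 0 < a by rewrite exprn_gt0.
by nra.
Qed.

Lemma level_height_ge0 j : 0 <= level_height L j :> R.
Proof. by rewrite divr_ge0 // exprn_ge0. Qed.

Lemma level_height_lt i j : (i < j)%N -> level_height L i < level_height L j :> R.
Proof.
have pos k : 0 < level_height L k :> R.
  by rewrite divr_gt0 ?exprn_gt0 // ltr0n expn_gt0.
elim: j => // j IH; rewrite ltnS leq_eqVlt => /orP[/eqP->|/IH h].
  by have := level_height_double j; have := pos j; lra.
by have := level_height_double j; have := pos j; lra.
Qed.

(** The measures decrease geometrically from one level to the next. *)
Lemma superlevel_width_le j : (j < J)%N ->
  \sum_(w <- all_blocks | level_height L j <= bheight w) bwidth w <= upper_width L j.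
Proof.
move=> jJ; rewrite (leaf_blocks_width (fun v => level_height L j <= v)).
have e0 i : 0 < 8 ^- digit_count L i :> R by rewrite invr_gt0 exprn_gt0.
rewrite big_mkcond (big_cat_nat (n := j)) ?(ltnW jJ) //=.
rewrite big_nat big1 ?add0r; last first.
  by move=> i /andP[_ ij]; rewrite leNgt level_height_lt.
apply: (@le_trans _ _ (\sum_(j <= i < j + (J - j)) 8 ^- digit_count L i / 8 * q)).
  rewrite subnKC ?(ltnW jJ) // !big_nat; apply: ler_sum => i /andP[_ iJ].
  have /andP[_ h] := level_length_bounds iJ.
  have p0 : 0 < 8 ^- digit_count L i / 8 :> R by rewrite divr_gt0.
  by case: ifP => _; [rewrite ler_pM2l|rewrite mulr_ge0 ?ltW].
rewrite -!mulr_suml /upper_width -/q.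
have h := digit_count_geometric j (J - j); have := q_gt0; have := e0 j.
by nra.
Qed.

Lemma superlevel_width_gt j : (j < J)%N ->
  lower_width L j < \sum_(w <- all_blocks | level_height L j <= bheight w) bwidth w.
Proof.
move=> jJ; rewrite (leaf_blocks_width (fun v => level_height L j <= v)).
have e0 i : 0 < 8 ^- digit_count L i :> R by rewrite invr_gt0 exprn_gt0.
have t0 i : 0 <= 8 ^- digit_count L i / 8 * (q * (1 - q) ^+ (J - i.+1)).
  have J1 : 1 <= J%:R :> R by rewrite ler1n.
  have q1 : q <= 2^-1 by rewrite -qJ; apply: ler_peMl => //; exact: ltW.
  apply: mulr_ge0; first by apply: divr_ge0 => //; exact: ltW.
  by apply: mulr_ge0; [exact: ltW|apply: exprn_ge0; lra].
rewrite big_mkcond (bigD1_seq j) ?mem_index_iota ?iota_uniq //= lexx.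
have [/andP[h _] e] := (level_length_bounds jJ, e0 j).
rewrite ltr_wpDr //; first by apply: sumr_ge0 => i _; case: ifP.
rewrite /lower_width -/q; have := q_gt0.
move: h e; set a := 8 ^- _; set b := q * (1 - q) ^+ _ => h e qq.
have : a / 8 * (q / 2) <= a / 8 * b by rewrite ler_pM2l // divr_gt0.
have : 0 < a * q by rewrite mulr_gt0.
lra.
Qed.

End Construction.

(** * The operator on the extremal function *)

Section Extremizer.
Context {R : realType}.
Variable L : nat.
Hypothesis L_ge3 : (3 <= L)%N.
Let L_ge2 : (2 <= L)%N := ltnW L_ge3.
Let L_gt0 : (0 < L)%N := ltnW L_ge2.
Let J := tower_number L.
Let K := scale_number L.
Let D := @level_density R L.
Let c0 := base_exponent L.
Let c := frequency_shift L.
Let ml := @mass_leaves R L.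
Let fl := @free_leaves R L.

Definition extremizer : R -> R := step_fun (@all_blocks R L).
Definition gain_constant : R := (64 * ratio%:R)^-1.

Let D_ge0 j : 0 <= D j. Proof. by rewrite invr_ge0. Qed.
Let c0c : (c0 < c)%N. Proof. by rewrite /c /frequency_shift -/c0; lia. Qed.
Let J_gt0 : (0 < J)%N. Proof. by rewrite expn_gt0. Qed.
Let r : R := ratio%:R.
Let rE : r = 2 ^+ 10. Proof. by rewrite /r ratio_eq natrX. Qed.
Let r_ge : 600 <= r. Proof. by rewrite rE !exprS expr0; lra. Qed.
Let r_gt0 : 0 < r. Proof. by have := r_ge; lra. Qed.
Let r1E : (ratio.-1)%:R = r - 1. Proof. by rewrite -subn1 natrB ?ratio_gt0. Qed.
Let K_gt0 j : 0 < (K j)%:R :> R. Proof. by rewrite ltr0n expn_gt0. Qed.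
Let K_ge1 j : 1 <= (K j)%:R :> R. Proof. by rewrite ler1n expn_gt0. Qed.

(** [scale_number L i] exceeds the number of levels. *)
Lemma density_sum : \sum_(0 <= i < J) D i <= 1.
Proof.
apply: (@le_trans _ _ (\sum_(0 <= i < J) J%:R^-1)).
  rewrite !big_nat; apply: ler_sum => i _.
  rewrite lef_pV2 ?posrE ?ltr0n // ?expn_gt0 // ler_nat ltnW //.
  by apply: leq_ltn_trans (scale_number_gt L i); exact: leq_addr.
by rewrite sumr_const_nat subn0 -[leLHS]mulr_natl mulfV // pnatr_eq0 -lt0n.
Qed.

Lemma density_large j : 2 / (ratio * 2 ^ K j)%:R <= D j.
Proof.
have h : (K j)%:R <= (2 ^ K j)%:R :> R by rewrite ler_nat ltnW // ltn_expl.
rewrite natrM -/r /D /level_density -/K.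
move: (2 ^ K j)%:R (K j)%:R (K_gt0 j) h => X k k0 kX.
have X0 : 0 < X by exact: lt_le_trans kX.
rewrite ler_pdivrMr; last exact: mulr_gt0.
rewrite mulrC ler_pdivlMr //; move: r r_ge => y y600.
by nra.
Qed.

(** The first term is [1 / (32 ratio)]; the second is at most
    [8 / (ratio - 1) ^ 2], hence at most half of it. *)
Lemma gain_constantP j :
  gain_constant <= 16^-1 * D j * ((K j)%:R / 2 / ratio%:R) -
     1 * (2 * D j) / (ratio.-1)%:R * (2 * (K j).+1%:R) / (ratio.-1)%:R.
Proof.
rewrite r1E /gain_constant /D /level_density -/K -[(K j).+1%:R]natr1 -/r.
have k1 := K_ge1 j; move: (K j)%:R k1 (K_gt0 j) => k k1 k0.
have ki : k^-1 <= 1 by rewrite invf_le1.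
move: r r_ge r_gt0 => y y600 y0; have y1 : 0 < y - 1 by lra.
have yy : 0 < (y - 1) * (y - 1) by rewrite mulr_gt0.
rewrite [X in X - _](_ : _ = 2 * (64 * y)^-1); last first.
  by field; rewrite !gt_eqF.
rewrite (_ : 1 * (2 * k^-1) / (y - 1) * (2 * (k + 1)) / (y - 1) =
    4 * (1 + k^-1) / ((y - 1) * (y - 1))); last first.
  by field; rewrite !gt_eqF.
suff : 4 * (1 + k^-1) / ((y - 1) * (y - 1)) <= (64 * y)^-1 by lra.
apply: (@le_trans _ _ (8 / ((y - 1) * (y - 1)))).
  by rewrite ler_pM2r ?invr_gt0 //; lra.
rewrite ler_pdivrMr // mulrC ler_pdivlMr; last by lra.
by nra.
Qed.

(** The leaves partition the unit interval. *)
Lemma leaves_apart l f : l \in ml -> f \in fl ->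
  (mpos l + mlen l <= fpos f) || (fpos f + flen f <= mpos l).
Proof.
move=> hl hf; have /and3P[p0 l0 pl] := mass_leaves_unit hl.
have /and3P[p0' l0' pl'] := free_leaves_unit hf.
rewrite leNgt [X in _ || X]leNgt -negb_and; apply/negP => /andP[h1 h2].
pose p := Num.max (mpos l) (fpos f).
have pl1 : inI p (mpos l) (mlen l).
  by rewrite /inI /p le_max lexx gt_max /= h1 andbT ltrDl.
have pf1 : inI p (fpos f) (flen f).
  by rewrite /inI /p le_max lexx orbT gt_max /= h2 /= ltrDl.
have := @leaves_partition R ratio L K ratio_gt1 J p.
rewrite -/(mass_leaves L) -/(free_leaves L).
rewrite (big_rem l) //= pl1 (big_rem f) //= pf1 /=.
set A := \sum_(_ <- _) _; set B := \sum_(_ <- _) _ => E.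
have A0 : 0 <= A by apply: sumr_ge0.
have B0 : 0 <= B by apply: sumr_ge0.
have : (inI p 0 1)%:R <= 1 :> R by case: inI.
by lra.
Qed.

Lemma free_leaf_length f : f \in fl -> 8 ^- c0 <= flen f.
Proof.
move=> hf; have [_ [n hn]] := free_leaves_aligned L_ge3 hf.
have /and3P[_ l0 _] := free_leaves_unit hf.
have e0 : 0 < 8 ^+ c0 :> R by rewrite exprn_gt0.
rewrite -[leLHS]mul1r ler_pdivrMr // hn ler1n lt0n.
apply/eqP => n0; move: hn; rewrite n0 => /eqP; rewrite mulf_eq0.
by rewrite (gt_eqF l0) (gt_eqF e0).
Qed.

Lemma kernel_sum_blocks n x :
  \sum_(w <- all_blocks L) bheight w * kernel_integral n x (bleft w) (bright w) =
  \sum_(l <- ml) leaf_height D l * leaf_kernel c n x l.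
Proof.
rewrite big_flatten big_map; apply: eq_bigr => l _.
by rewrite big_map mulr_sumr.
Qed.

(** Away from the ends of the free leaf by a quarter of its length, and so at
    a distance from all the mass that is known in advance. *)
Definition middle (f : fleaf R) (t : R) : bool :=
  fpos f + flen f / 4 <= t < fpos f + 3 / 4 * flen f.

Lemma frequency_ratio : 8 ^- c / (8 ^- (c0 + 3)) ^+ 2 = 8 ^- 6 :> R.
Proof.
rewrite exprVn invrK -exprM [c](_ : _ = (c0 + 3) * 2 + 6)%N.
  by rewrite exprD invfM mulrAC mulVf ?mul1r // expf_neq0.
by rewrite /c /frequency_shift -/c0 mulnDl (mulnC c0) -addnA.
Qed.

Lemma gain_constantE : gain_constant = 4 * 8 ^- 6.
Proof.
have e8 : 8 = 2 ^+ 3 :> R by rewrite !exprS expr0; lra.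
have e64 : 64 = 2 ^+ 6 :> R by rewrite !exprS expr0; lra.
have e4 : 4 = 2 ^+ 2 :> R by rewrite !exprS expr0; lra.
rewrite /gain_constant -/r rE e64 e8 e4 -exprM -exprD.
apply: (@mulIf _ (2 ^+ 18)); first by rewrite expf_neq0.
by rewrite mulfVK ?expf_neq0 // [2 ^+ 18](exprD 2 (6 + 10) 2) mulKf ?expf_neq0.
Qed.

(** The main term is at least [gain_constant * L], by [leaves_gain]; the
    oscillation error is at most [8 ^- 6], that is [gain_constant / 4]. *)
Lemma modulated_hilbert_ge f t : f \in fl -> L%:R <= fgain f -> middle f t ->
  gain_constant * L%:R / 2 <=
  Normc.normc (modulated_hilbert (8 ^ (c + fidx f)) extremizer (t / 8)).
Proof.
move=> hf hL /andP[t1 t2]; have /and3P[p0 l0 pl] := free_leaves_unit hf.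
have len := free_leaf_length hf.
(* A quarter of the smallest cell has length [8 ^- c0 / 4], at least [8 * dl]. *)
pose dl : R := 8 ^- (c0 + 3).
have dl0 : 0 < dl by rewrite invr_gt0 exprn_gt0.
have e0 : 0 < 8 ^- c0 :> R by rewrite invr_gt0 exprn_gt0.
have dlE : dl = 8 ^- c0 / 512.
  by rewrite /dl exprD invfM; congr (_ * _); congr (_^-1); rewrite !exprS expr0; lra.
have t01 : 0 < t < 1 by apply/andP; split; lra.
have apart l : l \in ml -> (mpos l + mlen l + 8 * dl <= t) || (t + 8 * dl <= mpos l).
  move=> hl; rewrite dlE; case/orP: (leaves_apart hl hf) => h; apply/orP.
    by left; lra.
  by right; lra.
apply: le_trans (@hilbert_step _ _ (t / 8) dl _ dl0 _ _); last 2 first.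
- by case/andP: t01 => *; apply/andP; split; lra.
- move=> w hw; split; first by case: (all_blocks_ok L_ge3 hw).
  have [l [q [hl hq ->]]] := all_blocksP hw.
  exact: (leaf_bar_away c0c (mass_leaves_unit hl) (mass_leaves_aligned L_ge3 hl)
    t01 (apart l hl) hq).
rewrite kernel_sum_blocks; apply: le_trans (ler_norm _).
have fx : fpos f < t < fpos f + flen f by apply/andP; split; lra.
have gc0 : 0 <= gain_constant by rewrite invr_ge0 mulr_ge0.
have c10 : 0 <= 16^-1 :> R by rewrite invr_ge0.
have key := leaves_gain ratio_gt1 L_gt0 c10 ler01 gc0 D_ge0 density_sum
  (fun j _ => density_large j) (fun j _ => gain_constantP j) (leqnn J) hf fx.
have mass1 := mleaves_mass K ratio_gt1 L_gt0 D_ge0 density_sum (leqnn J).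
apply: (@le_trans _ _ (\sum_(l <- ml)
   (contribution 16^-1 1 D l t (fidx f) - mass D l * (8 ^- c / dl ^+ 2)))); last first.
  rewrite big_seq [leRHS]big_seq; apply: ler_sum => l hl.
  exact: leaf_estimate (mass_leaves_unit hl) (mass_leaves_aligned L_ge3 hl) t01 dl0 (apart l hl).
rewrite sumrB -mulr_suml frequency_ratio.
have gL : (ratio%:R : R) ^- L <= 1.
  by rewrite invf_le1 ?exprn_gt0 ?exprn_ege1 ?ltr0n ?ler1n ?ratio_gt0.
have k0 : 0 < 8 ^- 6 :> R by rewrite invr_gt0 exprn_gt0.
have L3 : 3 <= L%:R :> R by rewrite ler_nat.
have key2 : gain_constant * L%:R <= gain_constant * fgain f by exact: ler_wpM2l.
have m1 : (\sum_(l <- ml) mass D l) * 8 ^- 6 <= 8 ^- 6.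
  by rewrite ler_piMl ?(ltW k0) //; exact: le_trans mass1 gL.
apply: le_trans (lerB (le_trans key2 key) m1).
have L3' : 8 ^- 6 * 3 <= 8 ^- 6 * L%:R :> R by rewrite ler_pM2l.
rewrite gain_constantE; move: L3' k0.
by move: (8 ^- 6) (L%:R : R) => a b *; lra.
Qed.

End Extremizer.

(** * The norms of the extremal function *)

Section ExtremizerNorms.
Context {R : realType}.
Variable L : nat.
Hypothesis L_ge3 : (3 <= L)%N.
Let L_ge2 : (2 <= L)%N := ltnW L_ge3.
Let J := tower_number L.
Let K := scale_number L.
Let J_gt0 : (0 < J)%N. Proof. by rewrite expn_gt0. Qed.
Let ratio_pos : 0 < ratio%:R :> R. Proof. by rewrite ltr0n ratio_gt0. Qed.

Definition good_leaves : seq (fleaf R) :=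
  [seq f <- free_leaves L | L%:R <= fgain f].

Definition middle_block (f : fleaf R) : block :=
  (1, (fpos f + flen f / 4) / 8, (fpos f + 3 / 4 * flen f) / 8).

Definition middle_blocks := [seq middle_block f | f <- good_leaves].

Lemma in_middle_block f y : in_block (middle_block f) y = middle f (8 * y).
Proof.
by rewrite /in_block /middle_block /bleft /bright /middle /= ler_pdivrMr // ltr_pdivlMr // [y * 8]mulrC.
Qed.

Lemma middle_blocks_ok : {in middle_blocks, forall w, block_ok w}.
Proof.
move=> w /mapP[f]; rewrite mem_filter => /andP[_ hf] ->.
have /and3P[p0 l0 pl] := free_leaves_unit hf.
rewrite /block_ok /bleft /bright /=.
by apply/andP; split; [apply/andP; split|]; lra.
Qed.

Lemma middle_blocks_disjoint : blocks_disjoint middle_blocks.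
Proof.
move=> y; rewrite count_map count_filter.
apply: (@leq_trans (\sum_(f <- free_leaves L) inI (8 * y) (fpos f) (flen f))).
  rewrite -sumn_count sumnE big_map big_seq [leqRHS]big_seq.
  apply: leq_sum => f hf; rewrite /= in_middle_block.
  have /and3P[p0 l0 pl] := free_leaves_unit hf.
  case: (boolP (inI _ _ _)) => [_|hin]; first by case: (_ && _).
  case: (boolP (middle f (8 * y))) => //= /andP[h1 h2].
  by case/negP: hin; apply/andP; split; lra.
have := @leaves_partition R ratio L K ratio_gt1 J (8 * y).
rewrite -/(free_leaves L) -[X in _ + X]natr_sum => h.
rewrite -(ler_nat R); apply: (@le_trans _ _ (inI (8 * y) 0 1)%:R); last by case: inI.
by rewrite -h lerDr; apply: sumr_ge0.
Qed.

Lemma middle_blocks_width : 64^-1 <= \sum_(w <- middle_blocks) bwidth w.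
Proof.
have g16 : (16 <= ratio)%N by rewrite ratio_eq.
have h := @good_length R ratio L J K g16 L_ge3 (ratio_pow L_ge2).
rewrite big_map big_filter.
rewrite (eq_bigr (fun f => flen f * 16^-1)).
  rewrite -mulr_suml; move: h; rewrite -/(free_leaves L).
  by move: (\sum_(_ <- _ | _) _) => x; lra.
by move=> f _; rewrite /bwidth /bleft /bright /=; lra.
Qed.

(** The middle halves of the free leaves with gain at least [L] have total
    length at least [1/8] in the unit interval, thus [1/64] in the circle. *)
Lemma weak_L1_ge : ((gain_constant * L%:R / 256)%:E <=
  weak_L1 (carleson_lac (fun j => 8 ^ j)%N (@extremizer R L)))%E.
Proof.
have L0 : 0 < L%:R :> R by rewrite ltr0n (leq_trans _ L_ge2).
have g0 : 0 < gain_constant :> R by rewrite invr_gt0 mulr_gt0.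
have gL0 : 0 < gain_constant * L%:R :> R by rewrite mulr_gt0.
pose l : R := gain_constant * L%:R / 4.
have l0 : 0 < l by rewrite divr_gt0.
apply: (@le_trans _ _ (l%:E * torus_measure
    [set x | l%:E < `|carleson_lac (fun j => 8 ^ j)%N (@extremizer R L) x|])%E); last first.
  by apply: ereal_sup_ubound; exists l.
apply: (@le_trans _ _ (l%:E * lebesgue_measure (blocks_set middle_blocks))%E).
  rewrite (measure_blocks_set middle_blocks_disjoint middle_blocks_ok).
  rewrite -EFinM lee_fin; have := middle_blocks_width; rewrite /l.
  by move: (\sum_(_ <- _) _) => x; nra.
apply: lee_wpmul2l; first by rewrite lee_fin ltW.
rewrite /torus_measure /mrestr; apply: lebesgue_measure_le => y.
move=> /hasP[w hw hy]; have /andP[/andP[w0 w1] w2] := middle_blocks_ok hw.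
split; last by rewrite /= in_itv /=; case/andP: hy => *; apply/andP; split; lra.
case/mapP: hw hy => f; rewrite mem_filter => /andP[hL hf] ->.
rewrite in_middle_block => hm /=.
have := modulated_hilbert_ge L_ge3 hf hL hm.
rewrite [8 * y]mulrC mulfK // => hge.
rewrite gee0_abs; last first.
  apply: le_trans (ereal_sup_ubound _); last by exists 0%N.
  by rewrite lee_fin; case: modulated_hilbert => u v; exact: sqrtr_ge0.
apply: lt_le_trans (ereal_sup_ubound _); last by exists (frequency_shift L + fidx f)%N.
by rewrite lte_fin; apply: lt_le_trans hge; rewrite /l; lra.
Qed.

Let q : R := ratio%:R ^- L.
Let q_gt0 : 0 < q. Proof. by rewrite invr_gt0 exprn_gt0. Qed.
Let qJ : J%:R * q = 2^-1.
Proof.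
rewrite /q -natrX ratio_pow // natrM invfM mulrCA mulfV ?mulr1 //.
by rewrite pnatr_eq0 -lt0n.
Qed.
Let q_le : q <= 2^-1.
Proof. by rewrite -qJ; apply: ler_peMl; [exact: ltW|rewrite ler1n]. Qed.

Lemma upper_width_le j : (0 : R) <= upper_width L j <= q.
Proof.
have e0 : 0 < 8 ^- digit_count L j :> R by rewrite invr_gt0 exprn_gt0.
have e1 : 8 ^- digit_count L j <= 1 :> R.
  by rewrite invf_le1 ?exprn_gt0 // exprn_ege1 // ler1n.
have q0 := q_gt0; rewrite /upper_width -/q.
by apply/andP; split; nra.
Qed.

Lemma lower_width_upper j : lower_width L j = upper_width L j / 8 :> R.
Proof. by rewrite /lower_width /upper_width; lra. Qed.

(** Each level contributes equally to the norm with weight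
    [s log log (1 / s)]. *)
Lemma level_mass j : level_height L j * (upper_width L j * (K j)%:R) = q / 4.
Proof.
rewrite /level_height /upper_width -/K -/q.
have k0 : (K j)%:R != 0 :> R by rewrite pnatr_eq0 -lt0n expn_gt0.
have e0 : 8 ^+ digit_count L j != 0 :> R by rewrite expf_neq0.
by field; rewrite k0 e0.
Qed.

Lemma lorentz_norm_bounds (phi : cumulative R R) (a b : R) : phi 0 = 0 ->
  (forall j s, (j < J)%N -> lower_width L j <= s <= upper_width L j ->
     s * (a * (K j)%:R) <= phi s <= s * (b * (K j)%:R)) ->
  ((a / 128)%:E <= lorentz_norm phi (@extremizer R L) <= (b / 8)%:E)%E.
Proof.
move=> phi0 hphi.
have up j := upper_width_le j.
have up1 j : (0 : R) <= upper_width L j <= (1 : R).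
  by case/andP: (up j) => -> h /=; apply: le_trans (le_trans h q_le) _; lra.
have lo j : (0 : R) <= lower_width L j <= (1 : R).
  by rewrite lower_width_upper; case/andP: (up1 j) => *; apply/andP; split; lra.
have v0 j := @level_height_ge0 R L j.
have vd j := @level_height_double R L L_ge3 j.
have ok := all_blocks_ok L_ge3; have dis := all_blocks_disjoint L_ge3.
have ht := @all_blocks_height R L.
have mass_le j := level_mass j.
apply/andP; split.
  apply: le_trans (lorentz_norm_ge (J := J) phi0 (v := fun j => level_height L j / 2)
    (tau := lower_width L) _ _ _) => //.
  - rewrite lee_fin (_ : a / 128 = \sum_(0 <= j < J) (a * q / 64)).
      rewrite !big_nat; apply: ler_sum => j /andP[_ jJ].
      have /andP[h _] : lower_width L j * (a * (K j)%:R) <= phi (lower_width L j)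
          <= lower_width L j * (b * (K j)%:R).
        apply: hphi => //; rewrite lexx /= lower_width_upper.
        by case/andP: (up j) => *; lra.
      have v2 : 0 <= level_height L j / 2 :> R by rewrite divr_ge0.
      apply: le_trans (ler_wpM2l v2 h); rewrite lower_width_upper.
      rewrite (_ : a * q / 64 = a / 16 * (q / 4)); last by lra.
      by rewrite -(mass_le j) le_eqVlt; apply/orP; left; apply/eqP; field.
    by rewrite sumr_const_nat subn0 -[RHS]mulr_natl -mulrA mulrCA [J%:R * _]mulrA qJ; lra.
  - by move=> j; rewrite divr_ge0.
  - move=> s /andP[s0 s1]; apply: rearrangement_step_ge => // j jJ.
    exact: superlevel_width_gt.
apply: le_trans (lorentz_norm_le (J := J) phi0 (v := level_height L)
  (tau := upper_width L) _ _ _) _ => //.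
- move=> s /andP[s0 s1]; rewrite rearrangement_step_ge0 /=.
  apply: rearrangement_step_le => // j jJ; exact: superlevel_width_le.
- rewrite lee_fin (_ : b / 8 = \sum_(0 <= j < J) (b * q / 4)).
    rewrite !big_nat; apply: ler_sum => j /andP[_ jJ].
    have /andP[_ h] : upper_width L j * (a * (K j)%:R) <= phi (upper_width L j)
        <= upper_width L j * (b * (K j)%:R).
      apply: hphi => //; rewrite lexx andbT lower_width_upper.
      by case/andP: (up j) => *; lra.
    apply: le_trans (ler_wpM2l (v0 j) h) _.
    by rewrite -mulrA -(mass_le j) le_eqVlt; apply/orP; left; apply/eqP; ring.
  by rewrite sumr_const_nat subn0 -[RHS]mulr_natl -mulrA mulrCA [J%:R * _]mulrA qJ; lra.
Qed.

End ExtremizerNorms.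

(** * Boundedness and lacunarity *)

Section BoundedStep.
Context {R : realType}.

Lemma measurable_fracpart : measurable_fun setT (@fracpart R).
Proof.
apply: measurable_funB; first exact: measurable_id.
apply: nondecreasing_measurable => // x y xy.
by rewrite ler_int; exact: le_floor.
Qed.

Lemma measurable_step_fun (s : seq (@block R)) : measurable_fun setT (step_fun s).
Proof.
apply: measurable_sum => w; apply: measurable_funM; first exact: measurable_cst.
rewrite (_ : (fun y => _) = \1_`[bleft w, bright w[ \o @fracpart R).
  apply: measurableT_comp; last exact: measurable_fracpart.
  exact: measurable_indic.
apply/funext => y; rewrite /= indicE; congr (nat_of_bool _)%:R.
by apply/idP/idP; rewrite inE /= in_itv.
Qed.

Lemma step_fun_norm_le (s : seq (@block R)) y :
  `|step_fun s y| <= \sum_(w <- s) `|bheight w|.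
Proof.
apply: le_trans (ler_norm_sum _ _ _) _; apply: ler_sum => w _.
by rewrite normrM; case: in_block; rewrite ?normr1 ?mulr1 ?normr0 ?mulr0.
Qed.

Lemma step_fun_bounded (s : seq (@block R)) : step_fun s \in Lfun (@torus_measure R) +oo.
Proof.
rewrite inE /=; apply/andP; split; rewrite inE /=; first exact: measurable_step_fun.
rewrite /finite_norm unlock; case: ifP => // _.
apply: (@le_lt_trans _ _ (\sum_(w <- s) `|bheight w|)%:E); last exact: ltry.
apply/ess_sup_inf.ess_supP; apply: nearW => y /=.
by rewrite lee_fin; exact: step_fun_norm_le.
Qed.

Lemma lacunary_exp (b : nat) : (1 < b)%N -> lacunary R (fun j => b ^ j)%N.
Proof.
move=> b1; have b0 : (0 < b)%N by exact: ltnW.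
split=> [j|]; first by rewrite expn_gt0 b0.
rewrite (_ : (fun j => _) = (fun=> (b%:R : R)%:E)).
  have [-> _] := cvg_limn_einf_sup (@cvg_cst (\bar R) (b%:R : R)%:E _ \oo _).
  by rewrite lte_fin ltr1n.
apply/funext => j; congr (_%:E); rewrite expnS natrM mulfK //.
by rewrite pnatr_eq0 -lt0n expn_gt0 b0.
Qed.

End BoundedStep.

(** * Weights given near the origin *)

Section Weights.
Context {R : realType}.

Lemma lower_width_gt0 L j : 0 < lower_width L j :> R.
Proof.
by rewrite !mulr_gt0 // invr_gt0 !exprn_gt0 // ltr0n ratio_gt0.
Qed.

(** The widths are at most [ratio ^- L] at all levels, so that they lie in
    any given neighbourhood of [0] when [L] is large. *)
Lemma levels_near0 (P : R -> Prop) : (\forall s \near 0^'+, P s) ->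
  exists2 L0, (3 <= L0)%N & forall L j s, (L0 <= L)%N ->
    lower_width L j <= s <= upper_width L j -> P s.
Proof.
case=> e /= e0 h; pose L0 := (maxn 3 (Num.truncn e^-1).+1).
exists L0; first by rewrite leq_max.
move=> L j s LL /andP[s1 s2].
have L3 : (3 <= L)%N by apply: leq_trans LL; rewrite leq_max.
have /andP[_ u2] := @upper_width_le R L j.
have s0 : 0 < s := lt_le_trans (lower_width_gt0 L j) s1.
apply: h => //=; rewrite sub0r normrN gtr0_norm //.
apply: le_lt_trans (le_trans s2 u2) _.
have L0' : 0 < L%:R :> R by rewrite ltr0n (leq_trans _ L3).
apply: (@le_lt_trans _ _ L%:R^-1).
  rewrite lef_pV2 ?posrE ?exprn_gt0 ?ltr0n ?ratio_gt0 ?(leq_trans _ L3) //.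
  by rewrite -natrX ler_nat ltnW // ltn_expl // ratio_gt1.
rewrite invf_plt ?posrE //; apply: lt_le_trans (truncnS_gt _) _.
by rewrite ler_nat (leq_trans _ LL) // leq_max leqnn orbT.
Qed.

Lemma LloglogL_extremizer (phi : cumulative R R) : LloglogL_weight phi ->
  exists2 L0, (3 <= L0)%N & forall L, (L0 <= L)%N ->
    ((1 / 128)%:E <= lorentz_norm phi (@extremizer R L) <= (5 / 8)%:E)%E.
Proof.
case=> -[phi0 _] /levels_near0[L0 L3 h]; exists L0 => // L LL.
have L_ge3 := leq_trans L3 LL.
apply: lorentz_norm_bounds => // j s _ hs.
have b4 : 4 <= (4 : R) <= 17 by rewrite lexx ler_nat.
have s0 : 0 < s by case/andP: hs => + _; exact: lt_le_trans (lower_width_gt0 L j).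
rewrite (h L j s LL hs) mul1r !ler_pM2l //.
exact: (loglog_bound (ltnW L_ge3) b4 hs).
Qed.

Lemma LloglogLloglogloglogL_extremizer (phi : cumulative R R) :
  LloglogLloglogloglogL_weight phi ->
  exists2 L0, (3 <= L0)%N & forall L, (L0 <= L)%N ->
    ((L%:R / 128)%:E <= lorentz_norm phi (@extremizer R L) <= (55 * L%:R / 8)%:E)%E.
Proof.
case=> -[phi0 _] /levels_near0[L0 L3 h]; exists L0 => // L LL.
have L_ge3 := leq_trans L3 LL.
apply: lorentz_norm_bounds => // j s jJ hs.
have b17 : 4 <= (17 : R) <= 17 by rewrite lexx andbT ler_nat.
have s0 : 0 < s by case/andP: hs => + _; exact: lt_le_trans (lower_width_gt0 L j).
have /andP[h1 h2] := loglog_bound (ltnW L_ge3) b17 hs.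
have /andP[h3 h4] := loglogloglog_bound (ltnW L_ge3) jJ hs.
rewrite (h L j s LL hs) -mulrA !ler_pM2l //.
have k0 : 0 <= (scale_number L j)%:R :> R by [].
have l0 : 0 <= L%:R :> R by [].
apply/andP; split; first by rewrite mulrC ler_pM.
rewrite (_ : 55 * L%:R * _ = 5 * (scale_number L j)%:R * (11 * L%:R)); last by ring.
by apply: ler_pM => //; [exact: le_trans h1|exact: le_trans h3].
Qed.

Lemma extremizer_ge0 L (x : R) : (3 <= L)%N -> 0 <= extremizer L x.
Proof.
move=> L3; rewrite /extremizer /step_fun big_seq; apply: sumr_ge0 => w /(all_blocks_ok L3)[_ h].
by rewrite mulr_ge0.
Qed.

Lemma extremizer_neq0 L : (3 <= L)%N -> exists x : R, extremizer L x != 0.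
Proof.
move=> L3; have J_gt0 : (0 < tower_number L)%N by rewrite expn_gt0.
have := lt_trans (lower_width_gt0 L 0) (@superlevel_width_gt R L L3 0%N J_gt0).
case: (boolP (has (fun w => level_height L 0 <= bheight w) (@all_blocks R L))).
  move=> /hasP[w hw hv] _; exists (bleft w).
  have [/andP[/andP[w0 w1] w2] _] := all_blocks_ok L3 hw.
  rewrite /extremizer (step_fun_in (all_blocks_disjoint L3) hw).
    by rewrite gt_eqF // (lt_le_trans _ hv) // divr_gt0 ?exprn_gt0 // ltr0n expn_gt0.
  by rewrite (@fracpart_itv _ 0) ?subr0 /in_block ?lexx //; apply/andP; split; lra.
move=> /hasPn no; rewrite big_seq_cond big_pred0 ?ltxx // => w.
by case: (boolP (w \in _)) => //= /no/negbTE.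
Qed.

End Weights.

Local Open Scope ereal_scope.

Theorem theorem1 (R : realType) (phi phi0 : cumulative R R)
    (hphi : LloglogL_weight phi)
    (hphi0 : LloglogLloglogloglogL_weight phi0) :
  exists (n : nat -> nat) (f : nat -> R -> R),
    [/\ lacunary R n,
        forall k, periodic (f k) 1%R /\ positive_fun (f k),
        (forall k, f k \in Lfun torus_measure +oo) /\
        (exists c c' : R, (0 < c <= c')%R /\
          forall k, c%:E <= lorentz_norm phi (f k) <= c'%:E),
        lorentz_norm phi0 (f k) @[k --> \oo] --> +oo &
        exists C : R, (0 < C)%R /\
          forall k, C%:E * lorentz_norm phi0 (f k)
                    <= weak_L1 (carleson_lac n (f k))].
Proof.
have [L1 L1_ge3 norm1] := LloglogL_extremizer hphi.
have [L2 L2_ge3 norm2] := LloglogLloglogloglogL_extremizer hphi0.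
pose L k := (maxn L1 L2 + k)%N.
have LL1 k : (L1 <= L k)%N by rewrite /L (leq_trans (leq_maxl _ _) (leq_addr _ _)).
have LL2 k : (L2 <= L k)%N by rewrite /L (leq_trans (leq_maxr _ _) (leq_addr _ _)).
have L3 k : (3 <= L k)%N := leq_trans L1_ge3 (LL1 k).
exists (fun j => 8 ^ j)%N, (fun k => @extremizer R (L k)); split.
- exact: lacunary_exp.
- move=> k; split; first exact: step_fun_periodic.
  split=> [x|]; first exact: extremizer_ge0.
  exact: extremizer_neq0.
- split=> [k|]; first exact: step_fun_bounded.
  exists (1 / 128)%R, (5 / 8)%R; split; first by apply/andP; split; lra.
  by move=> k; exact: norm1.
- apply/cvgeyPge => A; exists (Num.truncn (`|A| * 128)).+1 => // k /= kA.
  have /andP[+ _] := norm2 _ (LL2 k); apply: le_trans.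
  rewrite lee_fin ler_pdivlMr //; apply: (@le_trans _ _ (`|A| * 128)%R).
    by rewrite ler_pM2r // ler_norm.
  apply: le_trans (ltW (truncnS_gt _)) _; rewrite ler_nat.
  exact: leq_trans kA (leq_addl _ _).
- have g0 : (0 < gain_constant :> R)%R by rewrite invr_gt0 mulr_gt0 // ltr0n ratio_gt0.
  exists (gain_constant / 256 / 7)%R; split; first by rewrite !divr_gt0.
  move=> k; apply: le_trans (weak_L1_ge (L3 k)).
  have /andP[_ h] := norm2 _ (LL2 k).
  apply: le_trans (lee_wpmul2l _ h) _; first by rewrite lee_fin !divr_ge0 // ltW.
  rewrite -EFinM lee_fin; have: (0 <= gain_constant * (L k)%:R :> R)%R.
    by rewrite mulr_ge0 // ltW.
  by move: (gain_constant) ((L k)%:R)%R => a b ab; lra.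
Qed.
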